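(* Let $(G,c,o)$ be a recurrent rooted network and let $h_1,h_2$ be potentials on $(G,c,o)$ (possibly equal). Let $\{Y_n\}$ be an $h_1$-process and let $\{Z_n\}$ be an independent $h_2$-process. If $\mathbb{P}\big(|\{Y_n\}\cap\{Z_n\}|<\infty\big)>0$, where $\{Y_n\}$ and $\{Z_n\}$ denote the sets of visited vertices, then the uniform spanning tree (UST) on $(G,c)$ almost surely has more than one end.
   Context: A network $(G,c)$ is an infinite, connected, locally finite graph $G=(V,E)$ with positive edge weights (conductances) $c_{xy}=c_{yx}$, $xy\in E$; put $c_x=\sum_{z\sim x}c_{xz}$. The network random walk is the Markov chain on $V$ with transition probabilities $p(x,y)=c_{xy}/c_x$ for $x\sim y$. The network is recurrent if this walk is recurrent. A rooted network $(G,c,o)$ is a network with a distinguished vertex $o\in V$. The Laplacian of $f:V\to\mathbb{R}$ is $\Delta f(v)=\sum_{x\sim v}c_{vx}(f(x)-f(v))$. A potential on $(G,c,o)$ is a function $h:V\to[0,\infty)$ with $h(o)=0$, $\Delta h(o)=1$ and $\Delta h(v)=0$ for every $v\ne o$. For a potential $h$, the $h$-process is the Markov chain on $S_h=\{v:h(v)>0\}$ with transition probabilities $p^h(x,y)=p(x,y)h(y)/h(x)$, started from the initial distribution $\mu_h(v)=c_{ov}h(v)$, $v\sim o$ (a probability measure since $\Delta h(o)=1$). In a finite network, the (weighted) UST is a random spanning tree drawn with probability proportional to the product of the conductances of its edges. In a recurrent infinite network, the (weighted) UST is the weak limit of the USTs along an exhaustion by finite connected subnetworks; it is almost surely a spanning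 tree of $G$. An infinite graph has a single end if the complement of any finite set of vertices contains a single infinite connected component. *)

(* Defs.v *)
From HB Require Import structures.
From mathcomp Require Import all_boot all_order all_algebra finmap.
From mathcomp Require Import all_classical all_reals all_analysis.

Set Implicit Arguments.
Unset Strict Implicit.
Unset Printing Implicit Defensive.

Import Order.TTheory GRing.Theory Num.Theory.
Import numFieldNormedType.Exports.

Local Open Scope classical_set_scope.
Local Open Scope ring_scope.

Section Graphs.
Variable V : choiceType.

(* Undirected edges are two-element sets of vertices. *)
Definition edge_rel (T : {fset V} -> bool) : rel V :=
  [rel x y | T [fset x; y]%fset].

Definition joined (r : rel V) (x y : V) : Prop :=
  exists2 p : seq V, path r x p & last x p = y.

Definition connected_on (r : rel V) (W : {fset V}) : Prop :=
  forall x y, x \in W -> y \in W -> joined r x y.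

Definition acyclic (r : rel V) : Prop :=
  forall s : seq V, (2 < size s)%N -> ~ ucycle r s.

Definition spanning_tree (W : {fset V}) (F T : {fset {fset V}}) : Prop :=
  [/\ (T `<=` F)%fset,
      connected_on (edge_rel (fun e => e \in T)) W
    & acyclic (edge_rel (fun e => e \in T))].

Definition component_off (r : rel V) (K : {fset V}) (x : V) : set V :=
  [set y | exists p : seq V,
     [/\ path r x p, last x p = y & all (fun z => z \notin K) (x :: p)]].

Definition infinite_component (r : rel V) (K : {fset V}) (C : set V) : Prop :=
  infinite_set C /\ exists2 x, x \notin K & C = component_off r K x.

Definition more_than_one_end (r : rel V) : Prop :=
  exists (K : {fset V}) (C1 C2 : set V),
    [/\ infinite_component r K C1, infinite_component r K C2 & C1 <> C2].

End Graphs.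

(* Local finiteness is part of the data: [nbr x] is the finite set of
   neighbours of [x].  Only the values of [cond] on edges are meaningful. *)
Record network (R : realType) (V : choiceType) := Network {
  nbr : V -> {fset V};
  nbr_sym : forall x y, (x \in nbr y) = (y \in nbr x);
  nbr_irr : forall x, x \notin nbr x;
  nbr_connected : forall x y, joined [rel u v | v \in nbr u] x y;
  vertices_infinite : infinite_set [set: V];
  cond : {fset V} -> R;
  cond_gt0 : forall x y, y \in nbr x -> 0 < cond [fset x; y]%fset
}.

Section Network.
Variables (R : realType) (V : choiceType) (N : network R V).

Definition edge (e : {fset V}) : Prop :=
  exists x y, y \in nbr N x /\ e = [fset x; y]%fset.

Definition conductance (x y : V) : R :=
  if y \in nbr N x then cond N [fset x; y]%fset else 0.

Definition total_conductance (x : V) : R :=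
  \sum_(y <- nbr N x) conductance x y.

Definition walk_prob (x y : V) : R := conductance x y / total_conductance x.

Definition laplacian (f : V -> R) (v : V) : R :=
  \sum_(x <- nbr N v) conductance v x * (f x - f v).

Definition potential (o : V) (h : V -> R) : Prop :=
  [/\ forall v, 0 <= h v, h o = 0, laplacian h o = 1
    & forall v, v != o -> laplacian h v = 0].

(* Discrete state space with countably many reachable states: measurability
   of the [X n] amounts to measurability of the events [X n = v], and the
   Markov property is the one conditional on the exact past, multiplied by
   the probability of that past. *)
Definition markov_chain d (Omega : measurableType d) (P : probability Omega R)
    (X : nat -> Omega -> V) (mu : V -> R) (q : V -> V -> R) : Prop :=
  [/\ forall n v, measurable [set w | X n w = v],
      forall v, P [set w | X 0%N w = v] = (mu v)%:E
    & forall (n : nat) (v : nat -> V),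
        P [set w | forall i, (i <= n.+1)%N -> X i w = v i] =
        (P [set w | forall i, (i <= n)%N -> X i w = v i]
          * (q (v n) (v n.+1))%:E)%E].

(* The law of the walk from [x] does not depend on its realization, so
   recurrence may be tested on any one of them. *)
Definition recurrent : Prop :=
  forall x : V, exists (d : measure_display) (Omega : measurableType d)
    (P : probability Omega R) (X : nat -> Omega -> V),
    markov_chain P X (fun v => (v == x)%:R) walk_prob /\
    P [set w | exists2 n, (0 < n)%N & X n w = x] = 1%E.

(* The initial law and the transitions give no mass to [h = 0] (the division
   by [h x = 0] yields 0), so the chain lives on [h > 0] almost surely. *)
Definition h_process (o : V) (h : V -> R) d (Omega : measurableType d)
    (P : probability Omega R) (X : nat -> Omega -> V) : Prop :=
  markov_chain P X (fun v => conductance o v * h v)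
    (fun x y => walk_prob x y * h y / h x).

Definition finite_connected_subnetwork
    (W : {fset V}) (F : {fset {fset V}}) : Prop :=
  [/\ W != fset0, forall e, e \in F -> edge e /\ (e `<=` W)%fset
    & connected_on (edge_rel (fun e => e \in F)) W].

Definition exhaustion
    (W : nat -> {fset V}) (F : nat -> {fset {fset V}}) : Prop :=
  [/\ forall n, finite_connected_subnetwork (W n) (F n),
      forall n, (W n `<=` W n.+1)%fset /\ (F n `<=` F n.+1)%fset,
      forall v, exists n, v \in W n
    & forall e, edge e -> exists n, e \in F n].

Definition tree_weight (T : {fset {fset V}}) : R := \prod_(e <- T) cond N e.

(* Expectation of [f] under the weighted UST of the finite network (W, F). *)
Definition finite_ust_mean (W : {fset V}) (F : {fset {fset V}})
    (f : ({fset V} -> bool) -> R) : R :=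
  (\sum_(T <- fpowerset F | `[< spanning_tree W F T >])
     tree_weight T * f (fun e => e \in T)) /
  (\sum_(T <- fpowerset F | `[< spanning_tree W F T >]) tree_weight T).

(* [U] is a random element of the compact space 2^{finite vertex sets}, in
   which edge sets embed by extending indicators by 0.  Its law is the weak
   limit of the finite USTs: the means of continuous functions (for the
   product topology) converge. *)
Definition is_ust d (Omega : measurableType d) (P : probability Omega R)
    (U : Omega -> {fset V} -> bool) : Prop :=
  (forall e, measurable [set w | U w e]) /\
  exists (W : nat -> {fset V}) (F : nat -> {fset {fset V}}),
    exhaustion W F /\
    forall f : {ptws {fset V} -> bool} -> R, continuous f ->
      (finite_ust_mean (W n) (F n) f)%:E @[n --> \oo]
        --> (\int[P]_w (f (U w))%:E)%E.

End Network.

Section Processes.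
Variables (V : choiceType) (d : measure_display) (Omega : measurableType d).

Definition process_events (X : nat -> Omega -> V) : set (set Omega) :=
  <<s [set A | exists n v, A = [set w | X n w = v]] >>.

Definition independent_processes (R : realType) (P : probability Omega R)
    (Y Z : nat -> Omega -> V) : Prop :=
  forall A B, process_events Y A -> process_events Z B ->
    P (A `&` B) = (P A * P B)%E.

Definition visited (X : nat -> Omega -> V) (w : Omega) : set V :=
  range (fun n => X n w).

End Processes.

(* Main.v *)
Require Import Defs.
From HB Require Import structures.
From mathcomp Require Import all_boot all_order all_algebra finmap.
From mathcomp Require Import all_classical all_reals all_analysis.
From mathcomp Require Import ring lra.

Set Implicit Arguments.
Unset Strict Implicit.
Unset Printing Implicit Defensive.

Import Order.TTheory GRing.Theory Num.Theory.
Import numFieldNormedType.Exports.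

(* Let K be a ball such that Y and Z meet only inside K with probability at
   least s > 0. Reversing time, an h-process cut off at a large scale is the
   last part of a walk started on a far sphere with a suitable initial measure
   of mass at most 2 and stopped at o. Hence two independent such walks meet
   only inside K with probability of order s, and since tree branches are
   loop erasures of walks, two far vertices have branches towards o that merge
   only inside K; removing K then leaves two components reaching far away.

   Wilson's algorithm enters only through an exchange argument on forests
   written as parent maps: moving the parent of z from y to x only changes the
   weight by the factor c(z,x)/c(z,y), so the law of the root of the tree of x is harmonic in x, and a decreasing
   function of the branch has superharmonic mean. Both the loop erasure bound
   and the comparison with walks then follow from the maximum principle.

   The same tools show that, by recurrence, the tree near o is almost
   independent of the tree far away, which upgrades the uniform lower bound to
   probability one. *)

(** An h-process has infinite paths and no last vertex, so it cannot be reversed as it stands. Its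
    potential [h] is therefore replaced by a function [f] that equals [h] on a ball and vanishes
    outside a larger one. This [f] is the Green potential of a measure [m] on a sphere, and
    reversibility of the network turns walks started from [m] into paths read from [o]. The bound 2
    on the mass of [m] is Green's identity tested against the probability of reaching [o] within [t]
    steps, which recurrence makes at least 1/2 on that sphere. Truncation costs half of s and the
    two masses a factor 4, whence the constant s / 8.

    Only finite-range events pass through the weak limit of the finite trees, so the two branches
    are asked to reach distance [k] only, and [k] grows after that limit. Near independence is a
    one-sided comparison with a forest wired outside a ball; it is applied to an event near [o] and
    to its complement, and the error is the probability that a branch from near [o] ends in the
    wired part. *)

Local Open Scope ring_scope.

(** * Rooted forests as parent maps *)

Section ParentMaps.
Variable T : finType.
Implicit Types (p q phi : {ffun T -> T}) (S X L : {set T}) (x y z : T).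

(** An orbit has at most [#|T|] points before it repeats, so in a forest this is the root of the
    tree of [x]. *)
Definition sink p x := iter #|T| p x.

Definition forest S p :=
  [forall s in S, p s == s] && [forall x, sink p x \in S].

Definition upd p z y : {ffun T -> T} :=
  [ffun x => if x == z then y else p x].

Lemma iter_fix p x n : p x = x -> iter n p x = x.
Proof. by move=> h; elim: n => //= n ->. Qed.

Lemma forestP S p :
  reflect ((forall s, s \in S -> p s = s) /\ forall x, exists k, iter k p x \in S)
          (forest S p).
Proof.
apply: (iffP andP) => [[/forall_inP h1 /forallP h2]|[h1 h2]]; split.
- by move=> s /h1/eqP.
- by move=> x; exists #|T|; apply: h2.
- by apply/forall_inP => s /h1/eqP.
apply/forallP => x; have [k hk] := h2 x.
have hc : fconnect p x (iter k p x) by apply: fconnect_iter.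
have hlt := leq_trans (findex_max hc) (max_card _).
rewrite /sink -(subnK (ltnW hlt)) iterD (iter_findex hc).
by rewrite iter_fix // h1.
Qed.

Lemma forest_fix S p s : forest S p -> s \in S -> p s = s.
Proof. by case/forestP => h _; apply: h. Qed.

Lemma forest_sink S p x : forest S p -> sink p x \in S.
Proof. by case/andP => _ /forallP; apply. Qed.

Lemma sink_eq S p x k : forest S p -> iter k p x \in S -> sink p x = iter k p x.
Proof.
move=> hf hk; have hr := forest_sink x hf.
have [le|lt] := leqP k #|T|.
  by rewrite /sink -(subnK le) iterD iter_fix // (forest_fix hf).
by rewrite -(subnK (ltnW lt)) iterD [RHS]iter_fix // (forest_fix hf).
Qed.

Lemma sink_step S p x : forest S p -> sink p (p x) = sink p x.
Proof.
move=> hf; rewrite /sink -iterSr.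
by rewrite iterS (forest_fix hf) //; apply: forest_sink.
Qed.

Lemma sink_iter S p x k : forest S p -> sink p (iter k p x) = sink p x.
Proof. by move=> hf; elim: k => //= k IH; rewrite (sink_step _ hf). Qed.

Lemma sink_id S p x : forest S p -> x \in S -> sink p x = x.
Proof. by move=> hf hx; apply: (sink_eq (k := 0) hf). Qed.

Lemma iter_agree p q x k z : (forall y, y != z -> p y = q y) ->
  (forall i, (i < k)%N -> iter i q x != z) -> iter k p x = iter k q x.
Proof.
move=> hpq; elim: k => //= k IH h.
by rewrite IH ?hpq // => [|i hi]; apply: h; rewrite ?ltnS // ltnW.
Qed.

Lemma first_visit p x (a : pred T) k : a (iter k p x) ->
  exists j, [/\ (j <= k)%N, a (iter j p x) & forall i, (i < j)%N -> ~~ a (iter i p x)].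
Proof.
move=> hk; have ex : exists j, a (iter j p x) by exists k.
exists (ex_minn ex); case: ex_minnP => j hj hmin; split=> //; first exact: hmin.
by move=> i hi; apply/negP => /hmin; rewrite leqNgt hi.
Qed.

Lemma upd_same p z y : upd p z y z = y.
Proof. by rewrite ffunE eqxx. Qed.

Lemma upd_other p z y x : x != z -> upd p z y x = p x.
Proof. by rewrite ffunE => /negbTE->. Qed.

Lemma upd_upd p z y : p z = z -> upd (upd p z y) z z = p.
Proof.
by move=> h; apply/ffunP => x; rewrite !ffunE; case: eqP => // ->.
Qed.

Lemma never_sink S phi z x k : forest (z |: S) phi -> sink phi x != z ->
  iter k phi x != z.
Proof.
move=> hf; apply: contraNneq => h.
by rewrite (sink_eq (k := k) hf) h ?setU11.
Qed.

Lemma forest_no_cycle S p z j : forest S p -> z \notin S ->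
  iter j.+1 p z != z.
Proof.
move=> hf; apply: contraNneq => hj.
have hm m : iter (j.+1 * m) p z = z.
  by elim: m => [|m IH]; rewrite ?muln0 // mulnS iterD IH.
have /forestP[h1 h2] := hf; have [k hk] := h2 z.
rewrite -(hm k) -(subnK (leq_pmull k (ltn0Sn j))) iterD iter_fix //.
exact: h1.
Qed.

(** Cutting the arrow out of [z] makes [z] a root; attaching [z] to [y] closes a cycle exactly when
    [y] lies in the tree of [z]. *)
Lemma forest_upd S phi z y : z \notin S -> phi z = z ->
  forest S (upd phi z y) = forest (z |: S) phi && (sink phi y != z).
Proof.
move=> zS hz; set p := upd phi z y.
have hpq u : u != z -> p u = phi u by apply: upd_other.
have hqp u : u != z -> phi u = p u by move/hpq.
apply/idP/andP => [hp|[hphi hy]].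
  have hf : forest (z |: S) phi.
    have /forestP[h1 h2] := hp; apply/forestP; split.
      move=> s /setU1P[->//|hs]; rewrite hqp ?h1 //.
      by apply: contraNneq zS => <-.
    move=> x; have [k hk] := h2 x.
    have [/existsP[i /eqP hi]|] := boolP [exists i : 'I_k, iter i p x == z].
      have [j [_ /eqP hj hj']] := first_visit (p := p) (x := x) (a := pred1 z) (k := i) (introT eqP hi).
      by exists j; rewrite (iter_agree hqp) // hj setU11.
    rewrite negb_exists => /forallP h; exists k.
    rewrite (iter_agree hqp) ?inE ?hk ?orbT // => i hi.
    exact: (h (Ordinal hi)).
  split=> //; apply/negP => /eqP hr.
  have [j [_ /eqP hj hj']] := first_visit (p := phi) (x := y) (a := pred1 z) (k := #|T|) (introT eqP hr).
  have := forest_no_cycle j hp zS.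
  by rewrite iterSr /p upd_same (iter_agree hpq) // hj eqxx.
have /forestP[h1 h2] := hphi.
have hy2 : exists k, iter k p y \in S.
  have hn k : iter k phi y != z by apply: never_sink hphi hy.
  exists #|T|; rewrite (iter_agree hpq) //.
  by have := forest_sink y hphi; rewrite /sink !inE (negbTE (hn _)).
apply/forestP; split.
  move=> s hs; rewrite hpq; first by apply: h1; rewrite inE hs orbT.
  by apply: contraNneq zS => <-.
move=> x; have [hr|hr] := eqVneq (sink phi x) z; last first.
  have hn k : iter k phi x != z by apply: never_sink hphi hr.
  exists #|T|; rewrite (iter_agree hpq) //.
  by have := forest_sink x hphi; rewrite /sink !inE (negbTE (hn _)).
have [j [_ /eqP hj hj']] := first_visit (p := phi) (x := x) (a := pred1 z) (k := #|T|) (introT eqP hr).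
have [k hk] := hy2; exists (k.+1 + j)%N.
by rewrite iterD (iter_agree hpq hj') hj iterSr /p upd_same.
Qed.

Definition br p x : {set T} := [set y | fconnect p x y].

Lemma brP p x y : reflect (exists k, y = iter k p x) (y \in br p x).
Proof.
rewrite inE; apply: (iffP idP) => [h|[k ->]]; last exact: fconnect_iter.
by exists (findex p x y); rewrite iter_findex.
Qed.

Lemma br_self p x : x \in br p x.
Proof. by apply/brP; exists 0. Qed.

Lemma br_trans p x y : y \in br p x -> br p y \subset br p x.
Proof. by rewrite inE => h; apply/fintype.subsetP => z; rewrite !inE; apply: connect_trans. Qed.

(* For z outside S, a forest rooted at S is a forest rooted at S and z plus an
   edge from z to a vertex y that does not lie in the tree of z. *)
Section Upd.
Variables (S : {set T}) (phi : {ffun T -> T}) (z y : T).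
Hypotheses (hphi : forest (z |: S) phi) (zS : z \notin S) (hy : sink phi y != z).

Let hz : phi z = z. Proof. by apply: (forest_fix hphi); rewrite setU11. Qed.
Let hp : forest S (upd phi z y). Proof. by rewrite forest_upd // hphi. Qed.

Lemma upd_iter x k : sink phi x != z -> iter k (upd phi z y) x = iter k phi x.
Proof.
move=> hx; apply: iter_agree => [u|i _]; first exact: upd_other.
exact: never_sink hphi hx.
Qed.

Lemma upd_sink_off x : sink phi x != z -> sink (upd phi z y) x = sink phi x.
Proof. exact: upd_iter. Qed.

Lemma upd_sink_self : sink (upd phi z y) z = sink phi y.
Proof. by rewrite -(sink_step _ hp) upd_same upd_sink_off. Qed.

Lemma upd_reach x : sink phi x = z -> z \in br (upd phi z y) x.
Proof.
move=> hx.
have [j [_ /eqP hj hj']] := first_visit (p := phi) (x := x) (a := pred1 z) (k := #|T|) (introT eqP hx).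
apply/brP; exists j; rewrite (@iter_agree _ phi _ _ z) // => u; exact: upd_other.
Qed.

Lemma upd_sink_on x : sink phi x = z -> sink (upd phi z y) x = sink phi y.
Proof.
by move/upd_reach/brP => [k hk]; rewrite -(sink_iter _ k hp) -hk upd_sink_self.
Qed.

Lemma upd_br_off x : sink phi x != z -> br (upd phi z y) x = br phi x.
Proof.
move=> hx; apply/setP => u; apply/brP/brP => -[k ->]; exists k.
  by rewrite upd_iter.
by rewrite upd_iter.
Qed.

Lemma upd_br_self : br (upd phi z y) z = z |: br phi y.
Proof.
apply/setP => u; apply/brP/setU1P => [[[|k] ->]|[->|/brP[k ->]]].
- by left.
- by right; rewrite iterSr upd_same upd_iter //; apply/brP; exists k.
- by exists 0.
- by exists k.+1; rewrite iterSr upd_same upd_iter.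
Qed.

End Upd.
End ParentMaps.

(** * Weighted sums over forests and the exchange argument *)

Section ForestSums.
Variables (R : realFieldType) (T : finType) (c : T -> T -> R).
Hypothesis c_ge0 : forall x y, 0 <= c x y.
Implicit Types (p q phi : {ffun T -> T}) (S X L : {set T}) (x y z : T).
Implicit Types (G : {ffun T -> T} -> R).

Definition wt S p : R := \prod_(x | x \notin S) c x (p x).

Definition Zf S G : R := \sum_(p | forest S p) wt S p * G p.

Lemma wt_ge0 S p : 0 <= wt S p.
Proof. exact: prodr_ge0. Qed.

Lemma wt_upd S phi z y : z \notin S ->
  wt S (upd phi z y) = c z y * wt (z |: S) phi.
Proof.
move=> zS; rewrite /wt (bigD1 z) //= upd_same; congr (_ * _).
apply: eq_big => [x|x]; first by rewrite !inE negb_or andbC.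
by case/andP => _ hx; rewrite upd_other.
Qed.

(** A forest rooted at [S] is the pair of the forest with the arrow out of [z] cut and the parent
    [y] of [z]; the exchanges below act on this pair. *)
Lemma Zf_dec S z G : z \notin S ->
  Zf S G = \sum_(phi | forest (z |: S) phi) wt (z |: S) phi *
             \sum_(y | sink phi y != z) c z y * G (upd phi z y).
Proof.
move=> zS.
under [RHS]eq_bigr do rewrite mulr_sumr.
rewrite pair_big_dep /= /Zf.
rewrite (reindex_onto (fun a : {ffun T -> T} * T => upd a.1 z a.2)
                      (fun p => (upd p z z, p z))) /=; last first.
  move=> p hp; apply/ffunP => x; rewrite !ffunE; case: eqP => // ->//.
apply: eq_big => [[phi y]|[phi y]] /=.
  have [hz|hz] := eqVneq (phi z) z.
    by rewrite forest_upd // upd_upd // upd_same eqxx andbT.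
  apply/andP/andP => -[h1 h2].
    by case/eqP: h2 => /ffunP/(_ z); rewrite upd_same => e _; rewrite -e eqxx in hz.
  by rewrite (forest_fix h1) ?setU11 ?eqxx in hz.
by rewrite wt_upd // => _; rewrite mulrA [c z y * _]mulrC.
Qed.

Lemma Zf_ge0 S G : (forall p, forest S p -> 0 <= G p) -> 0 <= Zf S G.
Proof. by move=> h; apply: sumr_ge0 => p hp; rewrite mulr_ge0 ?wt_ge0 ?h. Qed.

Lemma Zf_le S G1 G2 : (forall p, forest S p -> G1 p <= G2 p) -> Zf S G1 <= Zf S G2.
Proof. by move=> h; apply: ler_sum => p hp; rewrite ler_wpM2l ?wt_ge0 ?h. Qed.

Lemma Zf_eq S G1 G2 : (forall p, forest S p -> G1 p = G2 p) -> Zf S G1 = Zf S G2.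
Proof. by move=> h; apply: eq_bigr => p hp; rewrite h. Qed.

Lemma Zf_add S G1 G2 : Zf S (fun p => G1 p + G2 p) = Zf S G1 + Zf S G2.
Proof. by rewrite /Zf -big_split; apply: eq_bigr => p _; rewrite mulrDr. Qed.

Lemma Zf_scale S a G : Zf S (fun p => a * G p) = a * Zf S G.
Proof. by rewrite /Zf mulr_sumr; apply: eq_bigr => p _; rewrite mulrCA. Qed.

Lemma Zf_sum S (I : Type) (r : seq I) (P : pred I) (G : I -> {ffun T -> T} -> R) :
  Zf S (fun p => \sum_(i <- r | P i) G i p) = \sum_(i <- r | P i) Zf S (G i).
Proof.
rewrite /Zf exchange_big /=; apply: eq_bigr => p _; exact: mulr_sumr.
Qed.

(* Exchanging the two endpoints x and y chosen from z pairs up the forests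
   counted on both sides. *)
Lemma Zf_swap S z (G : T -> {ffun T -> T} -> R) : z \notin S ->
  (forall phi x y, forest (z |: S) phi -> sink phi y != z -> sink phi x != z ->
     G x (upd phi z y) = G z (upd phi z x)) ->
  (forall phi x y, forest (z |: S) phi -> sink phi y != z -> sink phi x = z ->
     G x (upd phi z y) <= G z (upd phi z y)) ->
  \sum_x c z x * Zf S (G x) <= (\sum_x c z x) * Zf S (G z).
Proof.
move=> zS hoff hon.
have -> : \sum_x c z x * Zf S (G x) =
    \sum_(phi | forest (z |: S) phi) wt (z |: S) phi *
      \sum_x \sum_(y | sink phi y != z) c z x * c z y * G x (upd phi z y).
  under eq_bigr do rewrite (Zf_dec _ zS) mulr_sumr.
  rewrite exchange_big /=; apply: eq_bigr => phi _.
  rewrite mulr_sumr; apply: eq_bigr => x _; rewrite mulrCA; congr (_ * _).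
  by rewrite mulr_sumr; apply: eq_bigr => y _; rewrite mulrA.
have -> : (\sum_x c z x) * Zf S (G z) =
    \sum_(phi | forest (z |: S) phi) wt (z |: S) phi *
      \sum_x \sum_(y | sink phi y != z) c z x * c z y * G z (upd phi z y).
  rewrite (Zf_dec _ zS) mulr_sumr; apply: eq_bigr => phi _.
  rewrite mulrCA; congr (_ * _); rewrite mulr_suml; apply: eq_bigr => x _.
  by rewrite mulr_sumr; apply: eq_bigr => y _; rewrite mulrA.
apply: ler_sum => phi hphi; rewrite ler_wpM2l ?wt_ge0 //.
(* If [x] is outside the tree of [z], then [x] and [y] are both admissible parents and can trade
   places. Otherwise [z] cannot be attached to [x], and the two sides are compared on the same
   forest. *)
rewrite [leLHS](bigID (fun x => sink phi x != z)) [leRHS](bigID (fun x => sink phi x != z)) /=.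
apply: lerD.
  rewrite [leRHS]exchange_big /=; apply: ler_sum => x hx; apply: ler_sum => y hy.
  by rewrite (hoff _ _ _ hphi hy hx) [c z x * _]mulrC.
apply: ler_sum => x; rewrite negbK => /eqP hx; apply: ler_sum => y hy.
by rewrite ler_wpM2l ?mulr_ge0 ?hon.
Qed.

(** Attaching [z] to [y] gives the whole tree of [z] the root of [y], so neither case of the
    exchange loses anything. *)
Lemma Zf_harm S z (th : {ffun T -> T} -> R) (g : T -> R) : z \notin S ->
  (forall p y, th (upd p z y) = th p) ->
  \sum_x c z x * Zf S (fun p => th p * g (sink p x)) =
  (\sum_x c z x) * Zf S (fun p => th p * g (sink p z)).
Proof.
move=> zS hth.
have key (g' : T -> R) : \sum_x c z x * Zf S (fun p => th p * g' (sink p x)) <=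
  (\sum_x c z x) * Zf S (fun p => th p * g' (sink p z)).
  apply: Zf_swap => // phi x y hphi hy hx; rewrite !hth.
    by rewrite (upd_sink_off _ hphi) // (upd_sink_self hphi).
  by rewrite (upd_sink_on hphi) // (upd_sink_self hphi).
(* The exchange yields one inequality for every [g]; the other is the same one for [- g]. *)
apply/eqP; rewrite eq_le key /=.
have hN x : Zf S (fun p => th p * - g (sink p x)) = - Zf S (fun p => th p * g (sink p x)).
  by rewrite -mulN1r -Zf_scale; apply: Zf_eq => p _; rewrite mulN1r mulrN.
have /= := key (fun x => - g x).
under eq_bigr do rewrite hN mulrN.
by rewrite hN mulrN sumrN lerN2.
Qed.

(** After the exchange, [z] followed by the branch of [x] is the branch of [z] if [x] is off the
    tree of [z]; otherwise the branch of [x] passes through [z] and contains that of [z]. Iterated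
    along a walk, this compares the branch with the full trace of the walk. *)
Lemma Zf_branch S z (Phi : {set T} -> R) : z \notin S ->
  (forall A B : {set T}, A \subset B -> Phi B <= Phi A) ->
  \sum_x c z x * Zf S (fun p => Phi (z |: br p x)) <=
  (\sum_x c z x) * Zf S (fun p => Phi (br p z)).
Proof.
move=> zS hPhi.
have hz p : br p z = z |: br p z.
  by apply/setP => u; rewrite in_setU1; case: eqP => // ->; rewrite br_self.
rewrite (Zf_eq (S := S) (G2 := fun p => Phi (z |: br p z))); last first.
  by move=> p _; rewrite -hz.
apply: (Zf_swap (G := fun x p => Phi (z |: br p x))) => // phi x y hphi hy hx.
  by rewrite (upd_br_off _ hphi) // -hz (upd_br_self hphi).
apply: hPhi; apply: finset.setUS; apply: br_trans; exact: upd_reach.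
Qed.

Section MaximumPrinciple.
Variable o : T.
Hypothesis c_conn : forall x, connect [rel x y | 0 < c x y] x o.

(** A positive maximum would be attained in [I], where the mean inequality spreads it to all
    neighbours, hence along a path of positive conductances to [o], which is outside [I]. *)
Lemma finite_max_principle (I : {set T}) (u : T -> R) : o \notin I ->
  (forall z, z \in I -> (\sum_x c z x) * u z <= \sum_x c z x * u x) ->
  (forall x, x \notin I -> u x <= 0) -> forall x, u x <= 0.
Proof.
move=> oI hI hout x0.
pose m := [arg max_(i > o) u i]%O.
have hm x : u x <= u m by rewrite /m; case: Order.TotalTheory.arg_maxP => // i _; apply.
apply: le_trans (hm x0) _; rewrite leNgt; apply/negP => mpos.
have step z y : u z = u m -> 0 < c z y -> u y = u m.
  move=> hz hc; have zI : z \in I.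
    by apply: contraLR mpos => /hout; rewrite hz leNgt.
  have := hI _ zI; rewrite mulr_suml -subr_ge0 -sumrB => hs.
  have hterm x : 0 <= c z x * u z - c z x * u x.
    by rewrite -mulrBr mulr_ge0 // subr_ge0 hz.
  have /eqP : \sum_x (c z x * u z - c z x * u x) = 0.
    apply/eqP; rewrite eq_le sumr_ge0 // andbT -oppr_ge0 -sumrN.
    by rewrite (eq_bigr _ (fun i _ => opprB _ _)).
  rewrite psumr_eq0 // => /allP /(_ y (mem_index_enum _)) /=.
  by rewrite -mulrBr mulf_eq0 gt_eqF //= subr_eq0 => /eqP <-.
have : u o = u m.
  have /connectP[s hs ->] := c_conn m.
  elim: s m {mpos hm step} (step) (erefl (u m)) hs => //= y s IH m' st e /andP[h1 h2].
  have ey := st _ _ e h1.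
  by have := IH y; rewrite ey; apply.
by move=> e; have := hout _ oI; rewrite e leNgt mpos.
Qed.

End MaximumPrinciple.
End ForestSums.

Lemma finset_ind_above (T : finType) (P : {set T} -> Prop) (S0 S : {set T}) :
  S0 \subset S -> P S0 ->
  (forall (A : {set T}) z, S0 \subset A -> z |: A \subset S -> z \notin A ->
     P A -> P (z |: A)) -> P S.
Proof.
move=> hS h0 hstep.
elim: {S}_.+1 {-2}S (ltnSn #|S|) hS hstep => // n IH S hn hS hstep.
have [->//|hne] := eqVneq S S0.
have /fintype.subsetPn[z zS zS0] : ~~ (S \subset S0).
  by apply: contra hne => h; rewrite finset.eqEsubset h.
rewrite -(finset.setD1K zS); apply: (hstep); rewrite ?finset.setD1K ?setD11 //.
  by rewrite finset.subsetD1 hS.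
apply: IH; first by rewrite -ltnS (leq_trans _ hn) // ltnS [X in (_ < X)%N](cardsD1 z) zS.
  by rewrite finset.subsetD1 hS.
move=> A u h1 h2; apply: hstep => //; apply: fintype.subset_trans h2 _.
exact: finset.subD1set.
Qed.

(** * Decomposition of a forest along the branches of a vertex set *)

Section Hulls.
Variable T : finType.
Implicit Types (p q tau phi : {ffun T -> T}) (S X L A : {set T}) (x y z : T).

Definition hull L p : {set T} := [set y | [exists v in L, fconnect p v y]].

Definition splice A tau phi : {ffun T -> T} :=
  [ffun x => if x \in A then tau x else phi x].
Definition prune A p : {ffun T -> T} := [ffun x => if x \in A then x else p x].
Definition restr A p : {ffun T -> T} := [ffun x => if x \in A then p x else x].

Lemma hullP L p y :
  reflect (exists2 v, v \in L & exists k, y = iter k p v) (y \in hull L p).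
Proof.
rewrite inE; apply: (iffP exists_inP) => -[v vL].
  by move=> h; exists v => //; exists (findex p v y); rewrite iter_findex.
by move=> [k ->]; exists v => //; apply: fconnect_iter.
Qed.

Lemma hull_sub L p : L \subset hull L p.
Proof. by apply/fintype.subsetP => v vL; apply/hullP; exists v => //; exists 0. Qed.

Lemma hull_iter L p q v k : {in hull L p, q =1 p} -> v \in L ->
  iter k q v = iter k p v.
Proof.
move=> hpq vL; elim: k => //= k ->; apply: hpq.
by apply/hullP; exists v => //; exists k.
Qed.

Lemma eq_hull L p q : {in hull L p, q =1 p} -> hull L q = hull L p.
Proof.
move=> hpq; apply/setP => y.
by apply/hullP/hullP => -[v vL [k ->]]; exists v => //; exists k; rewrite (hull_iter k hpq vL).
Qed.

Lemma splice_in A tau phi : {in A, splice A tau phi =1 tau}.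
Proof. by move=> x hx; rewrite ffunE hx. Qed.

Lemma splice_out A tau phi x : x \notin A -> splice A tau phi x = phi x.
Proof. by rewrite ffunE => /negbTE->. Qed.

Lemma prune_forest S A p : forest S p -> S \subset A -> forest A (prune A p).
Proof.
move=> /forestP[h1 h2] hSA; apply/forestP; split=> [s hs|x]; first by rewrite ffunE hs.
have [k hk] := h2 x.
have [j [_ hj hj']] := first_visit (a := mem A) (fintype.subsetP hSA _ hk).
exists j; suff -> : iter j (prune A p) x = iter j p x by [].
elim: j hj' {hj} => //= j IH hj; rewrite IH => [|i hi]; last by rewrite hj // ltnS ltnW.
by rewrite ffunE (negbTE (hj j (ltnSn _))).
Qed.

Variable o : T.

(** The condition on [restr] makes [tau] the identity off its hull, so that each union of branches
    is represented once. *)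
Definition stem L tau := [&& restr (hull L tau) tau == tau, tau o == o
  & [forall v in L, sink tau v == o]].

Lemma splice_forest L X tau phi : stem L tau -> hull L tau \subset ~: X ->
  o \in L -> forest (hull L tau :|: X) phi ->
  forest (o |: X) (splice (hull L tau) tau phi).
Proof.
set A := hull L tau => /and3P[_ /eqP hto /forall_inP hsink] hAX oL hphi.
have oA : o \in A by apply: (fintype.subsetP (hull_sub _ _)).
have hAp : {in A, splice A tau phi =1 tau} by apply: splice_in.
have toA y : y \in A -> exists k, iter k (splice A tau phi) y = o.
  case/hullP => v vL [k ->]; have hv := eqP (hsink _ vL).
  rewrite -(hull_iter k hAp vL).
  exists #|T|; rewrite -iterD addnC iterD [iter #|T| _ v](hull_iter _ hAp vL).
  rewrite -/(sink tau v) hv iter_fix // hAp //.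
have [h1 h2] := forestP _ _ hphi; apply/forestP; split=> [s|x].
  case/setU1P=> [->|hs]; first by rewrite hAp.
  rewrite splice_out ?h1 ?finset.in_setU ?hs ?orbT //.
  by apply/negP => h; have := fintype.subsetP hAX _ h; rewrite inE hs.
have [k hk] := h2 x.
have [j [_ /= hj hj']] := first_visit (a := mem (A :|: X)) hk.
have hi : iter j (splice A tau phi) x = iter j phi x.
  elim: j hj' {hj} => //= j IH hj; rewrite IH => [|i hi]; last by rewrite hj // ltnS ltnW.
  have := hj j (ltnSn _); rewrite inE negb_or => /andP[h _].
  by rewrite splice_out.
have := hj; rewrite -hi finset.in_setU => /orP[/toA[m hm]|hX].
  by exists (m + j)%N; rewrite iterD hm setU11.
by exists j; rewrite finset.in_setU1 hX orbT.
Qed.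

(** A forest is determined by the branches of [L] and the forest hanging off them. The boolean form,
    membership together with a round trip, is the index condition that [reindex_onto] produces in
    [Zf_stems]. *)
Lemma stem_decomposition L X tau phi : o \in L -> o \notin X ->
  (forest (o |: X) (splice (hull L tau) tau phi) &&
    [forall v in L, sink (splice (hull L tau) tau phi) v == o]) &&
  ((restr (hull L (splice (hull L tau) tau phi)) (splice (hull L tau) tau phi),
    prune (hull L (splice (hull L tau) tau phi)) (splice (hull L tau) tau phi))
     == (tau, phi)) =
  (stem L tau && (hull L tau \subset ~: X)) && forest (hull L tau :|: X) phi.
Proof.
move=> oL oX; set A := hull L tau; set p := splice A tau phi.
have hAp : {in A, p =1 tau} by apply: splice_in.
have oA : o \in A by apply: (fintype.subsetP (hull_sub _ _)).
rewrite (eq_hull hAp) -/A.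
have hrestr : restr A p = restr A tau.
  by apply/ffunP => x; rewrite [LHS]ffunE [RHS]ffunE; case: ifP => // /hAp.
have hsink v : v \in L -> sink p v = sink tau v by move=> vL; apply: hull_iter hAp vL.
apply/andP/andP.
  move=> [/andP[hf /forall_inP hr] /eqP[e1 e2]].
  have hAX : A \subset ~: X.
    apply/fintype.subsetP => y /hullP[v vL [k hk]]; rewrite inE.
    apply: contra oX => yX.
    rewrite -(eqP (hr _ vL)) (sink_eq (k := k) hf) (hull_iter k hAp vL) -hk //.
    by rewrite finset.in_setU1 yX orbT.
  split.
    apply/andP; split => //; apply/and3P; split.
    - by rewrite -hrestr e1.
    - by rewrite -(hAp _ oA) (forest_fix hf) ?setU11.
    - by apply/forall_inP => v vL; rewrite -hsink // hr.
  have -> : phi = prune (A :|: X) p.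
    apply/ffunP => x; rewrite -{1}e2 [LHS]ffunE [RHS]ffunE finset.in_setU.
    case: (x \in A) => //=; case: ifP => // xX.
    by rewrite (forest_fix hf) // finset.in_setU1 xX orbT.
  apply: prune_forest hf _; apply/fintype.subsetP => y /setU1P[->|yX].
    by rewrite finset.in_setU oA.
  by rewrite finset.in_setU yX orbT.
move=> [/andP[ht hAX] hphi]; split.
  apply/andP; split; first exact: splice_forest.
  apply/forall_inP => v vL; rewrite hsink //.
  by case/and3P: ht => _ _ /forall_inP; apply.
apply/eqP; congr (_, _).
  by rewrite hrestr; case/and3P: ht => /eqP.
apply/ffunP => x; rewrite ffunE; case: ifP => hx.
  by rewrite (forest_fix hphi) // finset.in_setU hx.
by rewrite splice_out ?hx.
Qed.

End Hulls.

Section StemSums.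
Variables (R : realFieldType) (T : finType) (c : T -> T -> R) (o : T).
Hypothesis c_ge0 : forall x y, 0 <= c x y.
Implicit Types (p q tau phi : {ffun T -> T}) (S X L A B K : {set T}) (x y z : T).
Implicit Types (G th : {ffun T -> T} -> R).

Local Notation Z := (Zf c).

Definition wt_stem L tau : R := \prod_(x | (x \in hull L tau) && (x != o)) c x (tau x).

Lemma wt_stem_ge0 L tau : 0 <= wt_stem L tau.
Proof. exact: prodr_ge0. Qed.

(** Spatial Markov property: once the branches of [L] are revealed and reach [o] without touching
    [X], the rest is a weighted forest rooted at these branches and [X]. *)
Lemma Zf_stems L X G : o \in L -> o \notin X ->
  Z (o |: X) (fun p => [forall v in L, sink p v == o]%:R * G p) =
  \sum_(tau | stem o L tau && (hull L tau \subset ~: X)) wt_stem L tau *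
    Z (hull L tau :|: X) (fun phi => G (splice (hull L tau) tau phi)).
Proof.
move=> oL oX.
under [RHS]eq_bigr do rewrite /Zf mulr_sumr.
rewrite pair_big_dep /=.
transitivity (\sum_(p | forest (o |: X) p && [forall v in L, sink p v == o])
     wt c (o |: X) p * G p).
  rewrite /Zf [RHS]big_mkcondr /=; apply: eq_bigr => p _.
  by case: ifP => _; rewrite ?mul1r // mul0r mulr0.
rewrite (reindex_onto
   (fun a : {ffun T -> T} * {ffun T -> T} => splice (hull L a.1) a.1 a.2)
   (fun p => (restr (hull L p) p, prune (hull L p) p))) /=; last first.
  move=> p _; have e : hull L (restr (hull L p) p) = hull L p.
    by apply: eq_hull => x hx; rewrite ffunE hx.
  by apply/ffunP => x; rewrite e !ffunE; case: ifP => // h; rewrite ?h.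
apply: eq_big => [[tau phi]|[tau phi]] /=; first exact: stem_decomposition.
rewrite stem_decomposition // => /andP[/andP[_ hAX] _].
rewrite mulrA; congr (_ * _).
rewrite /wt /wt_stem (bigID (fun x => x \in hull L tau)) /=.
congr (_ * _).
  apply: eq_big => [x|x /andP[_ hx]]; last by rewrite splice_in.
  rewrite finset.in_setU1 negb_or andbC; case hx: (x \in hull L tau) => //=.
  by have := fintype.subsetP hAX _ hx; rewrite inE => ->; rewrite andbT.
apply: eq_big => [x|x /andP[_ hx]]; last by rewrite splice_out.
rewrite finset.in_setU1 finset.in_setU !negb_or andbC; case hx: (x \in hull L tau) => //=.
have -> // : x != o.
by apply: contraFneq hx => ->; apply: (fintype.subsetP (hull_sub _ _)).
Qed.

End StemSums.

(** * Locality of the uniform spanning tree *)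

Section Locality.
Variables (R : realFieldType) (T : finType) (c : T -> T -> R) (o : T).
Hypothesis c_ge0 : forall x y, 0 <= c x y.
Hypothesis c_conn : forall x, connect [rel x y | 0 < c x y] x o.
Hypothesis Zo_gt0 : 0 < Zf c [set o] (fun=> 1).
Implicit Types (p q tau phi : {ffun T -> T}) (S X L A B K : {set T}) (x y z : T).
Implicit Types (G th : {ffun T -> T} -> R).

Local Notation Z := (Zf c).
Let mp := finite_max_principle c_ge0 c_conn.

Lemma Zf_dec_invariant S z th : z \notin S ->
  (forall p y, th (upd p z y) = th p) ->
  Z S th = \sum_y c z y * Z (z |: S) (fun p => th p * (sink p y != z)%:R).
Proof.
move=> zS hth; rewrite (Zf_dec c _ zS).
under [RHS]eq_bigr do rewrite /Zf mulr_sumr.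
rewrite [RHS]exchange_big /=; apply: eq_bigr => phi _.
rewrite big_mkcond mulr_sumr; apply: eq_bigr => y _.
case: ifP => _; rewrite ?hth; last by rewrite !mulr0.
by rewrite mulr1 mulrCA.
Qed.

Lemma Zf_gt0 S : o \in S -> 0 < Z S (fun=> 1).
Proof.
move=> oS; apply: (@finset_ind_above _ (fun A => 0 < Z A (fun=> 1)) [set o]) => //.
  by rewrite finset.sub1set.
move=> A z _ _ zA; rewrite (Zf_dec_invariant zA) // => hpos.
rewrite lt0r; apply/andP; split; last by apply: Zf_ge0.
apply: contraTneq hpos => h0; rewrite -leNgt.
apply: sumr_le0 => y _; rewrite mulr_ge0_le0 //.
by rewrite -h0; apply: Zf_le => // p _; rewrite mul1r lern1 leq_b1.
Qed.

Section Boundary.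
Variables (B : {set T}) (th : {ffun T -> T} -> R).
Hypotheses (th_ge0 : forall p, 0 <= th p)
  (th_inv : forall p z y, z \in B -> th (upd p z y) = th p).
Let X := ~: B.

(** Adding the root [z] divides a forest sum by the conductance-weighted sum of the chances that a
    neighbour [y] escapes the tree of [z]. Wiring [X] adds roots other than [z], so it can only help
    [y] to escape. *)
Lemma Zf_step S z : o \in S -> z \in B -> S \subset B -> z \notin S ->
  Z S th * Z (z |: S :|: X) (fun=> 1) <= Z (z |: S) th * Z (S :|: X) (fun=> 1).
Proof.
move=> oS zB SB zS.
have zSX : z \notin S :|: X by rewrite !inE negb_or zS negbK.
have hth p y : th (upd p z y) = th p by apply: th_inv.
rewrite (Zf_dec_invariant zS hth) (Zf_dec_invariant zSX) //.
rewrite finset.setUA mulr_suml mulr_sumr; apply: ler_sum => y _.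
rewrite -mulrA [leRHS]mulrCA ler_wpM2l //.
rewrite -subr_le0.
pose F y := Z (z |: S) (fun p => th p * (sink p y != z)%:R).
pose F' y := Z (z |: S :|: X) (fun p => 1 * (sink p y != z)%:R).
rewrite -/(F y) -/(F' y).
(* Both escape sums are harmonic on [B] off the roots, as [th] ignores arrows out of [B]. At the
   roots they are proportional, and outside [B] the wired one takes its full value. *)
apply: (mp (I := B :\: (z |: S)) (u := fun y => F y * Z (z |: S :|: X) (fun=> 1) -
    Z (z |: S) th * F' y)) => [|w|w].
- by rewrite !inE oS orbT.
- rewrite finset.in_setD => /andP[wzS wB].
  have wX : w \notin z |: S :|: X by rewrite finset.in_setU negb_or wzS inE negbK.
  rewrite mulrBr.
  under [leRHS]eq_bigr do rewrite mulrBr mulrA [c w _ * (Z _ _ * _)]mulrCA.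
  rewrite sumrB -mulr_suml -mulr_sumr.
  rewrite (Zf_harm c_ge0 (fun v => (v != z)%:R) wzS) => [|p v]; last exact: th_inv.
  rewrite (Zf_harm c_ge0 (th := fun=> 1) (fun v => (v != z)%:R) wX) //.
  by rewrite mulrA [X in _ - X <= _]mulrCA.
rewrite finset.in_setD negb_and negbK => /orP[hw|wB].
  have hs (Q : {set T}) p : forest ((z |: S) :|: Q) p -> sink p w = w.
    by move=> hp; apply: (sink_id hp); rewrite finset.in_setU hw.
  have -> : F w = (w != z)%:R * Z (z |: S) th.
    rewrite /F -Zf_scale; apply: Zf_eq => p hp.
    by rewrite (hs finset.set0) ?finset.setU0 // mulrC.
  have -> : F' w = (w != z)%:R * Z (z |: S :|: X) (fun=> 1).
    rewrite /F' -Zf_scale; apply: Zf_eq => p hp.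
    by rewrite (hs X) // mulrC.
  by rewrite subr_le0 -mulrA [leRHS]mulrCA.
have -> : F' w = Z (z |: S :|: X) (fun=> 1).
  apply: Zf_eq => p hp; rewrite (sink_id hp) ?finset.in_setU ?inE ?wB ?orbT //.
  by rewrite mul1r; case: eqP wB => // ->; rewrite zB.
rewrite subr_le0 ler_wpM2r ?Zf_ge0 //.
by apply: Zf_le => // p _; rewrite ler_piMr // lern1 leq_b1.
Qed.

(** By [Zf_step] the ratio of [Z A th] to [Z (A :|: X) 1] grows when a vertex of [B] joins [A]; this
    is telescoped from [[set o]] to [S]. *)
Lemma Zf_logsup S : o \in S -> S \subset B ->
  Z [set o] th * Z (S :|: X) (fun=> 1) <= Z S th * Z (o |: X) (fun=> 1).
Proof.
move=> oS SB.
apply: (@finset_ind_above _ (fun A => Z [set o] th * Z (A :|: X) (fun=> 1) <=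
   Z A th * Z (o |: X) (fun=> 1)) [set o]) => //; first by rewrite finset.sub1set.
move=> A z; rewrite finset.sub1set => oA zAS zA IH.
have /andP[zS AS] : (z \in S) && (A \subset S).
  by have := zAS; rewrite finset.subUset finset.sub1set.
have hpos : 0 < Z (A :|: X) (fun=> 1) by apply: Zf_gt0; rewrite inE oA.
rewrite -(ler_pM2r hpos) mulrAC.
apply: le_trans (ler_wpM2r (Zf_ge0 c_ge0 _) IH) _ => //.
rewrite mulrAC [leRHS]mulrAC ler_wpM2r ?Zf_ge0 //.
apply: Zf_step => //; first exact: (fintype.subsetP SB).
exact: fintype.subset_trans SB.
Qed.

(* The event C is decided by the branches of L, and th by the steps taken
   outside B; a branch that meets the wired boundary X is given up. *)
Lemma Zf_local L (C : {ffun T -> T} -> bool) : o \in L -> o \in B ->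
  (forall p q, {in hull L p, q =1 p} -> C q = C p) ->
  Z [set o] th * Z (o |: X) (fun p => [forall v in L, sink p v == o]%:R * (C p)%:R) <=
  Z [set o] (fun p => (C p)%:R * th p) * Z (o |: X) (fun=> 1).
Proof.
move=> oL oB hC.
have oX : o \notin X by rewrite inE negbK.
rewrite (Zf_stems c _ oL oX) mulr_sumr.
have -> : Z [set o] (fun p => (C p)%:R * th p) =
  Z (o |: finset.set0) (fun p => [forall v in L, sink p v == o]%:R * ((C p)%:R * th p)).
  rewrite finset.setU0; apply: Zf_eq => p hp.
  have -> : [forall v in L, sink p v == o]; last by rewrite mul1r.
  by apply/forall_inP => v _; have := forest_sink v hp; rewrite inE.
rewrite (Zf_stems c _ oL) ?inE // mulr_suml.
(* Stems that leave [B] occur only on the unwired side, where they contribute a nonnegative amount.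
   The remaining stems are common to both sides and [Zf_logsup] compares them one by one. *)
rewrite [leRHS](bigID (fun tau => hull L tau \subset B)) /=.
rewrite -[leLHS]addr0 lerD //; last first.
  by apply: sumr_ge0 => tau _; rewrite !mulr_ge0 ?wt_stem_ge0 ?Zf_ge0 // => p _; rewrite mulr_ge0.
rewrite finset.setC0 [leRHS](eq_bigl (fun tau => stem o L tau && (hull L tau \subset ~: X))); last first.
  by move=> tau; rewrite finset.subsetT andbT finset.setCK.
apply: ler_sum => tau /andP[ht hAX].
have hA : hull L tau \subset B by rewrite -[B]finset.setCK.
rewrite mulrCA -mulrA ler_wpM2l ?wt_stem_ge0 //.
have hCg phi : C (splice (hull L tau) tau phi) = C tau.
  by apply: hC => x hx; rewrite splice_in.
have -> : Z (hull L tau :|: X) (fun phi => (C (splice (hull L tau) tau phi))%:R) =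
   (C tau)%:R * Z (hull L tau :|: X) (fun=> 1).
  by rewrite -Zf_scale; apply: Zf_eq => p _; rewrite hCg mulr1.
(* [th_inv] changes one arrow at a time, so the arrows of the stem are put in place vertex by
   vertex. *)
have hthg phi : th (splice (hull L tau) tau phi) = th phi.
  apply: (@finset_ind_above _ (fun A => th (splice A tau phi) = th phi) finset.set0) => //.
  - exact: finset.sub0set.
  - by congr th; apply/ffunP => x; rewrite ffunE inE.
  move=> A z _ hzA zA <-.
  rewrite -(@th_inv (splice A tau phi) z (tau z)) //; last first.
    by apply: (fintype.subsetP (fintype.subset_trans hzA hA)); rewrite setU11.
  congr th; apply/ffunP => x; rewrite !ffunE in_setU1.
  by case: eqP => [->|].
rewrite finset.setU0.
have -> : Z (hull L tau)
    (fun phi => (C (splice (hull L tau) tau phi))%:R * th (splice (hull L tau) tau phi)) =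
   (C tau)%:R * Z (hull L tau) th.
  by rewrite -Zf_scale; apply: Zf_eq => p _; rewrite hCg hthg.
rewrite mulrCA -mulrA ler_wpM2l // Zf_logsup //.
exact: (fintype.subsetP (hull_sub _ _)).
Qed.

End Boundary.

(* By Wilson's algorithm, this is the probability that the walk from w reaches
   o before A. *)
Definition avoid A w : R :=
  Z (o |: A) (fun p => (sink p w == o)%:R) / Z (o |: A) (fun=> 1).

Lemma avoid_ge0 A w : 0 <= avoid A w.
Proof. by rewrite divr_ge0 ?Zf_ge0. Qed.

Lemma avoid_root A : avoid A o = 1.
Proof.
rewrite /avoid (Zf_eq c (G2 := fun=> 1)) ?divff ?gt_eqF ?Zf_gt0 ?setU11 //.
by move=> p hp; rewrite (sink_id hp) ?setU11 // eqxx.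
Qed.

Lemma avoid_in A w : w \in A -> w != o -> avoid A w = 0.
Proof.
move=> wA wo; rewrite /avoid (Zf_eq c (G2 := fun=> 0 * 1)) ?Zf_scale ?mul0r //.
by move=> p hp; rewrite (sink_id hp) ?finset.in_setU1 ?wA ?orbT // (negbTE wo) ?mulr0.
Qed.

Lemma avoid_harm A z : z \notin o |: A ->
  \sum_x c z x * avoid A x = (\sum_x c z x) * avoid A z.
Proof.
move=> zA; rewrite /avoid mulrA.
under eq_bigr do rewrite mulrA.
rewrite -mulr_suml; congr (_ / _).
have := Zf_harm c_ge0 (th := fun=> 1) (fun v => (v == o)%:R) zA (fun _ _ => erefl).
have e x : Z (o |: A) (fun p => 1 * (sink p x == o)%:R) = Z (o |: A) (fun p => (sink p x == o)%:R).
  by apply: Zf_eq => p _; rewrite mul1r.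
by rewrite e; under eq_bigr do rewrite e.
Qed.

Lemma avoid_anti A A' w : A \subset A' -> avoid A' w <= avoid A w.
Proof.
move=> hAA; rewrite -subr_le0.
apply: (mp (I := ~: (o |: A')) (u := fun w => avoid A' w - avoid A w)) => [|z|z].
- by rewrite !inE eqxx.
- rewrite inE => hz; have hz' : z \notin o |: A.
    by apply: contra hz; apply: fintype.subsetP; apply: finset.setUS.
  rewrite mulrBr; under [leRHS]eq_bigr do rewrite mulrBr.
  by rewrite sumrB !avoid_harm.
rewrite inE negbK in_setU1; have [->|zo] /= := eqVneq z o.
  by rewrite !avoid_root subrr.
by move=> zA; rewrite avoid_in // sub0r oppr_le0 avoid_ge0.
Qed.

(* The event that the branch of w first meets the branch of z inside K. *)
Definition coalesce K z w p := sink (prune (hull [set o; z] p) p) w \in K.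

(** Given the branch of [z], the probability that [w] attaches to it inside [K] is harmonic in [w].
    It dominates [avoid] by its values on the branch: it is 1 in [K], and outside [K] the function
    [avoid] is 0. *)
Lemma coalesce_lb K z w : o \in K ->
  Z [set o] (fun p => avoid (br p z :\: K) w) <= Z [set o] (fun p => (coalesce K z w p)%:R).
Proof.
move=> oK; have oL : o \in [set o; z] by rewrite !inE eqxx.
have hall G : Z [set o] G =
  Z (o |: finset.set0) (fun p => [forall v in [set o; z], sink p v == o]%:R * G p).
  rewrite finset.setU0; apply: Zf_eq => p hp.
  have -> : [forall v in [set o; z], sink p v == o]; last by rewrite mul1r.
  by apply/forall_inP => v _; have := forest_sink v hp; rewrite inE.
rewrite !hall !(Zf_stems c _ oL) ?inE //.
apply: ler_sum => tau /andP[ht _]; rewrite ler_wpM2l ?wt_stem_ge0 //.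
rewrite finset.setU0; set A := hull _ tau.
have hAg phi : {in A, splice A tau phi =1 tau} by apply: splice_in.
have oA : o \in A by apply: (fintype.subsetP (hull_sub _ _)).
have zA : z \in A by apply: (fintype.subsetP (hull_sub _ _)); rewrite !inE eqxx orbT.
have brA phi : br (splice A tau phi) z = br tau z.
  have e k : iter k (splice A tau phi) z = iter k tau z.
    by apply: hull_iter (hAg _) _; rewrite !inE eqxx orbT.
  by apply/setP => y; apply/brP/brP => -[k ->]; exists k; rewrite e.
have brAs : br tau z \subset A.
  by apply/fintype.subsetP => y /brP[k ->]; apply/hullP; exists z; [rewrite !inE eqxx orbT|exists k].
set a := avoid (br tau z :\: K) w.
rewrite (Zf_eq c (G2 := fun=> a * 1)) ?Zf_scale; last by move=> p _; rewrite brA mulr1.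
rewrite (Zf_eq c (G1 := fun phi => (coalesce K z w _)%:R)
  (G2 := fun phi => (sink phi w \in K)%:R)); last first.
  move=> phi hphi; congr (nat_of_bool _)%:R; rewrite /coalesce (eq_hull (hAg phi)) -/A.
  congr (sink _ w \in K); apply/ffunP => x; rewrite ffunE; case: ifP => hx.
    by rewrite (forest_fix hphi).
  by rewrite splice_out ?hx.
rewrite -subr_le0.
pose f x := Z A (fun phi => 1 * (sink phi x \in K)%:R).
have -> : Z A (fun phi => (sink phi w \in K)%:R) = f w.
  by apply: Zf_eq => p _; rewrite mul1r.
apply: (mp (I := ~: A) (u := fun w => avoid (br tau z :\: K) w * Z A (fun=> 1) - f w)) => [|x|x].
- by rewrite inE oA.
- rewrite inE => xA; have xB : x \notin o |: (br tau z :\: K).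
    rewrite in_setU1 negb_or; apply/andP; split; first by apply: contraNneq xA => ->.
    by apply: contra xA; rewrite finset.in_setD => /andP[_]; apply: fintype.subsetP.
  rewrite mulrBr; under [leRHS]eq_bigr do rewrite mulrBr mulrA.
  rewrite sumrB -mulr_suml avoid_harm // mulrA.
  by rewrite (Zf_harm c_ge0 (th := fun=> 1) (fun v => (v \in K)%:R) xA).
rewrite inE negbK => xA.
have -> : f x = (x \in K)%:R * Z A (fun=> 1).
  rewrite /f -Zf_scale; apply: Zf_eq => p hp.
  by rewrite (sink_id hp) // mulrC.
rewrite -mulrBl pmulr_lle0 ?Zf_gt0 // subr_le0.
have [xo|xo] := eqVneq x o; first by rewrite xo avoid_root oK.
have le1 : avoid (br tau z :\: K) x <= 1.
  rewrite ler_pdivrMr ?Zf_gt0 ?setU11 // mul1r; apply: Zf_le => // p _.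
  by rewrite lern1 leq_b1.
case xK: (x \in K) => //=; rewrite avoid_in // finset.in_setD xK /=.
have xbr : x \in br tau z.
  have /hullP[v] := xA; rewrite !inE => /orP[|] /eqP-> [k hk].
    case/and3P: ht => _ /eqP hto _.
    by rewrite hk iter_fix ?eqxx in xo.
  by rewrite hk fconnect_iter.
by rewrite xbr.
Qed.

End Locality.

(** * Branches that merge inside [K] are separated by removing [K] *)

Section Separation.
Variables (T : finType) (o : T) (K : {set T}) (p : {ffun T -> T}).
Hypotheses (hp : forest [set o] p) (oK : o \in K).
Implicit Types (x y z w : T).

Definition par_rel : rel T := [rel u v | (p u == v) || (p v == u)].

(* x is the last vertex before K on the branch of v. *)
Definition gate v x := exists i, [/\ x = iter i p v,
  forall i', (i' <= i)%N -> iter i' p v \notin K & p x \in K].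

Lemma gate_exists v : v \notin K -> exists x, gate v x.
Proof.
move=> vK; have hk : iter #|T| p v \in K.
  by have := forest_sink v hp; rewrite /sink inE => /eqP->.
have [[|j] [_ /= hj hj']] := first_visit (a := mem K) hk; first by rewrite hj in vK.
by exists (iter j p v), j; split=> // i hi; apply: hj'.
Qed.

Lemma gate_uniq v x y : gate v x -> gate v y -> x = y.
Proof.
move=> [i [-> hi1 hi2]] [j [-> hj1 hj2]].
have [hij|hij|->//] := ltngtP i j.
  by have := hj1 i.+1 hij; rewrite iterS hi2.
by have := hi1 j.+1 hij; rewrite iterS hj2.
Qed.

Lemma gate_step v x : v \notin K -> p v \notin K -> gate (p v) x <-> gate v x.
Proof.
move=> hv hpv; split=> -[i [e h1 h2]].
  exists i.+1; split; rewrite ?iterSr // => -[|i'] hi' //.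
  by rewrite iterSr; apply: h1.
case: i e h1 => [|i] e h1; first by rewrite e in h2; rewrite h2 in hpv.
by exists i; split; rewrite -?iterSr // => i' hi'; rewrite -iterSr; apply: h1.
Qed.

(** A vertex and its parent share their gate when both are outside [K], so the gate labels the
    components left by removing [K]. *)
Lemma gate_path s v x : path par_rel v s -> all (fun u => u \notin K) (v :: s) ->
  gate v x -> gate (last v s) x.
Proof.
elim: s v => //= u s IH v /andP[huv hs] /and3P[hv hu hall] hg.
apply: IH => //=; first by rewrite hu.
by case/orP: huv => /eqP e; subst; apply/gate_step.
Qed.

(** A connection off [K] would make the gates equal; the branch of [w] would then meet that of [z]
    no later than at this gate, hence outside [K]. *)
Lemma coalesce_gates z w : z \notin K -> w \notin K -> coalesce o K z w p ->
  exists x y, [/\ gate z x, gate w y & forall s, path par_rel x s -> last x s = y ->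
    ~~ all (fun u => u \notin K) (x :: s)].
Proof.
move=> zK wK hm; have [x hx] := gate_exists zK; have [y hy] := gate_exists wK.
exists x, y; split=> // s hs hl; apply/negP => hall.
have gxx v u : gate v u -> gate u u.
  by move=> [i [e h1 h2]]; exists 0; split=> // -[|//] _ /=; rewrite e; apply: h1.
have exy : x = y.
  have := gate_path hs hall (gxx _ _ hx); rewrite hl.
  by move/gate_uniq => h; apply: h (gxx _ _ hy).
rewrite -exy in hy; have [i [ei _ _]] := hx; have [j [ej hj _]] := hy.
set H := hull [set o; z] p in hm *.
have hH : iter j p w \in H.
  by rewrite -ej; apply/hullP; exists z; [rewrite !inE eqxx orbT|exists i].
have oH : [set o] \subset H.
  by rewrite finset.sub1set; apply: (fintype.subsetP (hull_sub _ _)); rewrite !inE eqxx.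
have [k [hkj /= hk hk']] := first_visit (a := mem H) hH.
have ek : iter k (prune H p) w = iter k p w.
  elim: k hk' {hk hkj} => //= k IH hk; rewrite IH => [|a ha]; last by rewrite hk // ltnS ltnW.
  by rewrite ffunE (negbTE (hk k (ltnSn _))).
have := hm; rewrite /coalesce -/H (sink_eq (k := k) (prune_forest hp oH)) ek //.
by rewrite (negbTE (hj _ hkj)).
Qed.

End Separation.

(** * Spanning trees and parent maps *)

Section Joined.
Variables (V : choiceType) (r : rel V).

Lemma joined_refl x : joined r x x.
Proof. by exists [::]. Qed.

Lemma joined_step x y : r x y -> joined r x y.
Proof. by move=> h; exists [:: y] => //=; rewrite h. Qed.

Lemma joined_trans x y z : joined r x y -> joined r y z -> joined r x z.
Proof.
move=> [s hs <-] [t ht <-]; exists (s ++ t); last by rewrite last_cat.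
by rewrite cat_path hs.
Qed.

Lemma joined_sym x y : symmetric r -> joined r x y -> joined r y x.
Proof.
move=> hr [s hs <-]; elim: s x hs => [|u s IH] x /=; first by move=> _; apply: joined_refl.
case/andP => hxu hs; apply: joined_trans (IH _ hs) _.
by apply: joined_step; rewrite hr.
Qed.

End Joined.

Lemma fset2_eq (V : choiceType) (a b x y : V) : [fset a; b]%fset = [fset x; y]%fset ->
  (a = x /\ b = y) \/ (a = y /\ b = x).
Proof.
move=> e.
have ha : a \in [fset x; y]%fset by rewrite -e !inE eqxx.
have hb : b \in [fset x; y]%fset by rewrite -e !inE eqxx orbT.
have hx : x \in [fset a; b]%fset by rewrite e !inE eqxx.
have hy : y \in [fset a; b]%fset by rewrite e !inE eqxx orbT.
by move: ha hb hx hy; rewrite !inE => /orP[]/eqP-> /orP[]/eqP-> /orP[]/eqP e1 /orP[]/eqP e2;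
  auto.
Qed.

Lemma fset2C (V : choiceType) (a b : V) : [fset a; b]%fset = [fset b; a]%fset.
Proof. by apply/fsetP => x; rewrite !inE orbC. Qed.

Lemma edge_rel_sym (V : choiceType) (T : {fset V} -> bool) : symmetric (edge_rel T).
Proof. by move=> x y; rewrite /edge_rel /= fset2C. Qed.

Section TreeOfParents.
Variables (R : realType) (V : choiceType) (N : network R V).
Variables (W : {fset V}) (F : {fset {fset V}}).
Hypothesis WF : finite_connected_subnetwork N W F.
Variable o : W.
Implicit Types (p q : {ffun W -> W}) (u v x y : W).

Local Notation pair_edge u v := ([fset val u; val v]%fset).

Definition sub_cond u v : R := if pair_edge u v \in F then cond N (pair_edge u v) else 0.

Definition ptree p : {fset {fset V}} :=
  [fset pair_edge x (p x) | x in [pred x | x != o]]%fset.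

Lemma ptreeP p e :
  reflect (exists2 x, x != o & e = pair_edge x (p x)) (e \in ptree p).
Proof. by apply: (iffP (imfsetP _ _ _ _)) => -[x xo ->]; exists x. Qed.

Lemma ptree_edge p u v : (pair_edge u v \in ptree p) =
  ((u != o) && (p u == v)) || ((v != o) && (p v == u)).
Proof.
apply/ptreeP/orP => [[x xo /fset2_eq[[]|[]] /val_inj e1 /val_inj e2]|].
- by left; rewrite e1 xo -e2 eqxx.
- by right; rewrite e2 xo -e1 eqxx.
move=> [] /andP[ho /eqP h]; first by exists u; rewrite // h.
by exists v; rewrite // h fset2C.
Qed.

Lemma F_edge u v : pair_edge u v \in F -> val v \in nbr N (val u).
Proof.
have [_ hF _] := WF; move=> /hF[[x [y [hxy /fset2_eq[[-> ->]|[-> ->]]]]] _] //.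
by rewrite nbr_sym.
Qed.

Lemma sub_cond_gt0 u v : (0 < sub_cond u v) = (pair_edge u v \in F).
Proof.
rewrite /sub_cond; case: ifP => h; last by rewrite ltxx.
by apply: cond_gt0; apply: F_edge.
Qed.

Lemma sub_cond_ge0 u v : 0 <= sub_cond u v.
Proof.
have := sub_cond_gt0 u v; rewrite /sub_cond; case: ifP => // _ h.
by apply: ltW; rewrite h.
Qed.

Section Rel.
Variable T : {fset {fset V}}.
Hypothesis TF : (T `<=` F)%fset.

Definition sub_rel : rel W := [rel u v | pair_edge u v \in T].

Lemma lift_path x s : path (edge_rel (fun e => e \in T)) (val x) s ->
  exists2 s' : seq W, s = map val s' & path sub_rel x s'.
Proof.
elim: s x => [|b s IH] x /=; first by exists [::].
case/andP => hb hs.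
have bW : b \in W.
  have [_ hF _] := WF; have [_ hsub] := hF _ (fsubsetP TF _ hb).
  by apply: (fsubsetP hsub); rewrite !inE eqxx orbT.
have eb : b = val (Sub b bW : W) by rewrite SubK.
rewrite {1}eb in hs; have [s' -> hs'] := IH _ hs.
by exists ((Sub b bW : W) :: s'); rewrite /= ?hs' ?andbT.
Qed.

Lemma joined_connect x y : joined (edge_rel (fun e => e \in T)) (val x) (val y) ->
  connect sub_rel x y.
Proof.
move=> [s hs hl]; have [s' e hs'] := lift_path hs; apply/connectP; exists s' => //.
by apply: val_inj; rewrite -hl e last_map.
Qed.

End Rel.

Lemma sub_connect x : connect [rel u v | 0 < sub_cond u v] x o.
Proof.
have [_ _ hc] := WF; have := joined_connect (fsubset_refl F) (hc _ _ (valP x) (valP o)).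
by apply: connect_sub => u v /= h; apply: connect1; rewrite /= sub_cond_gt0.
Qed.

Lemma ptree_sub p : (forall x, x != o -> pair_edge x (p x) \in F) -> (ptree p `<=` F)%fset.
Proof. by move=> h; apply/fsubsetP => e /ptreeP[x xo ->]; apply: h. Qed.

Section ForestTree.
Variable p : {ffun W -> W}.
Hypothesis hp : forest [set o]%SET p.

Lemma forest_no2cycle x : x != o -> p (p x) != x.
Proof. by move=> xo; have := forest_no_cycle 1 hp (z := x); rewrite inE; apply. Qed.

Lemma forest_connect x : fconnect p x o.
Proof. by have := forest_sink x hp; rewrite inE => /eqP <-; apply: fconnect_iter. Qed.

Definition depth x := findex p x o.

Lemma depth_step x : x != o -> depth x = (depth (p x)).+1.
Proof. by move=> xo; apply: fconnect_findex; rewrite ?forest_connect // eq_sym. Qed.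

Lemma ptree_joined x : joined (edge_rel (fun e => e \in ptree p)) (val x) (val o).
Proof.
have := iter_findex (forest_connect x); rewrite -/(depth x).
move: (depth x) => n; elim: n x => [|n IH] y /=; first by move=> ->; apply: joined_refl.
rewrite -iterS iterSr => h; have [->|yo] := eqVneq y o; first exact: joined_refl.
apply: joined_trans (IH _ h); apply: joined_step.
by rewrite /edge_rel /= ptree_edge yo eqxx.
Qed.

Lemma ptree_connected : connected_on (edge_rel (fun e => e \in ptree p)) W.
Proof.
move=> x y xW yW; apply: joined_trans (ptree_joined (Sub x xW : W)) _.
apply: joined_sym; first exact: edge_rel_sym.
exact: ptree_joined (Sub y yW : W).
Qed.

(** At a vertex of maximal depth on a cycle both cycle neighbours must be its parent, so they
    coincide, which a cycle of length at least 3 excludes. *)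
Lemma ptree_acyclic : acyclic (edge_rel (fun e => e \in ptree p)).
Proof.
move=> s hs /andP[hc hu].
set r := edge_rel _ in hc.
have hrW (a b : V) : r a b -> a \in W.
  case/ptreeP => x xo e; have : a \in [fset a; b]%fset by rewrite !inE eqxx.
  by rewrite e !inE => /orP[] /eqP->; apply: valP.
have sW a : a \in s -> a \in W.
  move=> /(next_cycle hc); exact: hrW.
have [t st] : exists t : seq W, s = map val t.
  elim: s sW {hs hc hu} => [|a s IH] h; first by exists [::].
  have [t ->] := IH (fun b hb => h b (mem_behead (s := a :: s) hb)).
  by exists ((Sub a (h a (mem_head _ _)) : W) :: t).
rewrite st size_map map_inj_uniq in hs hu; last exact: val_inj.
have {hc} hc : cycle [rel u v | pair_edge u v \in ptree p] t.
  by move: hc; rewrite st; case: {st hs hu} t => //= a t; rewrite -map_rcons path_map.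
have [x xt hx] : exists2 x, x \in t & forall y, y \in t -> (depth y <= depth x)%N.
  case: t {st hu hc} hs => // a t _.
  have := @arg_maxnP W a (fun y => y \in a :: t) depth (mem_head _ _).
  by case => x xt hx; exists x.
have [i t' ht'] := rot_to xt.
have hu' : uniq (x :: t') by rewrite -ht' rot_uniq.
have hc' : cycle [rel u v | pair_edge u v \in ptree p] (x :: t') by rewrite -ht' rot_cycle.
have hs' : (2 < size (x :: t'))%N by rewrite -ht' size_rot.
have hx' y : y \in t' -> (depth y <= depth x)%N.
  by move=> hy; apply: hx; rewrite -(mem_rot i) ht' inE hy orbT.
have hadj y : y \in t' -> pair_edge x y \in ptree p -> p x = y.
  move=> yt; rewrite ptree_edge => /orP[/andP[_ /eqP]//|/andP[yo /eqP e]].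
  by have := hx' _ yt; rewrite (depth_step yo) e ltnn.
case: t' hs' hu' hc' {ht'} hx' hadj => //= a t'.
case: (lastP t') => // t'' b _ hu' /andP[h1].
rewrite !rcons_path last_rcons => /andP[_ h2] _ hadj.
have ea := hadj a (mem_head _ _) h1.
have eb : p x = b.
  apply: hadj; last by rewrite fset2C.
  by rewrite !(inE, mem_rcons) eqxx orbT.
have eab : a = b by rewrite -ea.
have /and3P[_ h _] := hu'; case/negP: h.
by rewrite eab mem_rcons in_cons eqxx.
Qed.

Lemma ptree_spanning : (forall x, x != o -> pair_edge x (p x) \in F) ->
  spanning_tree W F (ptree p).
Proof.
by move=> h; split; [exact: ptree_sub|exact: ptree_connected|exact: ptree_acyclic].
Qed.

Lemma ptree_weight : (forall x, x != o -> pair_edge x (p x) \in F) ->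
  tree_weight N (ptree p) = wt sub_cond [set o]%SET p.
Proof.
move=> h; rewrite /tree_weight /ptree big_imfset /=; last first.
  move=> x y xo yo /fset2_eq[[/val_inj]//|[/val_inj e1 /val_inj e2]].
  by have := forest_no2cycle xo; rewrite e2 -e1 eqxx.
rewrite (perm_big (enum [pred x | x != o])) /=; last first.
  apply: uniq_perm; rewrite ?enum_uniq ?enum_finmem_uniq //.
rewrite big_enum /= /wt; apply: eq_big => [x|x xo].
  by rewrite !inE.
by rewrite /sub_cond h.
Qed.

(** Where the maps differ, [q] must use the edge of [p] backwards. This propagates up the [p]
    branch, on which [q] undoes [p], and the branch could never arrive at the common fixed point
    [o]. *)
Lemma ptree_inj q : forest [set o]%SET q -> ptree p = ptree q -> p = q.
Proof.
move=> hq e; apply/ffunP => x.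
have [->|xo] := eqVneq x o.
  by rewrite (forest_fix hp) ?(forest_fix hq) // inE.
have hx y : y != o -> p y = q y \/ q (p y) = y.
  move=> yo; have : pair_edge y (p y) \in ptree q by rewrite -e ptree_edge yo eqxx.
  by rewrite ptree_edge yo => /orP[/eqP|/andP[_ /eqP]]; [left|right].
have [//|hqx] := hx _ xo; exfalso.
have key n : iter n p x != o /\ q (iter n.+1 p x) = iter n p x.
  elim: n => [|n [IH1 IH2]]; first by [].
  have ho : iter n.+1 p x != o.
    apply: contraNneq IH1 => h; rewrite -IH2 h (forest_fix hq) ?inE //.
  split=> //; have [h|//] := hx _ ho.
  have := forest_no2cycle IH1.
  by rewrite -[p (p _)]/(p (iter n.+1 p x)) h IH2 eqxx.
have := (key #|{: W}|).1; have := forest_sink x hp; rewrite /sink inE => /eqP->.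
by rewrite eqxx.
Qed.

End ForestTree.

(** The parent of [x] is a tree neighbour strictly closer to [o]. A tree edge missed in this way
    would close a cycle with the path of [ptree p] between its ends. *)
Lemma ptree_surj (T : {fset {fset V}}) : spanning_tree W F T ->
  exists p, [/\ forest [set o]%SET p, forall x, x != o -> pair_edge x (p x) \in F
    & ptree p = T].
Proof.
move=> [TF Tc Ta]; pose e := sub_rel T.
have hcon x : exists n, [exists t : n.-tuple W, path e x t && (last x t == o)].
  have /connectP[s hs hl] := joined_connect TF (Tc _ _ (valP x) (valP o)).
  by exists (size s); apply/existsP; exists (in_tuple s); rewrite /= hs -hl eqxx.
pose dist x := ex_minn (hcon x).
have hdist x : x != o -> exists2 y, e x y & (dist y < dist x)%N.
  rewrite {2}/dist; case: ex_minnP => n /existsP[[t /= /eqP ht] /andP[h1 h2]] _ xo.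
  case: t ht h1 h2 => [|y t] /=; first by rewrite (negbTE xo).
  move=> <- /andP[hxy hp] hl; exists y => //; rewrite ltnS /dist.
  case: ex_minnP => m _; apply; apply/existsP; exists (in_tuple t).
  by rewrite /= hp hl.
pose p : {ffun W -> W} :=
  [ffun x => if x == o then o else odflt o [pick y | e x y && (dist y < dist x)%N]].
have hp x : x != o -> e x (p x) /\ (dist (p x) < dist x)%N.
  move=> xo; rewrite ffunE (negbTE xo); case: pickP => [y /andP[]//|h].
  by have [y h1 h2] := hdist _ xo; have := h y; rewrite h1 h2.
have fp : forest [set o]%SET p.
  apply/forestP; split=> [x|x]; first by rewrite inE => /eqP->; rewrite ffunE eqxx.
  elim: {x}_.+1 {-2}x (ltnSn (dist x)) => // n IH x hx.
  have [xo|xo] := eqVneq x o; first by exists 0; rewrite /= xo inE.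
  have [_ hd] := hp _ xo; have [|k hk] := IH (p x).
    by apply: leq_trans hd _; rewrite -ltnS.
  by exists k.+1; rewrite iterSr.
have hpF x : x != o -> pair_edge x (p x) \in F.
  by case/hp => h _; apply: (fsubsetP TF).
exists p; split=> //; apply/eqP; rewrite eqEfsubset; apply/andP; split.
  by apply/fsubsetP => a /ptreeP[x /hp[h _] ->].
apply/fsubsetP => a aT; have aF := fsubsetP TF _ aT.
have [_ hF _] := WF; have [[u [v [huv ea]]] aW] := hF _ aF.
have uW : u \in W by apply: (fsubsetP aW); rewrite ea !inE eqxx.
have vW : v \in W by apply: (fsubsetP aW); rewrite ea !inE eqxx orbT.
have [//|ha] := boolP (a \in ptree p); exfalso.
have [s hs hl] := ptree_connected fp uW vW.
case: (shortenP hs) hl => s' hs' hu _ hl.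
apply: (Ta (u :: s')).
  case: s' hs' hu hl => [|b [|b' s']] //= hs' _ hl.
    by rewrite -hl (negbTE (nbr_irr N u)) in huv.
  by move: hs'; rewrite hl /edge_rel /= -ea (negbTE ha).
apply/andP; split=> //=; rewrite rcons_path hl; apply/andP; split.
  apply: sub_path hs' => x y /ptreeP[w /hp[hw _] h].
  by rewrite /edge_rel /= h.
by rewrite /edge_rel /= fset2C -ea.
Qed.

(** Spanning trees correspond to the forests rooted at [o] with arrows in [F]; every other parent
    map has weight 0 because [sub_cond] vanishes off [F]. *)
Lemma spanning_tree_sum (f : ({fset V} -> bool) -> R) :
  \sum_(T <- fpowerset F | `[< spanning_tree W F T >]) tree_weight N T * f (fun e => e \in T) =
  Zf sub_cond [set o]%SET (fun p => f (fun e => e \in ptree p)).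
Proof.
pose good p := forest [set o]%SET p && [forall x, (x != o) ==> (pair_edge x (p x) \in F)].
have goodP p : good p -> forest [set o]%SET p /\ forall x, x != o -> pair_edge x (p x) \in F.
  by case/andP => h1 /forallP h2; split=> // x xo; have := h2 x; rewrite xo.
pose G (T : {fset {fset V}}) : R := tree_weight N T * f (fun e => e \in T).
have -> : Zf sub_cond [set o]%SET (fun p => f (fun e => e \in ptree p)) =
  \sum_(p | good p) G (ptree p).
  rewrite /Zf (bigID (fun p : {ffun W -> W} => [forall x, (x != o) ==> (pair_edge x (p x) \in F)])) /=.
  rewrite [X in _ + X]big1 ?addr0 => [|p /andP[_]].
    by apply: eq_bigr => p /goodP[h1 h2]; rewrite /G ptree_weight.
  rewrite negb_forall => /existsP[x]; rewrite negb_imply => /andP[xo h].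
  rewrite /wt (bigD1 x) ?inE //= /sub_cond (negbTE h).
  by rewrite !mul0r.
transitivity (\sum_(p | good p) \sum_(T <- fpowerset F | `[< spanning_tree W F T >])
   (if T == ptree p then G T else 0)); last first.
  apply: eq_bigr => p /goodP[h1 h2].
  rewrite big_mkcond (bigD1_seq (ptree p)) ?fset_uniq //= ?fpowersetE ?ptree_sub //.
  have -> : `[< spanning_tree W F (ptree p) >] by apply/asboolP/ptree_spanning.
  by rewrite eqxx big1 ?addr0 // => T hT; rewrite (negbTE hT) if_same.
rewrite exchange_big /=; apply: eq_bigr => T /asboolP hT.
have [p [h1 h2 h3]] := ptree_surj hT.
rewrite (bigD1 p) /=; last first.
  by rewrite /good h1; apply/forallP => x; apply/implyP/h2.
rewrite h3 eqxx big1 ?addr0 // => q /andP[/goodP[hq _] qp].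
by case: eqP => // e; rewrite -h3 in e; rewrite (ptree_inj h1 hq e) eqxx in qp.
Qed.

End TreeOfParents.

(** * Walks and tree branches *)

Section PathSums.
Variables (R : realType) (V : choiceType) (N : network R V).
Implicit Types (x y z w : V) (s l : seq V) (D : {fset V}).

Local Notation cd := (conductance N).
Local Notation tc := (total_conductance N).
Local Notation wp := (walk_prob N).

Lemma conductance_sym x y : cd x y = cd y x.
Proof. by rewrite /conductance nbr_sym fset2C. Qed.

Lemma conductance_ge0 x y : 0 <= cd x y.
Proof. by rewrite /conductance; case: ifP => // h; apply/ltW/cond_gt0. Qed.

Lemma conductance_gt0 x y : y \in nbr N x -> 0 < cd x y.
Proof. by rewrite /conductance => h; rewrite h; apply: cond_gt0. Qed.

Lemma conductance_eq0 x y : y \notin nbr N x -> cd x y = 0.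
Proof. by rewrite /conductance => /negbTE->. Qed.

Lemma has_nbr x : exists y, y \in nbr N x.
Proof.
have [y /= yx] : exists y, y <> x.
  apply: contrapT => h; apply: (@vertices_infinite _ _ N).
  apply: (sub_finite_set _ (finite_set1 x)) => y _ /=.
  by apply: contrapT => hy; apply: h; exists y.
have [[|a s] hs hl] := nbr_connected N x y; first by case: yx.
by exists a; case/andP: hs.
Qed.

Lemma total_conductance_gt0 x : 0 < tc x.
Proof.
have [y hy] := has_nbr x; rewrite /total_conductance (bigD1_seq y) ?fset_uniq //=.
rewrite ltr_pwDl ?conductance_gt0 //; apply: sumr_ge0 => z _; exact: conductance_ge0.
Qed.

Lemma walk_prob_ge0 x y : 0 <= wp x y.
Proof. by rewrite divr_ge0 ?conductance_ge0 // ltW ?total_conductance_gt0. Qed.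

Lemma walk_prob_eq0 x y : y \notin nbr N x -> wp x y = 0.
Proof. by move=> h; rewrite /walk_prob conductance_eq0 ?mul0r. Qed.

Lemma sum_walk_prob x : \sum_(y <- nbr N x) wp x y = 1.
Proof. by rewrite -mulr_suml divff // gt_eqF ?total_conductance_gt0. Qed.

Lemma sum_walk_probE x (g : V -> R) :
  tc x * (\sum_(y <- nbr N x) wp x y * g y) = \sum_(y <- nbr N x) cd x y * g y.
Proof.
rewrite mulr_sumr; apply: eq_bigr => y _.
by rewrite /walk_prob mulrA mulrCA divff ?mulr1 // gt_eqF ?total_conductance_gt0.
Qed.

Lemma sum_nbr_eq x D (k : V -> R) (g : V -> R) :
  (forall y, y \notin nbr N x -> k y = 0) -> (nbr N x `<=` D)%fset ->
  \sum_(y <- D) k y * g y = \sum_(y <- nbr N x) k y * g y.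
Proof.
move=> hk hD; apply/esym/big_fset_incl => // y _ hy; by rewrite hk // mul0r.
Qed.

Lemma sum_nbr_le x D (k : V -> R) (g : V -> R) :
  (forall y, y \notin nbr N x -> k y = 0) -> (forall y, 0 <= k y) -> (forall y, 0 <= g y) ->
  \sum_(y <- D) k y * g y <= \sum_(y <- nbr N x) k y * g y.
Proof.
move=> hk k0 g0; rewrite -(sum_nbr_eq (D := D `|` nbr N x)%fset) ?fsubsetUr //.
rewrite [leRHS](big_fsetID _ (mem D)) /=.
have -> : [fset y in (D `|` nbr N x)%fset | y \in D]%fset = D.
  by apply/fsetP => y; rewrite !inE andbC; case: (y \in D).
by rewrite lerDl; apply: sumr_ge0 => y _; rewrite mulr_ge0.
Qed.

Fixpoint lists D k : seq (seq V) :=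
  if k is k'.+1 then [seq x :: s | x <- D, s <- lists D k'] else [:: [::]].

Lemma sum_lists0 D (G : seq V -> R) : \sum_(s <- lists D 0) G s = G [::].
Proof. by rewrite /= big_seq1. Qed.

Lemma sum_listsS D k (G : seq V -> R) :
  \sum_(s <- lists D k.+1) G s = \sum_(x <- D) \sum_(s <- lists D k) G (x :: s).
Proof. by rewrite /= big_allpairs_dep. Qed.

Lemma mem_lists D k s : (s \in lists D k) = (size s == k) && all (fun v => v \in D) s.
Proof.
elim: k s => [|k IH] [|x s] //=.
  by apply/allpairsP => -[[? ?] []].
rewrite eqSS; apply/allpairsP/idP => [[[y t] /= [hy ht [-> ->]]]|].
  by move: ht; rewrite IH => /andP[-> ->]; rewrite hy.
case/and3P => h1 h2 h3; exists (x, s); split=> //=; by rewrite IH h1.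
Qed.

Lemma lists_uniq D k : uniq (lists D k).
Proof.
elim: k => // k IH; apply: allpairs_uniq => //.
by move=> [a s] [b t] _ _ /= [-> ->].
Qed.

Lemma sum_lists_rev D k (G : seq V -> R) :
  \sum_(s <- lists D k) G s = \sum_(s <- lists D k) G (rev s).
Proof.
rewrite -(big_map rev xpredT G); apply: perm_big; apply: uniq_perm.
- exact: lists_uniq.
- by rewrite map_inj_uniq ?lists_uniq //; apply: (can_inj (@revK _)).
move=> s; rewrite mem_lists; apply/idP/mapP => [h|[t ht ->]].
  by exists (rev s); rewrite ?revK // mem_lists size_rev all_rev.
by rewrite size_rev all_rev -mem_lists.
Qed.

Variable o : V.

(** Probability that the walk from [x] runs through [s] and then steps to [o]. *)
Fixpoint walk_to x s : R := if s is y :: s' then wp x y * walk_to y s' else wp x o.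

Lemma walk_to_ge0 x s : 0 <= walk_to x s.
Proof.
elim: s x => [|y s IH] x /=; first exact: walk_prob_ge0.
by rewrite mulr_ge0 ?walk_prob_ge0.
Qed.

(* The second argument of q records the vertices visited so far. *)
Lemma walk_sum_le D (q : V -> seq V -> R) : o \notin D ->
  (forall x l, 0 <= q x l) ->
  (forall x l, x \in D -> \sum_(y <- nbr N x) wp x y * q y (x :: l) <= q x l) ->
  forall t x l, x \in D ->
  \sum_(k < t) \sum_(s <- lists D k) walk_to x s * q o (catrev (x :: s) l) <= q x l.
Proof.
move=> oD q0 hq; elim=> [|t IH] x l xD; first by rewrite big_ord0.
apply: le_trans (hq x l xD).
have hle := sum_nbr_le (o |` D)%fset (@walk_prob_eq0 x) (walk_prob_ge0 x)
  (fun y => q0 y (x :: l)).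
apply: le_trans hle.
(* The term [k = 0] is the immediate step to [o]; the other terms step to some [y] in [D] and fall
   under the induction hypothesis with [x] added to the past. *)
rewrite big_fsetU1 //= big_ord_recl [X in X + _ <= _]big_seq1 lerD2l.
under [leLHS]eq_bigr do rewrite lift0 sum_listsS /=.
rewrite exchange_big /= big_seq [leRHS]big_seq; apply: ler_sum => y yD.
apply: le_trans (ler_wpM2l (walk_prob_ge0 x y) (IH y (x :: l) yD)).
rewrite mulr_sumr; apply: ler_sum => k _; rewrite mulr_sumr.
by apply: ler_sum => s _; rewrite mulrA.
Qed.

Section Subnetwork.
Variables (W : {fset V}) (F : {fset {fset V}}).
Hypothesis WF : finite_connected_subnetwork N W F.
Hypothesis oW : o \in W.

Let r : W := FSetSub oW.
Local Notation c := (sub_cond N (W := W) F).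
Local Notation Z := (Zf c).
Hypothesis Zo_gt0 : 0 < Z [set r]%SET (fun=> 1).

Let c_ge0 := sub_cond_ge0 WF.
Let c_conn := sub_connect WF r.

(** At such a vertex the finite network and [N] have the same conductances, so the forest identities
    become statements about the walk on [N]. *)
Definition full x := [/\ x \in W & forall y, y \in nbr N x -> [fset x; y]%fset \in F].

Definition ext (g : W -> R) x : R := if insub x is Some v then g v else 0.

Lemma extE g (v : W) : ext g (val v) = g v.
Proof. by rewrite /ext valK. Qed.

Lemma ext_sum (g : W -> R) (u : W) : full (val u) ->
  \sum_v c u v * g v = \sum_(y <- nbr N (val u)) cd (val u) y * ext g y.
Proof.
move=> [uW hF]; have [_ hFW _] := WF.
rewrite -(sum_nbr_eq (D := W)); last 2 first.
- by move=> y; apply: conductance_eq0.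
- apply/fsubsetP => y hy; have [_ /fsubsetP] := hFW _ (hF _ hy); apply.
  by rewrite !inE eqxx orbT.
rewrite big_seq_fsetE /=; apply: eq_bigr => v _; rewrite extE; congr (_ * _).
rewrite /sub_cond /conductance; case: ifP => h.
  by rewrite (F_edge WF h).
by case: ifP => // /hF; rewrite h.
Qed.

Lemma ext_total (u : W) : full (val u) -> \sum_v c u v = tc (val u).
Proof.
move=> hu; rewrite (eq_bigr (fun v => c u v * 1)); last by move=> v _; rewrite mulr1.
rewrite (ext_sum (fun=> 1)) // /total_conductance big_seq [RHS]big_seq.
apply: eq_bigr => y hy; have [_ hF] := hu; have [_ hFW _] := WF.
have yW : y \in W.
  by have [_ /fsubsetP] := hFW _ (hF _ hy); apply; rewrite !inE eqxx orbT.
by rewrite (_ : y = val (FSetSub yW)) // extE mulr1.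
Qed.

Lemma ext_superharmonic (g g' : W -> R) (u : W) : full (val u) ->
  \sum_v c u v * g v <= (\sum_v c u v) * g' u ->
  \sum_(y <- nbr N (val u)) wp (val u) y * ext g y <= g' u.
Proof.
move=> hu; rewrite (ext_sum _ hu) (ext_total hu) -sum_walk_probE.
by rewrite ler_pM2l ?total_conductance_gt0.
Qed.

Definition vset l : {set W} := [set v | val v \in l]%SET.

Section Branches.
Variables (D K : {fset V}) (m1 m2 : V -> R).
Hypotheses (oD : o \notin D) (hD : forall x, x \in D -> full x) (oK : o \in K).
Hypotheses (m1_ge0 : forall x, 0 <= m1 x) (m2_ge0 : forall x, 0 <= m2 x).

Let Ks := vset K.

Definition disjoint_off l l' := all (fun v => (v \in K) || (v \notin l')) l.

Let rK : r \in Ks. Proof. by rewrite inE. Qed.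

(** [avoid] times the indicator that the past misses [l] is superharmonic along the walk, and at [o]
    it is that indicator. *)
Lemma avoid_walks l t w : w \in D -> o \notin l ->
  \sum_(k < t) \sum_(s <- lists D k) walk_to w s * (all (fun v => v \notin l) (w :: s))%:R <=
  ext (avoid c r (vset l)) w.
Proof.
move=> wD ol.
pose q x (l' : seq V) := ext (avoid c r (vset l)) x * (all (fun v => v \notin l) l')%:R.
have av0 x : 0 <= ext (avoid c r (vset l)) x.
  by rewrite /ext; case: insubP => // u _ _; apply: avoid_ge0.
have q0 x l' : 0 <= q x l' by rewrite mulr_ge0.
have hq x l' : x \in D -> \sum_(y <- nbr N x) wp x y * q y (x :: l') <= q x l'.
  move=> xD; rewrite /q /=; case: (boolP (x \in l)) => xl /=.
    by rewrite big1 ?mulr_ge0 // => y _; rewrite !mulr0.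
  under eq_bigr do rewrite mulrA.
  rewrite -mulr_suml ler_wpM2r //.
  have [xW _] := hD xD; rewrite (_ : x = val (FSetSub xW)) // extE.
  apply: ext_superharmonic; first by apply: hD.
  rewrite avoid_harm // finset.in_setU1 !inE negb_or xl andbT.
  by apply: contraNneq oD => /(congr1 val) /= <-.
have -> : ext (avoid c r (vset l)) w = q w [::] by rewrite /q /= mulr1.
apply: le_trans (walk_sum_le oD q0 hq t [::] wD).
apply: ler_sum => k _; apply: ler_sum => s _.
rewrite ler_wpM2l ?walk_to_ge0 // /q catrevE cats0 all_rev.
by rewrite (_ : o = val r) // extE avoid_root ?mul1r.
Qed.

Let Phi (A : {set W}) := \sum_(w <- D) m2 w * ext (avoid c r A) w.

Let Phi_anti (A B : {set W}) : A \subset B -> Phi B <= Phi A.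
Proof.
move=> AB; apply: ler_sum => w _; rewrite ler_wpM2l // /ext.
by case: insubP => // u _ _; apply: (avoid_anti c_ge0 c_conn).
Qed.

Let Phi_ge0 (A : {set W}) : 0 <= Phi A.
Proof.
apply: sumr_ge0 => w _; rewrite mulr_ge0 // /ext.
by case: insubP => // u _ _; apply: avoid_ge0.
Qed.

(** [q x l], the mean of [Phi] over the branch of [x] joined to the past [l], is superharmonic along
    the walk by [Zf_branch]. At [o] the branch is a single point of [K], so only the trace of the
    walk is left. *)
Lemma branch_walks t z : z \in D ->
  Z [set r]%SET (fun=> 1) * \sum_(k < t) \sum_(s <- lists D k) walk_to z s *
      Phi (vset (z :: s) :\: Ks) <=
  ext (fun u => Z [set r]%SET (fun p => Phi (br p u :\: Ks))) z.
Proof.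
move=> zD.
pose q x l := ext (fun u => Z [set r]%SET (fun p => Phi ((br p u :|: vset l) :\: Ks))) x.
have q0 x l : 0 <= q x l.
  by rewrite /q /ext; case: insubP => // u _ _; apply: Zf_ge0.
have hq x l : x \in D -> \sum_(y <- nbr N x) wp x y * q y (x :: l) <= q x l.
  move=> xD; have [xW _] := hD xD.
  pose g l' (u : W) := Z [set r]%SET (fun p => Phi ((br p u :|: vset l') :\: Ks)).
  rewrite -[q x l]/(ext (g l) (val (FSetSub xW))) extE.
  apply: (@ext_superharmonic (g (x :: l)) (g l) (FSetSub xW)); first exact: hD.
  have xr : FSetSub xW \notin [set r]%SET.
    by rewrite inE; apply: contraNneq oD => /(congr1 val) /= <-.
  have := Zf_branch c_ge0 (Phi := fun A => Phi ((A :|: vset l) :\: Ks)) xr.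
  move=> /(_ (fun A B AB => Phi_anti (finset.setSD _ (finset.setSU _ AB)))).
  apply: le_trans; rewrite le_eqVlt; apply/orP; left; apply/eqP.
  apply: eq_bigr => v _; congr (_ * _); apply: Zf_eq => p _; congr (Phi _).
  by apply/setP => u; rewrite !inE -val_eqE /= orbCA orbA.
have -> : ext (fun u => Z [set r]%SET (fun p => Phi (br p u :\: Ks))) z = q z [::].
  rewrite /q; congr (ext _ z); apply: funext => u; apply: Zf_eq => p _.
  by congr (Phi _); apply/setP => v; rewrite !inE orbF.
apply: le_trans (walk_sum_le oD q0 hq t [::] zD).
rewrite mulr_sumr; apply: ler_sum => k _; rewrite mulr_sumr; apply: ler_sum => s _.
rewrite mulrCA ler_wpM2l ?walk_to_ge0 // /q (_ : o = val r) // extE.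
rewrite mulrC -Zf_scale; apply: Zf_le => // p hp; rewrite mulr1.
apply: Phi_anti; apply/fintype.subsetP => v; rewrite !inE catrevE cats0.
case/andP => vK; have -> : fconnect p r v = (v == r).
  have e i : iter i p r = r by rewrite iter_fix // (forest_fix hp) ?inE.
  by apply/idP/eqP => [/iter_findex <-|->//]; rewrite e.
case/orP => [/eqP e|]; first by rewrite e /= oK in vK.
by rewrite mem_rev inE vK.
Qed.

(** With the first walk fixed, [avoid_walks] bounds the second; then [branch_walks] replaces the
    trace of the first by the branch of [z], and [coalesce_lb] turns the result into merging inside
    [K]. *)
Lemma coalesce_walks t :
  Z [set r]%SET (fun=> 1) *
  \sum_(z <- D) m1 z * \sum_(k < t) \sum_(s <- lists D k) walk_to z s *
    \sum_(w <- D) m2 w * \sum_(k' < t) \sum_(s' <- lists D k') walk_to w s' *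
      (disjoint_off (z :: s) (w :: s'))%:R <=
  \sum_(z <- D) m1 z * \sum_(w <- D) m2 w *
    ext (fun u => ext (fun v => Z [set r]%SET (fun p => (coalesce r Ks u v p)%:R)) w) z.
Proof.
rewrite mulr_sumr big_seq [leRHS]big_seq; apply: ler_sum => z zD.
rewrite mulrCA ler_wpM2l //.
have hb := branch_walks t zD.
have hle : Z [set r]%SET (fun=> 1) * (\sum_(k < t) \sum_(s <- lists D k) walk_to z s *
    \sum_(w <- D) m2 w * \sum_(k' < t) \sum_(s' <- lists D k') walk_to w s' *
      (disjoint_off (z :: s) (w :: s'))%:R) <=
  Z [set r]%SET (fun=> 1) * (\sum_(k < t) \sum_(s <- lists D k) walk_to z s *
      Phi (vset (z :: s) :\: Ks)).
  rewrite ler_wpM2l ?(ltW Zo_gt0) //; apply: ler_sum => k _.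
  rewrite big_seq [leRHS]big_seq; apply: ler_sum => s hs.
  rewrite ler_wpM2l ?walk_to_ge0 // /Phi big_seq [leRHS]big_seq; apply: ler_sum => w wD.
  rewrite ler_wpM2l //.
  have -> : vset (z :: s) :\: Ks = vset [seq v <- z :: s | v \notin K].
    by apply/setP => v; rewrite !inE mem_filter.
  apply: le_trans (avoid_walks t wD _); last by rewrite mem_filter oK.
  apply: ler_sum => k' _; apply: ler_sum => s' _.
  rewrite ler_wpM2l ?walk_to_ge0 // ler_nat.
  case h : (disjoint_off _ _) => //; rewrite lt0b; apply/allP => v hv.
  rewrite mem_filter negb_and negbK; case: (boolP (v \in K)) => //= vK.
  apply/negP => hvz; have := allP h _ hvz; by rewrite (negbTE vK) /= hv.
apply: (le_trans hle); apply: (le_trans hb).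
have [zW _] := hD zD; rewrite (_ : z = val (FSetSub zW)) // extE.
rewrite /Phi Zf_sum big_seq [leRHS]big_seq; apply: ler_sum => w wD.
rewrite Zf_scale ler_wpM2l // extE.
have [wW _] := hD wD; rewrite (_ : w = val (FSetSub wW)) // extE.
rewrite (Zf_eq c (G2 := fun p => avoid c r (br p (FSetSub zW) :\: Ks) (FSetSub wW))); last first.
  by move=> p _; rewrite extE.
exact: (coalesce_lb c_ge0 c_conn).
Qed.

End Branches.
End Subnetwork.
End PathSums.

Local Open Scope classical_set_scope.
Local Open Scope ring_scope.

(** * Recurrence *)

Section Survival.
Variables (R : realType) (V : choiceType) (N : network R V) (o : V).
Implicit Types (x y z w : V) (s l : seq V) (D : {fset V}) (a : pred V) (g h : V -> R).

Local Notation cd := (conductance N).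
Local Notation tc := (total_conductance N).
Local Notation wp := (walk_prob N).

Fixpoint nball n : {fset V} :=
  if n is n'.+1 then (nball n' `|` \bigcup_(x <- nball n') nbr N x)%fset else [fset o]%fset.

Lemma nball_leS n : (nball n `<=` nball n.+1)%fset.
Proof. exact: fsubsetUl. Qed.

Lemma nball_le m n : (m <= n)%N -> (nball m `<=` nball n)%fset.
Proof.
elim: n => [|n IH]; first by rewrite leqn0 => /eqP->.
rewrite leq_eqVlt => /orP[/eqP->//|]; rewrite ltnS => /IH h.
exact: fsubset_trans h (nball_leS n).
Qed.

Lemma nball_root n : o \in nball n.
Proof. by apply: (fsubsetP (nball_le (leq0n n))); rewrite inE. Qed.

Lemma nball_nbr n x y : x \in nball n -> y \in nbr N x -> y \in nball n.+1.
Proof.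
move=> hx hy; rewrite /= inE; apply/orP; right.
by apply/bigfcupP; exists x; rewrite ?hx.
Qed.

Lemma nball_exhausts x : exists n, x \in nball n.
Proof.
have [s hs <-] := nbr_connected N o x.
have: o \in nball 0 by rewrite inE.
elim: s o (0 : nat) hs => [|y s IH] u n /=; first by move=> _ h; exists n.
by case/andP => hu hs h; apply: (IH y n.+1 hs); apply: nball_nbr hu.
Qed.

Lemma nball_exhausts_fset D : exists n, (D `<=` nball n)%fset.
Proof.
have [n hn] : exists n, forall x, x \in enum_fset D -> x \in nball n.
  elim: (enum_fset D) => [|x s [n hn]]; first by exists 0.
  have [k hk] := nball_exhausts x; exists (maxn n k) => y; rewrite inE => /orP[/eqP->|/hn].
    by apply: (fsubsetP (nball_le _)) hk; rewrite leq_maxr.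
  by apply: (fsubsetP (nball_le _)); rewrite leq_maxl.
by exists n; apply/fsubsetP.
Qed.

Lemma sum_nbr_supp x D (k G : V -> R) : (forall y, y \notin nbr N x -> k y = 0) ->
  (forall y, y \in nbr N x -> y \notin D -> G y = 0) ->
  \sum_(y <- D) k y * G y = \sum_(y <- nbr N x) k y * G y.
Proof.
move=> hk hG; rewrite -(@sum_nbr_eq _ _ N x (D `|` nbr N x)%fset) ?fsubsetUr //.
apply: big_fset_incl; first exact: fsubsetUl.
by move=> y; rewrite inE => /orP[->//|hy] yD; rewrite hG ?mulr0.
Qed.

(** Mean of [g] at time [k] for the walk from [x], on the event that it has stayed in [a]. *)
Fixpoint surv a g k x : R := (a x)%:R *
  (if k is k'.+1 then \sum_(y <- nbr N x) wp x y * surv a g k' y else g x).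

Lemma surv_ge0 a g k x : (forall y, 0 <= g y) -> 0 <= surv a g k x.
Proof.
move=> g0; elim: k x => [|k IH] x /=; rewrite mulr_ge0 //.
by apply: sumr_ge0 => y _; rewrite mulr_ge0 ?walk_prob_ge0.
Qed.

Lemma survS a g k x : a x -> surv a g k.+1 x = \sum_(y <- nbr N x) wp x y * surv a g k y.
Proof. by rewrite /= => ->; rewrite mul1r. Qed.

Lemma surv_out a g k x : ~~ a x -> surv a g k x = 0.
Proof. by case: k => [|k] /= /negbTE->; rewrite mul0r. Qed.

Lemma surv_le a g k x : (forall y, 0 <= g y) ->
  (forall y, a y -> \sum_(z <- nbr N y) wp y z * g z <= g y) -> surv a g k x <= g x.
Proof.
move=> g0 hg; elim: k x => [|k IH] x.
  by rewrite /=; case: (a x); rewrite ?mul1r ?mul0r.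
have [ax|ax] := boolP (a x); last by rewrite surv_out.
rewrite survS //; apply: le_trans (hg _ ax).
by apply: ler_sum => y _; rewrite ler_wpM2l ?walk_prob_ge0.
Qed.

Fixpoint chain (q : V -> V -> R) x s : R := if s is y :: s' then q x y * chain q y s' else 1.

(** In [k] steps a walk from the ball of radius [j] stays in the ball of radius [j + k], so
    restricting the path sum to [D] drops only paths that leave [a]. *)
Lemma surv_lists a g j k x D : x \in nball j ->
  (forall y, y \in nball (j + k) -> a y -> y \in D) ->
  \sum_(l <- lists D k) chain wp x l * (all a (x :: l))%:R * g (last x l) = surv a g k x.
Proof.
elim: k x j => [|k IH] x j hx hD; first by rewrite sum_lists0 /= andbT mul1r.
rewrite sum_listsS; have [ax|ax] := boolP (a x); last first.
  rewrite surv_out // big1 // => y _; rewrite big1 // => l _.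
  by rewrite /= (negbTE ax) mulr0 mul0r.
rewrite survS // -(@sum_nbr_supp x D); last 2 first.
- by move=> y; apply: walk_prob_eq0.
- move=> y hy yD; rewrite surv_out //; apply: contra yD => ay; apply: hD => //.
  by rewrite addnS; apply: (fsubsetP (nball_le _)) (nball_nbr hx hy); rewrite ltnS leq_addr.
apply: eq_bigr => y _.
have [hy|hy] := boolP (y \in nbr N x); last first.
  rewrite walk_prob_eq0 // mul0r big1 // => l _; by rewrite /= walk_prob_eq0 // !mul0r.
rewrite -(IH y j.+1) ?mulr_sumr; last 2 first.
- exact: nball_nbr hx hy.
- by move=> z; rewrite addSnnS; apply: hD.
by apply: eq_bigr => l _; rewrite /= ax /= !mulrA.
Qed.

Lemma surv_lists_root a g n D (k : V -> R) : (forall y, y \notin nbr N o -> k y = 0) ->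
  (forall y, y \in nball n.+1 -> a y -> y \in D) ->
  \sum_(y <- D) k y * \sum_(l <- lists D n) chain wp y l * (all a (y :: l))%:R * g (last y l) =
  \sum_(y <- nbr N o) k y * surv a g n y.
Proof.
move=> hk hD; have hb y : y \in nbr N o -> y \in nball 1.
  exact: nball_nbr (nball_root 0).
rewrite -(@sum_nbr_supp o D) //; last first.
  move=> y hy yD; rewrite surv_out //; apply: contra yD => ay; apply: hD => //.
  by apply: (fsubsetP (nball_le _)) (hb _ hy).
apply: eq_bigr => y _; have [hy|hy] := boolP (y \in nbr N o); last by rewrite hk ?mul0r.
by rewrite -(@surv_lists a g 1 n y D) ?hb // => z; rewrite add1n; apply: hD.
Qed.

Definition noto : pred V := [pred x | x != o].

(** [sv k x] is the probability that the walk from [x] has not visited [o] by time [k]. *)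
Local Notation sv := (surv noto (fun=> 1)).

Lemma sv_le1 k x : sv k x <= 1.
Proof.
apply: (surv_le (g := fun=> 1)) => // y _.
by under eq_bigr do rewrite mulr1; rewrite sum_walk_prob.
Qed.

Lemma sv_ge0 k x : 0 <= sv k x.
Proof. exact: surv_ge0. Qed.

Lemma sv_root k : sv k o = 0.
Proof. by rewrite surv_out // /noto /= eqxx. Qed.

Lemma sv_leS k x : sv k.+1 x <= sv k x.
Proof.
have [ax|ax] := boolP (noto x); last by rewrite !surv_out.
elim: k x ax => [|k IH] x ax.
  by apply: le_trans (sv_le1 _ _) _; rewrite /= ax mulr1.
rewrite !(survS _ _ ax) //; apply: ler_sum => y _.
rewrite ler_wpM2l ?walk_prob_ge0 //.
have [ay|ay] := boolP (noto y); last by rewrite !surv_out.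
exact: IH.
Qed.

Lemma sv_le j k x : (j <= k)%N -> sv k x <= sv j x.
Proof.
elim: k => [|k IH]; first by rewrite leqn0 => /eqP->.
rewrite leq_eqVlt => /orP[/eqP->//|]; rewrite ltnS => /IH; apply: le_trans; exact: sv_leS.
Qed.

Lemma sv_superharm k x : x != o -> \sum_(y <- nbr N x) wp x y * sv k y <= sv k x.
Proof. by move=> xo; rewrite -survS // sv_leS. Qed.

Lemma sv_outside k x : x \notin nball k -> sv k x = 1.
Proof.
elim: k x => [|k IH] x hx; first by move: hx; rewrite inE /= /noto /= => ->; rewrite mulr1.
have xo : noto x by apply: contraNneq hx => ->; apply: nball_root.
rewrite survS // -[RHS](sum_walk_prob N x) big_seq [RHS]big_seq; apply: eq_bigr => y hy.
rewrite IH ?mulr1 //; apply: contra hx => yk; apply: nball_nbr yk _.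
by rewrite nbr_sym.
Qed.

End Survival.

(** * Path events of Markov chains *)

Section ChainPaths.
Variables (R : realType) (V : choiceType) (d : measure_display) (Omega : measurableType d)
  (P : probability Omega R) (X : nat -> Omega -> V) (mu : V -> R) (q : V -> V -> R).
Hypothesis hX : markov_chain P X mu q.

Definition follows (s : seq V) : set Omega :=
  [set w | forall i, (i < size s)%N -> X i w = nth (head (X 0%N w) s) s i].

Lemma followsE x s : follows (x :: s) = [set w | forall i, (i <= size s)%N -> X i w = nth x (x :: s) i].
Proof. by []. Qed.

Lemma measurable_follows s : measurable (follows s).
Proof.
case: s => [|x s]; first by rewrite (_ : follows _ = setT) //; apply/seteqP; split.
rewrite (_ : follows _ = \bigcap_(i in `I_(size s).+1) [set w | X i w = nth x (x :: s) i]).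
  by apply: bigcap_measurableType => i _; case: hX.
by apply/seteqP; split=> w h i hi; apply: h.
Qed.

Lemma chain_follows x s : P (follows (x :: s)) = (mu x * chain q x s)%:E.
Proof.
have [_ h0 hS] := hX.
elim/last_ind: s => [|s y IH].
  rewrite followsE /= mulr1 -h0; congr (P _); apply/seteqP; split=> w /= h.
    by rewrite (h 0%N).
  by move=> i; rewrite leqn0 => /eqP->.
have := hS (size s) (nth x (x :: rcons s y)).
have -> : [set w | forall i, (i <= size s)%N -> X i w = nth x (x :: rcons s y) i] = follows (x :: s).
  rewrite followsE; apply/seteqP; split=> w h i hi; rewrite h // -rcons_cons nth_rcons /=.
    by rewrite ltnS hi.
  by rewrite ltnS hi.
rewrite IH followsE size_rcons => ->; rewrite -EFinM; congr (_%:E).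
rewrite -mulrA; congr (_ * _).
have -> : nth x (x :: rcons s y) (size s).+1 = y by rewrite -rcons_cons nth_rcons /= ltnn eqxx.
have -> : nth x (x :: rcons s y) (size s) = last x s.
  by rewrite -rcons_cons nth_rcons /= ltnSn nth_last.
by elim: s x {IH} => [|z s IHs] u /=; rewrite ?mulr1 ?mul1r // -mulrA IHs.
Qed.

Lemma follows_disjoint s t : size s = size t -> s != t -> follows s `&` follows t = set0.
Proof.
move=> hst; apply: contraNeq => /set0P[w [hs ht]]; apply/eqP.
case: s t hst hs ht => [|x s] [|y t] //= [hst] hs ht.
apply: (@eq_from_nth _ x) => [|i hi] /=; first by rewrite hst.
have e1 : X i w = nth x (x :: s) i by rewrite hs.
have e2 : X i w = nth y (y :: t) i by rewrite ht //= -hst.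
by rewrite -e1 e2; apply: set_nth_default; rewrite /= -hst.
Qed.

End ChainPaths.

Lemma measure_bigsetU_seq d (T : measurableType d) (R : realType)
    (P : {measure set T -> \bar R}) (I : eqType) (r : seq I) (E : I -> set T) :
  uniq r -> (forall i, measurable (E i)) ->
  (forall i j, i \in r -> j \in r -> i != j -> E i `&` E j = set0) ->
  P (\big[setU/set0]_(i <- r) E i) = (\sum_(i <- r) P (E i))%E.
Proof.
move=> + mE; elim: r => [|i r IH] /=; first by rewrite !big_nil measure0.
case/andP => ir ur hd; rewrite !big_cons measureU.
- congr (_ + _)%E; apply: IH => // j k hj hk; apply: hd; by rewrite inE ?hj ?hk orbT.
- exact: mE.
- exact: bigsetU_measurable.
rewrite big_distrr /= big_seq big1 // => j hj; apply: hd; rewrite ?mem_head ?inE ?hj ?orbT //.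
by apply: contraNneq ir => ->.
Qed.

Section Recurrence.
Variables (R : realType) (V : choiceType) (N : network R V) (o : V).
Hypothesis N_rec : recurrent N.
Implicit Types (x y : V).
Local Notation wp := (walk_prob N).
Local Notation sv := (surv N (noto o) (fun=> 1)).

(** The left side is a sum over paths that avoid [o] after their start; the corresponding events are
    disjoint and contained in the right one. *)
Lemma return_lb (d : measure_display) (Omega : measurableType d)
    (P : probability Omega R) (X : nat -> Omega -> V) k :
  markov_chain P X (fun v => (v == o)%:R) wp ->
  ((\sum_(y <- nbr N o) wp o y * sv k y)%:E <=
   P [set w | forall i, (0 < i <= k.+1)%N -> X i w != o])%E.
Proof.
move=> hX; pose D := (nball N o k.+1 `\ o)%fset.
have -> : \sum_(y <- nbr N o) wp o y * sv k y = \sum_(l <- lists D k.+1) chain wp o l.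
  rewrite sum_listsS -(@surv_lists_root _ _ N o (noto o) (fun=> 1) k D (wp o)).
  - rewrite [LHS]big_seq [RHS]big_seq; apply: eq_bigr => y yD.
    rewrite mulr_sumr big_seq [RHS]big_seq; apply: eq_bigr => l.
    rewrite mem_lists => /andP[_ hl]; rewrite mulr1 /=.
    have -> : (noto o y && all (noto o) l); last by rewrite mulr1.
    move: yD; rewrite !inE => /andP[h _]; rewrite {1}/noto /= h /=.
    by apply: sub_all hl => v; rewrite !inE => /andP[].
  - by move=> y; apply: walk_prob_eq0.
  - by move=> y hy ay; rewrite in_fsetD1 hy andbT.
pose E l := follows X (o :: l).
have hd i j : i \in lists D k.+1 -> j \in lists D k.+1 -> i != j -> E i `&` E j = set0.
  rewrite !mem_lists => /andP[/eqP hi _] /andP[/eqP hj _] hij.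
  by apply: follows_disjoint; rewrite /= ?hi ?hj // eqseq_cons eqxx.
have mE i : measurable (E i) by apply: measurable_follows hX _.
rewrite -sumEFin (eq_bigr (fun l => P (E l))); last first.
  by move=> l _; rewrite /E (chain_follows hX) eqxx mul1r.
rewrite -measure_bigsetU_seq ?lists_uniq //.
apply: le_measure; rewrite ?inE.
- exact: bigsetU_measurable.
- rewrite (_ : [set w | _] = \bigcap_(i in [set i | (0 < i <= k.+1)%N]) ~` [set w | X i w = o]).
    by apply: bigcap_measurableType => i _; apply: measurableC; case: hX.
  by apply/seteqP; split=> w /= h i hi; [apply/eqP/h|apply/eqP/h].
move=> w; rewrite -bigcup_seq => -[l hlD hw] i /andP[i0 hi].
have : l \in lists D k.+1 := hlD; rewrite mem_lists => /andP[/eqP hs hl].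
have -> : X i w = nth o (o :: l) i by apply: hw; rewrite /= hs.
case: i i0 hi => // i _ hi /=.
have : nth o l i \in l by rewrite mem_nth // hs.
by move/(allP hl); rewrite !inE => /andP[].
Qed.

Lemma sv_cvg0_nbr e : 0 < e -> exists k, \sum_(y <- nbr N o) wp o y * sv k y <= e.
Proof.
move=> e0; have [d [Om [P [X [hX hret]]]]] := N_rec o.
pose A k := [set w | forall i, (0 < i <= k.+1)%N -> X i w != o].
have mA k : measurable (A k).
  rewrite (_ : A k = \bigcap_(i in [set i | (0 < i <= k.+1)%N]) ~` [set w | X i w = o]).
    by apply: bigcap_measurableType => i _; apply: measurableC; case: hX.
  by apply/seteqP; split=> w /= h i hi; [apply/eqP/h|apply/eqP/h].
have hcap : P (\bigcap_k A k) = 0%E.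
  have mret : measurable [set w | exists2 n, (0 < n)%N & X n w = o].
    rewrite (_ : [set w | _] = \bigcup_(i in [set i | (0 < i)%N]) [set w | X i w = o]).
      by apply: bigcup_measurable => i _; case: hX.
    by apply/seteqP; split=> w [i h1 h2]; exists i.
  have := probability_setC P mret; rewrite hret subee // => h0.
  rewrite -h0; congr (P _); apply/seteqP; split=> w.
    by move=> h [n n0 hn]; have := h n I n; rewrite /= n0 leqnSn hn eqxx => /(_ isT).
  by move=> h k _ i /andP[i0 _]; apply/eqP => hi; apply: h; exists i.
have hcvg : (P \o A) k @[k --> \oo] --> 0%E.
  rewrite -hcap; apply: nonincreasing_cvg_mu => //.
  - by rewrite ltey_eq fin_num_measure.
  - exact: bigcapT_measurable.
  move=> m n mn; apply/subsetPset => w h i /andP[i0 hi]; apply: h.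
  by rewrite i0 (leq_trans hi).
have hc : fine (P (A k)) @[k --> \oo] --> (0 : R) by apply: fine_cvg hcvg.
have [k _ hk] := (@cvgrPdist_le _ _ _ _ _ _ _).1 hc e e0.
exists k; rewrite -lee_fin; apply: le_trans (return_lb k hX) _; rewrite -/(A k).
have := hk k (leqnn k); rewrite /= sub0r normrN ger0_norm ?fine_ge0 // => h.
by rewrite -(@fineK _ (P (A k))) ?lee_fin // fin_num_measure.
Qed.

(** Smallness at [u] forces smallness at each neighbour [y], up to the factor [wp u y], and so
    spreads along a path from [o]. *)
Lemma sv_cvg0 x e : 0 < e -> exists k, sv k x <= e.
Proof.
have [s hs <-] := nbr_connected N o x.
suff key u t : (forall e, 0 < e -> exists k, sv k u <= e) -> path [rel u v | v \in nbr N u] u t ->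
    forall e, 0 < e -> exists k, sv k (last u t) <= e.
  move=> e0; apply: (key o s) => // e' e0'; exists 0; by rewrite sv_root ltW.
elim: t u => //= y t IH u hu /andP[huy ht] e' e0'; apply: (IH y) => // {e' e0'} e' e0'.
have wpos : 0 < wp u y by rewrite divr_gt0 ?conductance_gt0 ?total_conductance_gt0.
have hsum (k : nat) : wp u y * sv k y <= \sum_(z <- nbr N u) wp u z * sv k z.
  rewrite (bigD1_seq y) ?fset_uniq //= lerDl; apply: sumr_ge0 => z _.
  by rewrite mulr_ge0 ?walk_prob_ge0 ?sv_ge0.
have [k hk] : exists k, \sum_(z <- nbr N u) wp u z * sv k z <= e' * wp u y.
  (* At [o] the function [sv] is 0 and says nothing about its neighbours; there the return
     probability takes over. *)
  have [uo|uo] := eqVneq u o; first by rewrite uo in wpos *; apply: sv_cvg0_nbr; rewrite mulr_gt0.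
  have [k hk] := hu (e' * wp u y) (mulr_gt0 e0' wpos).
  by exists k; rewrite -survS //; apply: le_trans hk; apply: sv_leS.
by exists k; rewrite -(ler_pM2r wpos) mulrC (le_trans (hsum k)).
Qed.

Lemma sv_cvg0_seq (l : seq V) e : 0 < e -> exists k, forall x, x \in l -> sv k x <= e.
Proof.
move=> e0; elim: l => [|x l [k hk]]; first by exists 0.
have [j hj] := sv_cvg0 x e0; exists (maxn j k) => y; rewrite inE => /orP[/eqP->|/hk h].
  by apply: le_trans hj; apply: sv_le; rewrite leq_maxl.
by apply: le_trans h; apply: sv_le; rewrite leq_maxr.
Qed.

End Recurrence.

(** * Potentials *)

Lemma cvg_rsum (R : realType) (I : Type) (r : seq I) (u : I -> nat -> R) (l : I -> R) :
  (forall i, u i k @[k --> \oo] --> l i) ->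
  (\sum_(i <- r) u i k) @[k --> \oo] --> \sum_(i <- r) l i.
Proof. by move=> h; apply: cvg_big => //; exact: add_continuous. Qed.

Section Potentials.
Variables (R : realType) (V : choiceType) (N : network R V) (o : V).
Implicit Types (x y z w : V) (s l : seq V) (D : {fset V}).

Local Notation cd := (conductance N).
Local Notation tc := (total_conductance N).
Local Notation wp := (walk_prob N).
Local Notation sv := (surv N (noto o) (fun=> 1)).

Lemma potential_harm h x : potential N o h -> x != o ->
  \sum_(y <- nbr N x) wp x y * h y = h x.
Proof.
move=> [_ _ _ hh] xo; have := hh _ xo; rewrite /laplacian.
under eq_bigr do rewrite mulrBr.
rewrite sumrB => /eqP; rewrite subr_eq0 -mulr_suml -sum_walk_probE => /eqP.
by apply: mulfI; rewrite gt_eqF // total_conductance_gt0.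
Qed.

Lemma potential_flux h : potential N o h -> \sum_(y <- nbr N o) cd o y * h y = 1.
Proof.
move=> [_ h0 h1 _]; rewrite -h1 /laplacian; apply: eq_bigr => y _.
by rewrite h0 subr0.
Qed.

(* f is the part of h carried by the walks that return to the ball of radius
   r.+1 before leaving the ball of radius t; m is the mass that they put on
   their last exit from the smaller ball. *)
Lemma exit_measure h r t : potential N o h -> (r < t)%N ->
  (forall x, x \in nball N o r.+1 -> sv t x <= 2^-1) ->
  let D := (nball N o t `\ o)%fset in
  exists f m : V -> R,
    [/\ (forall x, 0 <= f x <= h x) /\ (forall x, x \in nbr N o -> f x = h x),
        (forall x, 0 <= m x) /\ (forall x, x \in nball N o r -> m x = 0),
        forall x, x \in D -> f x = m x / tc x + \sum_(y <- D) wp x y * f y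
      & \sum_(z <- D) m z <= 2].
Proof.
move=> hp rt hsv D; have [h0 ho h1 _] := hp.
set B := nball N o r.+1; set B' := nball N o t.
have BB' x : x \in B -> x \in B' by apply: fsubsetP; apply: nball_le.
(* The Dirichlet problem with values [h] on [B] and 0 outside [B'] is solved by iteration from
   above: started from [h] cut off to [B'], the iterates decrease and stay nonnegative. *)
pose stp (g : V -> R) x := if x \in B then h x else if x \in B' then
  \sum_(y <- nbr N x) wp x y * g y else 0.
pose g0 x := if x \in B' then h x else 0.
pose F k := iter k stp g0.
have F0 k x : 0 <= F k x.
  elim: k x => [|k IH] x; first by rewrite /= /g0; case: ifP.
  rewrite /= /stp; case: ifP => // _; case: ifP => // _.
  by apply: sumr_ge0 => y _; rewrite mulr_ge0 ?walk_prob_ge0.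
have Bo x : x \notin B -> x != o.
  by apply: contraNneq => ->; apply: nball_root.
have g0h x : g0 x <= h x by rewrite /g0; case: ifP.
have FS k x : F k.+1 x <= F k x.
  elim: k x => [|k IH] x.
    rewrite /= {1}/stp /g0; case: ifP => [/BB' ->//|xB]; case: ifP => // xB'.
    rewrite -(potential_harm hp (Bo _ (negbT xB))); apply: ler_sum => y _.
    by rewrite ler_wpM2l ?walk_prob_ge0 // g0h.
  change (stp (F k.+1) x <= stp (F k) x); rewrite /stp.
  case: ifP => // xB; case: ifP => // xB'; apply: ler_sum => y _.
  by rewrite ler_wpM2l ?walk_prob_ge0 //; apply: IH.
have Fh k x : F k x <= h x.
  by elim: k => [|k IH]; [apply: g0h|apply: le_trans IH].
pose f x := limn (fun k => F k x).
have Fcvg x : F k x @[k --> \oo] --> f x.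
  apply: nonincreasing_is_cvgn.
    by apply/nonincreasing_seqP => n; apply: FS.
  by exists 0 => _ [n _ <-]; apply: F0.
have FcvgS x : F k.+1 x @[k --> \oo] --> f x.
  by have := Fcvg x; rewrite -(cvg_shiftS (fun k => F k x)).
have lim_uniq (u : R^nat) (a b : R) : u k @[k --> \oo] --> a -> u k @[k --> \oo] --> b -> a = b.
  by move=> h2 h3; apply: (cvg_unique _ h2 h3).
have fB x : x \in B -> f x = h x.
  move=> xB; apply: (lim_uniq _ _ _ (FcvgS x)).
  rewrite (_ : (fun k => F k.+1 x) = fun=> h x); first exact: cvg_cst.
  by apply: funext => k; rewrite /= /stp xB.
have fout x : x \notin B' -> f x = 0.
  move=> xB'; apply: (lim_uniq _ _ _ (FcvgS x)).
  rewrite (_ : (fun k => F k.+1 x) = fun=> 0); first exact: cvg_cst.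
  apply: funext => k; rewrite /= /stp (negbTE xB') ifF //.
  by apply: contraNF xB' => /BB'.
have fharm x : x \notin B -> x \in B' -> f x = \sum_(y <- nbr N x) wp x y * f y.
  move=> xB xB'; apply: (lim_uniq _ _ _ (FcvgS x)).
  rewrite (_ : (fun k => F k.+1 x) = fun k => \sum_(y <- nbr N x) wp x y * F k y); last first.
    by apply: funext => k; rewrite /= /stp (negbTE xB) xB'.
  apply: (@cvg_rsum _ _ _ (fun y k => wp x y * F k y)) => y; apply: cvgM; [exact: cvg_cst|exact: Fcvg].
have f0 x : 0 <= f x.
  by apply: limr_ge; [apply: cvgP (Fcvg x)|apply: nearW => k; apply: F0].
have fh x : f x <= h x.
  by apply: limr_le; [apply: cvgP (Fcvg x)|apply: nearW => k; apply: Fh].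
have fo : f o = 0 by rewrite fB ?ho ?nball_root.
have fD x (k : V -> R) : (forall y, y \notin nbr N x -> k y = 0) ->
  \sum_(y <- D) k y * f y = \sum_(y <- nbr N x) k y * f y.
  move=> hk; apply: sum_nbr_supp => // y _; rewrite in_fsetD1 negb_and negbK.
  by case/orP=> [/eqP->//|]; apply: fout.
(* The defect of harmonicity of [f]. It is nonnegative as [f <= h] with equality on [B], and it
   vanishes on the smaller ball, whose neighbours all lie in [B]. *)
pose m x := if (x \in B) && (x != o) then tc x * (f x - \sum_(y <- nbr N x) wp x y * f y) else 0.
have m0 x : 0 <= m x.
  rewrite /m; case: ifP => // /andP[xB xo]; rewrite mulr_ge0 ?subr_ge0 ?(ltW (total_conductance_gt0 _ _)) //.
  rewrite fB // -(potential_harm hp xo); apply: ler_sum => y _.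
  by rewrite ler_wpM2l ?walk_prob_ge0.
have fm x : x \in D -> f x = m x / tc x + \sum_(y <- D) wp x y * f y.
  rewrite in_fsetD1 => /andP[xo xB']; rewrite (fD x); last exact: walk_prob_eq0.
  rewrite /m xo andbT; case: ifP => xB.
    by rewrite mulrAC divff ?mul1r ?subrK // gt_eqF ?total_conductance_gt0.
  by rewrite mul0r add0r; apply: fharm; rewrite ?xB.
exists f, m; split=> //.
- split=> [x|x hx]; first by rewrite f0 fh.
  by apply: fB; apply: (fsubsetP (nball_le N o (ltn0Sn r))); apply: nball_nbr hx; apply: nball_root.
- split=> // x xr; rewrite /m; case: ifP => // /andP[xB xo].
  rewrite (_ : \sum_(y <- nbr N x) wp x y * f y = h x) ?fB ?subrr ?mulr0 //.
  rewrite -(potential_harm hp xo) big_seq [RHS]big_seq; apply: eq_bigr => y hy.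
  by rewrite fB //; apply: nball_nbr hy.
(* Green's identity for f and the probability g of reaching o within t steps. *)
pose g x := 1 - sv t x.
have g_ge0 x : 0 <= g x by rewrite subr_ge0 sv_le1.
have g_sub x : x != o -> tc x * g x <= \sum_(y <- nbr N x) cd x y * g y.
  move=> xo; rewrite -sum_walk_probE ler_wpM2l ?(ltW (total_conductance_gt0 _ _)) //.
  under eq_bigr do rewrite mulrBr mulr1.
  by rewrite sumrB sum_walk_prob lerB ?sv_superharm.
have key : \sum_(z <- D) m z * g z <= 1.
  have e1 : \sum_(z <- D) m z * g z = \sum_(x <- D) tc x * f x * g x -
      \sum_(x <- D) \sum_(y <- D) cd x y * f y * g x.
    rewrite -sumrB big_seq [RHS]big_seq; apply: eq_bigr => x xD.
    rewrite -mulr_suml -mulrBl; congr (_ * _).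
    rewrite (fD x); last exact: conductance_eq0.
    rewrite {1}(fm _ xD) (fD x); last exact: walk_prob_eq0.
    rewrite mulrDr sum_walk_probE addrK mulrCA divff ?mulr1 // gt_eqF ?total_conductance_gt0 //.
  rewrite e1 exchange_big /= -sumrB.
  rewrite -(potential_flux hp).
  have -> : \sum_(y <- nbr N o) cd o y * h y = \sum_(y <- D) cd o y * f y.
    rewrite (fD o); last exact: conductance_eq0.
    rewrite big_seq [RHS]big_seq; apply: eq_bigr => y hy; rewrite fB //.
    by apply: (fsubsetP (nball_le N o (ltn0Sn r))); apply: nball_nbr hy; apply: nball_root.
  rewrite big_seq [leRHS]big_seq; apply: ler_sum => y yD.
  have yo : y != o by move: yD; rewrite in_fsetD1 => /andP[].
  have -> : \sum_(x <- D) cd x y * f y * g x = f y * \sum_(x <- D) cd y x * g x.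
    by rewrite mulr_sumr; apply: eq_bigr => x _; rewrite conductance_sym mulrAC mulrC.
  rewrite [tc y * _]mulrC -mulrA -mulrBr [cd o y * _]mulrC ler_wpM2l // lerBlDr.
  apply: le_trans (g_sub _ yo) _.
  (* [g] vanishes outside the ball of radius [t], so only [o] and [D] contribute. *)
  rewrite -(@sum_nbr_supp _ _ N y (o |` D)%fset); last 2 first.
  - by move=> x; apply: conductance_eq0.
  - move=> x _ hx; rewrite /g sv_outside ?subrr //.
    move: hx; rewrite in_fset1U in_fsetD1 negb_or negb_and negbK.
    by case/andP => /negbTE->.
  rewrite big_fsetU1 ?in_fsetD1 ?eqxx //= conductance_sym lerD2r.
  by rewrite ler_piMr ?conductance_ge0 // gerBl sv_ge0.
(* On [B], where [m] lives, [g] is at least 1/2 by [hsv]; hence the bound 2. *)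
have : \sum_(z <- D) m z * 2^-1 <= 1.
  apply: le_trans key; apply: ler_sum => z _.
  have [zB|zB] := boolP (z \in B); last by rewrite /m (negbTE zB) !mul0r.
  rewrite ler_wpM2l // /g; have := hsv _ zB; lra.
by rewrite -mulr_suml ler_pdivrMr ?mul1r.
Qed.

(** * Green sums of the exit measure and time reversal *)

Section Walks.
Variables (h f m : V -> R) (D : {fset V}).
Hypotheses (hpot : potential N o h) (f_ge0 : forall x, 0 <= f x) (fh : forall x, f x <= h x)
  (m_ge0 : forall x, 0 <= m x) (oD : o \notin D) (nbrD : (nbr N o `<=` D)%fset)
  (f_nbr : forall x, x \in nbr N o -> f x = h x)
  (fm : forall x, x \in D -> f x = m x / tc x + \sum_(y <- D) wp x y * f y).

(** Green sum of [m] over the paths from [x] with fewer than [k] steps in [D] and all vertices in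
    [a]. *)
Fixpoint mass (a : pred V) k x : R :=
  if k is k'.+1 then (a x)%:R * (m x / tc x + \sum_(y <- D) wp x y * mass a k' y) else 0.

Lemma massS a k x : mass a k.+1 x =
  (a x)%:R * (m x / tc x + \sum_(y <- D) wp x y * mass a k y).
Proof. by []. Qed.

Lemma mass_lists a t x :
  \sum_(k < t) \sum_(l <- lists D k) chain wp x l * (m (last x l) / tc (last x l)) *
     (all a (x :: l))%:R = mass a t x.
Proof.
elim: t x => [|t IH] x; first by rewrite big_ord0.
rewrite big_ord_recl [X in X + _]big_seq1 [mass _ _ _]/= mulrDr.
congr (_ + _); first by rewrite /= mul1r andbT mulrC.
under [LHS]eq_bigr do rewrite lift0 sum_listsS.
rewrite exchange_big /= mulr_sumr; apply: eq_bigr => y _.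
rewrite -IH !mulr_sumr; apply: eq_bigr => k _; rewrite !mulr_sumr; apply: eq_bigr => l _.
by rewrite /= -mulnb natrM; ring.
Qed.

Lemma mass_le x k : x \in D -> mass xpredT k x <= f x.
Proof.
elim: k x => [|k IH] x xD; first exact: f_ge0.
rewrite /= mul1r (fm xD) lerD2l big_seq [leRHS]big_seq; apply: ler_sum => y yD.
by rewrite ler_wpM2l ?walk_prob_ge0 ?IH.
Qed.

Let xD_noto x : x \in D -> x != o.
Proof. by apply: contraTneq => ->. Qed.

(** Both sides weigh the paths that leave [a]: on the left in the Green sum of [m], on the right for
    the potential [h]. At the exit the left mass is at most [f], hence at most [h]. *)
Lemma mass_hits a k x : x \in D ->
  mass xpredT k.+1 x - mass a k.+1 x <= h x - surv N (predI (noto o) a) h k x.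
Proof.
have sh j y : surv N (predI (noto o) a) h j y <= h y.
  have [h0 _ _ _] := hpot; apply: surv_le => // z /andP[zo _].
  by rewrite (potential_harm hpot).
elim: k x => [|k IH] x xD; have [ax|ax] := boolP (a x).
- have -> : mass a 1 x = mass xpredT 1 x by rewrite /= ax.
  by rewrite subrr subr_ge0 sh.
- rewrite (surv_out _ _ _ (a := predI _ _)) /= ?(negbTE ax) ?andbF // mul0r !subr0.
  exact: le_trans (mass_le 1 xD) (fh x).
- have axo : predI (noto o) a x by rewrite /= ax andbT; apply: xD_noto.
  rewrite survS // -(potential_harm hpot (xD_noto xD)) -sumrB.
  rewrite !(massS _ k.+1) ax !mul1r.
  rewrite opprD addrACA subrr add0r -sumrB.
  under eq_bigr do rewrite -mulrBr; under [leRHS]eq_bigr do rewrite -mulrBr.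
  apply: (le_trans (y := \sum_(y <- D) wp x y * (h y - surv N (predI (noto o) a) h k y))).
    rewrite big_seq [leRHS]big_seq; apply: ler_sum => y yD.
    by rewrite ler_wpM2l ?walk_prob_ge0 ?IH.
  apply: sum_nbr_le => [y|y|y]; first exact: walk_prob_eq0.
    exact: walk_prob_ge0.
  by rewrite subr_ge0.
rewrite (surv_out _ _ _ (a := predI _ _)) /= ?(negbTE ax) ?andbF // mul0r !subr0.
exact: le_trans (mass_le k.+2 xD) (fh x).
Qed.

(** What is missing comes from paths that avoid [o] for [k] steps, and from there on their mass is
    at most the bound [M] of [f]. *)
Lemma mass_tail M k x : (forall y, y \in D -> f y <= M) -> 0 <= M -> x \in D ->
  f x - mass xpredT k.+1 x <= M * sv k x.
Proof.
move=> hM M0; elim: k x => [|k IH] x xD.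
  rewrite -[sv 0 x]/((x != o)%:R * 1) xD_noto // !mulr1; apply: le_trans (hM _ xD).
  rewrite gerBl /= mul1r addr_ge0 ?divr_ge0 ?m_ge0 ?(ltW (total_conductance_gt0 _ _)) //.
  by apply: sumr_ge0 => y _; rewrite mulr0.
rewrite survS; last exact: xD_noto.
rewrite {1}(fm xD) massS mul1r opprD addrACA subrr add0r -sumrB mulr_sumr.
under eq_bigr do rewrite -mulrBr; under [leRHS]eq_bigr do rewrite mulrCA.
apply: (le_trans (y := \sum_(y <- D) wp x y * (M * sv k y))).
  rewrite big_seq [leRHS]big_seq; apply: ler_sum => y yD.
  by rewrite ler_wpM2l ?walk_prob_ge0 ?IH.
apply: sum_nbr_le => [y|y|y]; first exact: walk_prob_eq0.
  exact: walk_prob_ge0.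
by rewrite mulr_ge0 ?sv_ge0.
Qed.

(* Reversing a walk from z to o read off D turns the mass of its starting
   point into the mass of the end point of a walk from o. *)
Definition to_weight s : R := if s is z :: s' then m z * walk_to N o z s' else 0.
Definition from_weight s : R :=
  if s is x :: l then cd o x * chain wp x l * (m (last x l) / tc (last x l)) else 0.

Definition path_cond s : R := if s is x :: l then chain cd x l else 1.
Definition path_tc s : R := \prod_(v <- s) (tc v)^-1.

Lemma chain_wp x l : chain wp x l / tc (last x l) = path_cond (x :: l) * path_tc (x :: l).
Proof.
rewrite /path_tc; elim: l x => [|y l IH] x; first by rewrite big_seq1 /=.
rewrite big_cons [chain wp _ _]/= [last _ _]/= -mulrA IH /walk_prob /=; ring.
Qed.

Lemma walk_toE z s : walk_to N o z s = path_cond (z :: s) * path_tc (z :: s) * cd (last z s) o.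
Proof.
rewrite /path_tc; elim: s z => [|y s IH] z; first by rewrite big_seq1 /= mul1r mulrC.
by rewrite big_cons [walk_to _ _ _ _]/= IH /walk_prob /=; ring.
Qed.

Lemma path_cond_rcons s y x : path_cond (rcons (rcons s y) x) = path_cond (rcons s y) * cd y x.
Proof.
case: s => [|z s] /=; first by rewrite mulr1 mul1r.
by elim: s z => [|u s IH] z /=; rewrite ?mulr1 // -mulrA IH.
Qed.

Lemma path_cond_rev s : path_cond (rev s) = path_cond s.
Proof.
elim: s => [|x [|y l] IH] //.
by rewrite rev_cons [in rev _]rev_cons path_cond_rcons -rev_cons IH /= conductance_sym mulrC.
Qed.

(** Reversibility: both weights consist of one factor [(tc v)^-1] per vertex, the end factors, and a
    product of conductances that is symmetric under reversal. *)
Lemma to_weight_rev s : to_weight (rev s) = from_weight s.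
Proof.
case: s => [|x l] //; have e := path_cond_rev (x :: l).
have et : path_tc (rev (x :: l)) = path_tc (x :: l).
  by rewrite /path_tc; apply: perm_big; rewrite perm_rev.
have e2 : cd o x * chain wp x l * (m (last x l) / tc (last x l)) =
   m (last x l) * (path_cond (x :: l) * path_tc (x :: l) * cd o x).
  by rewrite -chain_wp; ring.
rewrite [RHS]e2 -e -et; case/lastP: l {e et e2} => [|l z].
  by rewrite (_ : rev [:: x] = [:: x]) // /to_weight walk_toE conductance_sym.
rewrite -rcons_cons rev_rcons /to_weight walk_toE last_rcons; congr (_ * (_ * _)).
by rewrite rev_cons last_rcons conductance_sym.
Qed.

Lemma mass_reversed a t :
  \sum_(z <- D) m z * \sum_(k < t) \sum_(s <- lists D k) walk_to N o z s * (all a (z :: s))%:R =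
  \sum_(x <- D) cd o x * mass a t x.
Proof.
have -> : \sum_(z <- D) m z * \sum_(k < t) \sum_(s <- lists D k)
      walk_to N o z s * (all a (z :: s))%:R =
   \sum_(k < t) \sum_(s <- lists D k.+1) to_weight s * (all a s)%:R.
  under [RHS]eq_bigr do rewrite sum_listsS.
  rewrite exchange_big /=; apply: eq_bigr => z _; rewrite mulr_sumr; apply: eq_bigr => k _.
  by rewrite mulr_sumr; apply: eq_bigr => s _; rewrite mulrA.
under eq_bigr do rewrite sum_lists_rev sum_listsS.
rewrite exchange_big /=; apply: eq_bigr => x _; rewrite -mass_lists mulr_sumr.
apply: eq_bigr => k _; rewrite mulr_sumr; apply: eq_bigr => l _.
by rewrite to_weight_rev all_rev /= !mulrA.
Qed.

(* The subtracted term bounds the mass of the walks with more than t steps. *)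
Lemma mass_avoid a t M : (forall y, y \in D -> f y <= M) -> 0 <= M ->
  \sum_(x <- nbr N o) cd o x * surv N (predI (noto o) a) h t x -
    M * \sum_(x <- nbr N o) cd o x * sv t x <=
  \sum_(z <- D) m z * \sum_(k < t.+1) \sum_(s <- lists D k)
     walk_to N o z s * (all a (z :: s))%:R.
Proof.
move=> hM M0; rewrite mass_reversed (@sum_nbr_supp _ _ N o D); last 2 first.
- by move=> y; apply: conductance_eq0.
- by move=> y hy; rewrite (fsubsetP nbrD).
rewrite mulr_sumr -sumrB big_seq [leRHS]big_seq; apply: ler_sum => x hx.
rewrite mulrCA -mulrBr ler_wpM2l ?conductance_ge0 //.
have xD := fsubsetP nbrD _ hx.
(* The mass inside [a] is at least [f x], which is [h x] here, minus the tail of long paths and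
   minus the paths that leave [a]. *)
have h1 := mass_hits a t xD; have h2 := mass_tail t hM M0 xD.
have h3 := f_nbr hx; lra.
Qed.

Lemma mass_total t :
  \sum_(z <- D) m z * \sum_(k < t) \sum_(s <- lists D k) walk_to N o z s <= 1.
Proof.
have -> : \sum_(z <- D) m z * \sum_(k < t) \sum_(s <- lists D k) walk_to N o z s =
  \sum_(x <- D) cd o x * mass xpredT t x.
  rewrite -mass_reversed; apply: eq_bigr => z _; congr (_ * _).
  apply: eq_bigr => k _; apply: eq_bigr => s _.
  by rewrite all_predT mulr1.
rewrite (@sum_nbr_supp _ _ N o D); last 2 first.
- by move=> y; apply: conductance_eq0.
- by move=> y hy; rewrite (fsubsetP nbrD).
rewrite -(potential_flux hpot) big_seq [leRHS]big_seq; apply: ler_sum => x hx.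
rewrite ler_wpM2l ?conductance_ge0 // -f_nbr //; apply: mass_le.
exact: (fsubsetP nbrD).
Qed.

End Walks.
End Potentials.

(** * Path laws of h-processes *)

Section HProcess.
Variables (R : realType) (V : choiceType) (N : network R V) (o : V).
Implicit Types (x y z w : V) (s l : seq V) (D K : {fset V}).

Local Notation cd := (conductance N).
Local Notation wp := (walk_prob N).
Local Notation sv := (surv N (noto o) (fun=> 1)).

Section OneProcess.
Variables (h : V -> R).
Hypothesis hpot : potential N o h.

Lemma surv_potential k x : surv N (noto o) h k x = h x.
Proof.
have [_ ho _ _] := hpot.
elim: k x => [|k IH] x; have [->|xo] := eqVneq x o.
- by rewrite ho surv_out // /noto /= eqxx.
- by rewrite /= /noto /= xo mul1r.
- by rewrite ho surv_out // /noto /= eqxx.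
rewrite survS // -(potential_harm hpot xo).
by apply: eq_bigr => y _; rewrite IH.
Qed.

(** The factors [h y / h x] telescope. Where [h x = 0], harmonicity and nonnegativity force [h] to
    vanish at all neighbours, so the convention for division by 0 does no harm. *)
Lemma h_chain x l : all (noto o) (x :: l) ->
  h x * chain (fun x y => wp x y * h y / h x) x l = chain wp x l * h (last x l).
Proof.
elim: l x => [|y l IH] x /=; first by rewrite mulr1 mul1r.
case/andP => xo hl; rewrite -[RHS]mulrA -IH //.
have [hx|hx] := eqVneq (h x) 0; last by field.
rewrite hx mul0r mulrA.
have [h0 _ _ _] := hpot.
suff -> : wp x y * h y = 0 by rewrite mul0r.
have [yx|yx] := boolP (y \in nbr N x); last by rewrite walk_prob_eq0 ?mul0r.
have /eqP := potential_harm hpot xo; rewrite hx psumr_eq0 => [/allP/(_ y yx)/eqP //|z _].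
by rewrite mulr_ge0 ?walk_prob_ge0.
Qed.

Definition h_weight l : R := if l is x :: l' then cd o x * chain wp x l' * h (last x l') else 0.

(** The process starts next to [o], so its first [t.+1] vertices lie within distance [t.+1]. *)
Definition outer t : {fset V} := (nball N o t.+1 `\ o)%fset.

Lemma outer_noto t k l : l \in lists (outer t) k -> all (noto o) l.
Proof.
rewrite mem_lists => /andP[_ hl]; apply: sub_all hl => v.
by rewrite in_fsetD1 => /andP[].
Qed.

Lemma h_weight_sum a t :
  \sum_(l <- lists (outer t) t.+1) h_weight l * (all a l)%:R =
  \sum_(x <- nbr N o) cd o x * surv N (predI (noto o) a) h t x.
Proof.
rewrite -(@surv_lists_root _ _ _ _ _ _ _ (outer t)); last 2 first.
- by move=> y; apply: conductance_eq0.
- by move=> y hy /andP[yo _]; rewrite in_fsetD1 hy andbT.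
rewrite sum_listsS [LHS]big_seq [RHS]big_seq; apply: eq_bigr => y yD.
rewrite mulr_sumr [LHS]big_seq [RHS]big_seq; apply: eq_bigr => l hl.
have -> : all (predI (noto o) a) (y :: l) = all a (y :: l).
  rewrite all_predI /= (outer_noto hl) andbT.
  by have -> : noto o y by move: yD; rewrite in_fsetD1 => /andP[].
by rewrite /h_weight; ring.
Qed.

Lemma h_weight_total t : \sum_(l <- lists (outer t) t.+1) h_weight l = 1.
Proof.
rewrite -(potential_flux hpot).
have := h_weight_sum predT t; under eq_bigr do rewrite all_predT mulr1.
move=> ->; apply: eq_bigr => x _; congr (_ * _); rewrite -[RHS](surv_potential t).
elim: t x => [|t IH] x /=; first by rewrite andbT.
by rewrite andbT; congr (_ * _); apply: eq_bigr => y _; rewrite IH.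
Qed.

Lemma h_weight_ge0 l : 0 <= h_weight l.
Proof.
case: l => // x l; have [h0 _ _ _] := hpot.
rewrite /h_weight !mulr_ge0 ?conductance_ge0 //.
by elim: l x => [|y l IH] x //=; rewrite mulr_ge0 ?walk_prob_ge0.
Qed.

Variables (d : measure_display) (Omega : measurableType d) (P : probability Omega R)
  (X : nat -> Omega -> V).
Hypothesis hX : h_process N o h P X.

Lemma h_follows t l : l \in lists (outer t) t.+1 -> P (follows X l) = (h_weight l)%:E.
Proof.
move=> hl; have := outer_noto hl; case: l hl => [|x l] hl ha.
  by have := hl; rewrite mem_lists.
by rewrite (chain_follows hX) -mulrA h_chain // mulrA.
Qed.

(** The listed path events are disjoint, and by harmonicity of [h] their weights already add up to
    1. *)
Lemma follows_cover t :
  P (~` \big[setU/set0]_(l <- lists (outer t) t.+1) follows X l) = 0%E.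
Proof.
rewrite probability_setC; last first.
  by apply: bigsetU_measurable => l _; apply: measurable_follows hX _.
rewrite measure_bigsetU_seq ?lists_uniq //; last 2 first.
- by move=> l; apply: measurable_follows hX _.
- move=> l l'; rewrite !mem_lists => /andP[/eqP h1 _] /andP[/eqP h2 _].
  by apply: follows_disjoint; rewrite h1 h2.
have -> : (\sum_(l <- lists (outer t) t.+1) P (follows X l) = 1)%E.
  rewrite big_seq (eq_bigr (fun l => (h_weight l)%:E)); last by move=> l /h_follows.
  by rewrite -big_seq sumEFin h_weight_total.
by rewrite subee.
Qed.

End OneProcess.

Lemma follows_event (d : measure_display) (Omega : measurableType d)
    (Y : nat -> Omega -> V) l :
  process_events Y (follows Y l).
Proof.
case: l => [|x s].
  rewrite (_ : follows _ _ = setT); last by apply/seteqP; split.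
  exact: (@measurableT _ (g_sigma_algebraType _)).
rewrite (_ : follows _ _ = \bigcap_(i in `I_(size s).+1) [set w | Y i w = nth x (x :: s) i]).
  apply: (@bigcap_measurableType _ (g_sigma_algebraType _)) => i _.
  by apply: sub_sigma_algebra; exists i, (nth x (x :: s) i).
by apply/seteqP; split=> w h i hi; apply: h.
Qed.

Section TwoProcesses.
Variables (h1 h2 : V -> R) (d : measure_display) (Omega : measurableType d)
  (P : probability Omega R) (Y Z : nat -> Omega -> V).
Hypotheses (hp1 : potential N o h1) (hp2 : potential N o h2)
  (hY : h_process N o h1 P Y) (hZ : h_process N o h2 P Z) (hYZ : independent_processes P Y Z).

Definition meet_inside K : set Omega :=
  [set w | forall i j, Y i w = Z j w -> Y i w \in K].

Lemma disjoint_offC K l l' : disjoint_off K l l' = disjoint_off K l' l.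
Proof.
suff h a b : disjoint_off K a b -> disjoint_off K b a by apply/idP/idP; apply: h.
move=> /allP hab; apply/allP => v vb; have [//|vK] := boolP (v \in K).
by apply/negP => va; have := hab _ va; rewrite (negbTE vK) vb.
Qed.

(** Up to a null set both processes follow listed paths, which on this event share vertices only in
    [K]; independence factors the probability of each pair. *)
Lemma meet_inside_le K t : measurable (meet_inside K) ->
  (P (meet_inside K) <= (\sum_(l <- lists (outer t) t.+1) h_weight h1 l *
     \sum_(l' <- lists (outer t) t.+1) h_weight h2 l' * (disjoint_off K l l')%:R)%:E)%E.
Proof.
move=> mK; set L := lists (outer t) t.+1.
pose I := [seq p <- [seq (l, l') | l <- L, l' <- L] | disjoint_off K p.1 p.2].
pose E (p : seq V * seq V) := follows Y p.1 `&` follows Z p.2.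
have mE p : measurable (E p).
  by apply: measurableI; [apply: measurable_follows hY _|apply: measurable_follows hZ _].
have uI : uniq I.
  apply: filter_uniq; apply: allpairs_uniq; rewrite ?lists_uniq //.
  by move=> [a b] [a' b'] _ _ /= [-> ->].
have memI p : p \in I -> [/\ p.1 \in L, p.2 \in L & disjoint_off K p.1 p.2].
  by rewrite mem_filter => /andP[hd /allpairsP[q /= [q1 q2 e]]]; rewrite e /= in hd *.
have PE : P (\big[setU/set0]_(p <- I) E p) = (\sum_(l <- L) h_weight h1 l *
     \sum_(l' <- L) h_weight h2 l' * (disjoint_off K l l')%:R)%:E.
  rewrite measure_bigsetU_seq //; last first.
    move=> p q /memI[p1 p2 _] /memI[q1 q2 _] hpq.
    move: p1 p2 q1 q2; rewrite !mem_lists.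
    move=> /andP[/eqP p1 _] /andP[/eqP p2 _] /andP[/eqP q1 _] /andP[/eqP q2 _].
    rewrite /E setIACA.
    have [e1|ne1] := eqVneq p.1 q.1.
      have ne2 : p.2 != q.2.
        by apply: contraNneq hpq => e2; case: p q e1 e2 {p1 p2 q1 q2} => [? ?] [? ?] /= -> ->.
      by rewrite [X in _ `&` X]follows_disjoint ?setI0 // p2 q2.
    by rewrite [X in X `&` _]follows_disjoint ?set0I // p1 q1.
  rewrite big_seq (eq_bigr (fun p => (h_weight h1 p.1 * h_weight h2 p.2)%:E)); last first.
    move=> p /memI[p1 p2 _].
    transitivity (P (follows Y p.1) * P (follows Z p.2))%E.
      by apply: hYZ; apply: follows_event.
    by rewrite (h_follows hp1 hY p1) (h_follows hp2 hZ p2) EFinM.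
  rewrite -big_seq sumEFin big_filter big_mkcond big_allpairs_dep /=; congr (_%:E).
  apply: eq_bigr => l _; rewrite mulr_sumr; apply: eq_bigr => l' _.
  by case: ifP => _; rewrite ?mulr1 // !mulr0.
rewrite -PE.
pose C1 := ~` \big[setU/set0]_(l <- L) follows Y l.
pose C2 := ~` \big[setU/set0]_(l <- L) follows Z l.
have mC1 : measurable C1.
  by apply: measurableC; apply: bigsetU_measurable => l _; apply: measurable_follows hY _.
have mC2 : measurable C2.
  by apply: measurableC; apply: bigsetU_measurable => l _; apply: measurable_follows hZ _.
have mI : measurable (\big[setU/set0]_(p <- I) E p) by apply: bigsetU_measurable.
have hsub : meet_inside K `<=` (\big[setU/set0]_(p <- I) E p `|` C1) `|` C2.
  move=> w hw; have [w2|w2] := pselect (C2 w); first by right.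
  left; have [w1|w1] := pselect (C1 w); first by right.
  left; move: w1 w2 => /contrapT + /contrapT; rewrite -!bigcup_seq.
  move=> [l lL hl] [l' lL' hl']; exists (l, l') => //=.
  have lL2 : l \in L := lL; have lL2' : l' \in L := lL'.
  rewrite mem_filter /=; apply/andP; split; last by apply: allpairs_f.
  apply/allP => v vl; have [//|vK] := boolP (v \in K) => /=.
  apply/negP => vl'; move/negP: vK; apply.
  have hYv : Y (index v l) w = v by rewrite hl ?index_mem // nth_index.
  have hZv : Z (index v l') w = v by rewrite hl' ?index_mem // nth_index.
  by rewrite -hYv; apply: (hw _ (index v l')); rewrite hYv hZv.
apply: (le_trans (le_measure P _ _ hsub)); rewrite ?inE //.
  by apply: measurableU => //; apply: measurableU.
apply: (le_trans (measureU2 _ _ _)) => //; first exact: measurableU.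
have e2 : P C2 = 0%E by exact: (follows_cover hp2 hZ t).
have e1 : P C1 = 0%E by exact: (follows_cover hp1 hY t).
rewrite [X in (_ + X <= _)%E]e2 adde0.
apply: (le_trans (measureU2 _ _ _)) => //.
by rewrite [X in (_ + X <= _)%E]e1 adde0.
Qed.

End TwoProcesses.
End HProcess.

(** * From two h-processes to two walks started far away *)

Section MeetWalks.
Variables (R : realType) (V : choiceType) (N : network R V) (o : V).
Variables (h1 h2 : V -> R) (d : measure_display) (Omega : measurableType d)
  (P : probability Omega R) (Y Z : nat -> Omega -> V).
Hypotheses (N_rec : recurrent N) (hp1 : potential N o h1) (hp2 : potential N o h2)
  (hY : h_process N o h1 P Y) (hZ : h_process N o h2 P Z) (hYZ : independent_processes P Y Z).
Local Notation cd := (conductance N).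
Local Notation sv := (surv N (noto o) (fun=> 1)).

Lemma flux_sv_small e : 0 < e -> exists t, \sum_(x <- nbr N o) cd o x * sv t x <= e.
Proof.
move=> e0; have hT := total_conductance_gt0 N o.
have [t ht] := sv_cvg0_seq o N_rec (enum_fset (nbr N o)) (divr_gt0 e0 hT).
exists t; apply: le_trans (_ : \sum_(x <- nbr N o) cd o x * (e / total_conductance N o) <= _).
  rewrite big_seq [leRHS]big_seq; apply: ler_sum => x hx.
  by rewrite ler_wpM2l ?conductance_ge0 // ht.
by rewrite -mulr_suml mulrC divfK ?gt_eqF.
Qed.

(** The processes are exchanged for reversed walks one at a time: [mass_avoid] is applied with the
    other path held fixed, at the cost [e / 2] each. *)
Lemma meet_walks K r t0 e : (r < t0)%N ->
  (forall x, x \in nball N o r.+1 -> sv t0 x <= 2^-1) ->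
  measurable (meet_inside Y Z K) -> 0 < e ->
  let D := (nball N o t0 `\ o)%fset in
  exists m1 m2 t,
    [/\ (forall x, 0 <= m1 x) /\ (forall x, 0 <= m2 x),
      (forall x, x \in nball N o r -> m1 x = 0) /\ (forall x, x \in nball N o r -> m2 x = 0),
      \sum_(z <- D) m1 z <= 2 /\ \sum_(z <- D) m2 z <= 2 &
      (P (meet_inside Y Z K) <= (e +
       \sum_(z <- D) m1 z * \sum_(k < t) \sum_(s <- lists D k) walk_to N o z s *
         \sum_(w <- D) m2 w * \sum_(k' < t) \sum_(s' <- lists D k') walk_to N o w s' *
           (disjoint_off K (z :: s) (w :: s'))%:R)%:E)%E].
Proof.
move=> rt hsv mK e0 D.
have [f1 [m1 [[f1h f1n] [m10 m1r] f1m m1s]]] := exit_measure hp1 rt hsv.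
have [f2 [m2 [[f2h f2n] [m20 m2r] f2m m2s]]] := exit_measure hp2 rt hsv.
have f10 x : 0 <= f1 x by case/andP: (f1h x).
have f20 x : 0 <= f2 x by case/andP: (f2h x).
have f1h' x : f1 x <= h1 x by case/andP: (f1h x).
have f2h' x : f2 x <= h2 x by case/andP: (f2h x).
(* A common bound for [f1] and [f2] on [D]; the summand 1 keeps it positive for the division
   below. *)
pose M := \sum_(x <- D) (f1 x + f2 x) + 1.
have M0 : 0 < M by rewrite ltr_wpDl ?sumr_ge0 // => x _; rewrite addr_ge0.
have fM x : x \in D -> f1 x + f2 x <= M.
  move=> xD; rewrite /M (bigD1_seq x) ?fset_uniq //= -addrA lerDl addr_ge0 //.
  by apply: sumr_ge0 => y _; rewrite addr_ge0.
have f1M x : x \in D -> f1 x <= M by move=> /fM; apply: le_trans; rewrite lerDl.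
have f2M x : x \in D -> f2 x <= M by move=> /fM; apply: le_trans; rewrite lerDr.
have oD : o \notin D by rewrite in_fsetD1 eqxx.
have nbrD : (nbr N o `<=` D)%fset.
  apply/fsubsetP => x hx; rewrite in_fsetD1.
  rewrite (fsubsetP (nball_le N o (leq_ltn_trans (leq0n r) rt))) ?andbT.
    by apply: contraTneq hx => ->; apply: nbr_irr.
  by apply: nball_nbr hx; apply: nball_root.
have eM : 0 < e / 2 / M by rewrite !divr_gt0.
have [t ht] := flux_sv_small eM.
have hM : M * \sum_(x <- nbr N o) cd o x * sv t x <= e / 2.
  by rewrite mulrC -ler_pdivlMr.
exists m1, m2, t.+1; split=> //.
apply: (le_trans (meet_inside_le hp1 hp2 hY hZ hYZ t mK)); rewrite lee_fin.
pose ac (l : seq V) : pred V := fun v => (v \in K) || (v \notin l).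
have acE l l' : disjoint_off K l l' = all (ac l') l by [].
set J := \sum_(z <- D) _.
pose E := lists (outer N o t) t.+1.
have s2 l : \sum_(l' <- E) h_weight N o h2 l' * (disjoint_off K l l')%:R - e / 2 <=
   \sum_(w <- D) m2 w * \sum_(k' < t.+1) \sum_(s' <- lists D k') walk_to N o w s' *
           (disjoint_off K l (w :: s'))%:R.
  have := mass_avoid hp2 f20 f2h' m20 oD nbrD f2n f2m (ac l) t f2M (ltW M0).
  rewrite -h_weight_sum => hm; apply: le_trans (_ : _ <= _) (le_trans hm _).
    rewrite lerB //; apply: ler_sum => l' _; by rewrite disjoint_offC acE.
  apply: ler_sum => w _; rewrite ler_wpM2l //; apply: ler_sum => k _; apply: ler_sum => s' _.
  by rewrite [X in _ <= _ * (nat_of_bool X)%:R]disjoint_offC acE.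
have s1 l' : \sum_(l <- E) h_weight N o h1 l * (disjoint_off K l l')%:R - e / 2 <=
   \sum_(z <- D) m1 z * \sum_(k < t.+1) \sum_(s <- lists D k) walk_to N o z s *
           (disjoint_off K (z :: s) l')%:R.
  have := mass_avoid hp1 f10 f1h' m10 oD nbrD f1n f1m (ac l') t f1M (ltW M0).
  rewrite -h_weight_sum => hm; apply: le_trans (_ : _ <= _) (le_trans hm _).
    by rewrite lerB //; apply: ler_sum.
  by [].
pose Q l := \sum_(l' <- E) h_weight N o h2 l' * (disjoint_off K l l')%:R.
(* The hybrid quantity: the first process is already a walk, the second is still an h-process. *)
pose J1 := \sum_(z <- D) m1 z * \sum_(k < t.+1) \sum_(s <- lists D k) walk_to N o z s * Q (z :: s).
have J1J : J1 - e / 2 <= J.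
  (* The error [e / 2] is paid for each path of the first walk, and these have total weight at most
     1. *)
  have ht1 := mass_total hp1 f10 nbrD f1n f1m t.+1.
  apply: le_trans (_ : J1 - (\sum_(z <- D) m1 z * \sum_(k < t.+1)
      \sum_(s <- lists D k) walk_to N o z s) * (e / 2) <= _).
    by rewrite lerB // ler_piMl // divr_ge0 ?ltW.
  rewrite /J1 /J mulr_suml -sumrB; apply: ler_sum => z _.
  rewrite -mulrA -mulrBr ler_wpM2l // mulr_suml -sumrB; apply: ler_sum => k _.
  rewrite mulr_suml -sumrB; apply: ler_sum => s _.
  by rewrite -mulrBr ler_wpM2l ?walk_to_ge0 ?s2.
have J1E : J1 = \sum_(l' <- E) h_weight N o h2 l' *
   \sum_(z <- D) m1 z * \sum_(k < t.+1) \sum_(s <- lists D k) walk_to N o z s *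
           (disjoint_off K (z :: s) l')%:R.
  under [RHS]eq_bigr do rewrite mulr_sumr.
  rewrite [RHS]exchange_big /=; apply: eq_bigr => z _.
  under [RHS]eq_bigr do rewrite mulrCA.
  rewrite -mulr_sumr; congr (_ * _).
  under [RHS]eq_bigr do rewrite mulr_sumr.
  rewrite [RHS]exchange_big /=; apply: eq_bigr => k _.
  under [RHS]eq_bigr do rewrite mulr_sumr.
  rewrite [RHS]exchange_big /=; apply: eq_bigr => s _.
  rewrite mulr_sumr; apply: eq_bigr => l' _; ring.
have J1lb : \sum_(l <- E) h_weight N o h1 l * Q l - e / 2 <= J1.
  rewrite J1E.
  apply: le_trans (_ : \sum_(l' <- E) h_weight N o h2 l' *
     (\sum_(l <- E) h_weight N o h1 l * (disjoint_off K l l')%:R - e / 2) <= _); last first.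
    by apply: ler_sum => l' _; rewrite ler_wpM2l ?(h_weight_ge0 hp2) // s1.
  under [leRHS]eq_bigr do rewrite mulrBr.
  rewrite sumrB -mulr_suml (h_weight_total hp2) mul1r lerB //.
  rewrite /Q; under [leLHS]eq_bigr do rewrite mulr_sumr.
  rewrite exchange_big /=; apply: ler_sum => l' _.
  rewrite mulr_sumr; apply: ler_sum => l _; by rewrite mulrCA.
rewrite -/E -/(Q _); lra.
Qed.

End MeetWalks.

(** * Two infinite components *)

Section SplitEvent.
Variables (R : realType) (V : choiceType) (N : network R V) (o : V).
Implicit Types (x y z w : V) (s l : seq V) (u : {fset V} -> bool).
Local Notation nball := (nball N o).

(** [U] is defined on all finite vertex sets; asking for an edge of [N] as well keeps a path of
    length [k] within distance [k], so that [reaches] has finite range. *)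
Definition adj u : rel V := [rel a b | edge_rel u a b && (b \in nbr N a)].

Definition reaches u r k x := exists s : seq V,
  [/\ size s = k, path (adj u) x s, uniq (x :: s) & all (fun v => v \notin nball r) (x :: s)].

(* The intersection of these finite-range events over k forces the removal of
   nball r to leave two infinite components. *)
Definition split_at r k u := exists x y,
  [/\ x \in nball r.+1 /\ y \in nball r.+1, reaches u r k x, reaches u r k y &
    forall s, path (edge_rel u) x s -> last x s = y ->
      all (fun v => v \in nball k) (x :: s) -> ~~ all (fun v => v \notin nball r) (x :: s)].

Lemma reaches_le u r j k x : (j <= k)%N -> reaches u r k x -> reaches u r j x.
Proof.
move=> jk [s [hs hp hu ha]]; exists (take j s); split.
- by rewrite size_takel // hs.
- by rewrite -[s](cat_take_drop j) cat_path in hp; case/andP: hp.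
- by move: hu; rewrite -{1}[s](cat_take_drop j) -cat_cons cat_uniq => /and3P[].
- by move: ha; rewrite -{1}[s](cat_take_drop j) -cat_cons all_cat => /andP[].
Qed.

Lemma split_le r j k u : (j <= k)%N -> split_at r k u -> split_at r j u.
Proof.
move=> jk [x [y [hxy hx hy hs]]]; exists x, y; split=> //.
- exact: reaches_le hx.
- exact: reaches_le hy.
move=> s h1 h2 h3; apply: hs => //; apply: sub_all h3 => v.
by apply: fsubsetP; apply: nball_le.
Qed.

Lemma adj_path_nball u r s x : x \in nball r -> path (adj u) x s ->
  all (fun v => v \in nball (r + size s)) (x :: s).
Proof.
elim: s x r => [|y s IH] x r hx; first by rewrite /= addn0 hx.
move=> /= /andP[/andP[_ hy] hs]; rewrite -addSnnS.
apply/andP; split; last exact: (IH y r.+1 (nball_nbr hx hy) hs).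
by apply: fsubsetP hx; apply: nball_le; rewrite addSn -addnS leq_addr.
Qed.

(** This serves twice: the upper bound on the radius makes the event finite-range, and the pairs
    taken off [nball r] make it insensitive to the tree near [o]. *)
Lemma split_ext r k u u' :
  (forall a b, a \in nball (r.+1 + k) -> b \in nball (r.+1 + k) ->
     a \notin nball r -> b \notin nball r -> u [fset a; b]%fset = u' [fset a; b]%fset) ->
  split_at r k u -> split_at r k u'.
Proof.
move=> huu [x [y [[xb yb] hx hy hs]]].
have hreach z : z \in nball r.+1 -> reaches u r k z -> reaches u' r k z.
  move=> hz [s [h1 h2 h3 h4]]; exists s; split=> //.
  have := adj_path_nball hz h2; rewrite h1 => h5.
  have h6 : all (fun v => (v \in nball (r.+1 + k)) && (v \notin nball r)) (z :: s).
    by apply/allP => v hv; rewrite (allP h5 _ hv) (allP h4 _ hv).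
  elim: s z h2 h6 {hz h1 h3 h4 h5} => //= v s IH z /andP[h1 h2] /and3P[h3 h4 h5].
  rewrite IH //= ?h4 // andbT; move: h1; rewrite /adj /edge_rel /= huu //.
  - by case/andP: h3.
  - by case/andP: h4.
  - by case/andP: h3.
  - by case/andP: h4.
exists x, y; split=> //; try exact: hreach.
move=> s h1 h2 h3; apply/negP => h4.
suff h5 : path (edge_rel u) x s by have := hs s h5 h2 h3; rewrite h4.
have h6 : all (fun v => (v \in nball (r.+1 + k)) && (v \notin nball r)) (x :: s).
  apply/allP => v hv; rewrite (allP h4 _ hv) andbT.
  by apply: fsubsetP (allP h3 _ hv); apply: nball_le; rewrite leq_addl.
elim: s x h1 h6 {xb hx hs h2 h3 h4} => //= v s IH z /andP[h1 h2] /and3P[h3 h4 h5].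
rewrite IH //= ?h4 // andbT; move: h1; rewrite /edge_rel /= huu //.
- by case/andP: h3.
- by case/andP: h4.
- by case/andP: h3.
- by case/andP: h4.
Qed.

Lemma component_mem (e : rel V) (K : {fset V}) z s v : path e z s ->
  all (fun v => v \notin K) (z :: s) -> v \in z :: s -> component_off e K z v.
Proof.
move=> hp ha hv; case/splitPl: hv hp ha => p1 p2 hl.
by rewrite cat_path -cat_cons all_cat => /andP[h _] /andP[h' _]; exists p1.
Qed.

(** The witnesses come from a finite ball and their conditions are monotone in [k], so one pair
    works for all [k]. *)
Lemma split_more_ends r u : (forall k, split_at r k u) -> more_than_one_end (edge_rel u).
Proof.
move=> hs.
pose Q k (p : V * V) := [/\ reaches u r k p.1, reaches u r k p.2 &
    forall s, path (edge_rel u) p.1 s -> last p.1 s = p.2 ->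
      all (fun v => v \in nball k) (p.1 :: s) -> ~~ all (fun v => v \notin nball r) (p.1 :: s)].
have Qle j k p : (j <= k)%N -> Q k p -> Q j p.
  move=> jk [h1 h2 h3]; split; first exact: reaches_le h1.
    exact: reaches_le h2.
  move=> s h4 h5 h6; apply: h3 => //; apply: sub_all h6 => v.
  by apply: fsubsetP; apply: nball_le.
pose L := [seq (x, y) | x <- enum_fset (nball r.+1), y <- enum_fset (nball r.+1)].
have [p [pL hp]] : exists p, p \in L /\ forall k, Q k p.
  apply: contrapT => hno.
  have [k hk] : exists k, forall p, p \in L -> ~ Q k p.
    have {}hno p : p \in L -> exists k, ~ Q k p.
      move=> pL; apply: contrapT => h; apply: hno; exists p; split=> // k.
      by apply: contrapT => hk; apply: h; exists k.
    elim: L hno => [|p L IH] hno; first by exists 0.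
    have [k hk] := hno p (mem_head _ _).
    have [j hj] := IH (fun q hq => hno q (mem_behead (s := p :: L) hq)).
    exists (maxn k j) => q; rewrite inE => /orP[/eqP->|hq] hQ.
      by apply: hk; apply: Qle hQ; rewrite leq_maxl.
    by apply: (hj q hq); apply: Qle hQ; rewrite leq_maxr.
  have [x [y [[xb yb] h1 h2 h3]]] := hs k.
  apply: (hk (x, y)); last by split.
  exact: allpairs_f.
case: p pL hp => x y _ hp; rewrite /Q /= in hp.
have xr : x \notin nball r by have [[s [_ _ _ /andP[]]]] := hp 0.
have yr : y \notin nball r by have [_ [s [_ _ _ /andP[]]]] := hp 0.
have hinf z : (forall k, reaches u r k z) ->
    infinite_set (component_off (edge_rel u) (nball r) z).
  move=> hz /finite_fsetP[A hA].
  have [s [h1 h2 h3 h4]] := hz #|` A|.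
  have hsub : {subset z :: s <= enum_fset A}.
    move=> v hv; have : [set` A] v; last by [].
    rewrite -hA; apply: component_mem hv => //.
    by apply: sub_path h2 => a b /andP[].
  by have := uniq_leq_size h3 hsub; rewrite /= h1 ltnn.
exists (nball r), (component_off (edge_rel u) (nball r) x), (component_off (edge_rel u) (nball r) y).
split.
- by split; [apply: hinf => k; case: (hp k)|exists x].
- by split; [apply: hinf => k; case: (hp k)|exists y].
move=> e; have : component_off (edge_rel u) (nball r) y y by exists [::]; split; rewrite //= yr.
rewrite -e => -[s [h1 h2 h3]].
have [k hk] := nball_exhausts_fset N o [fset v in x :: s]%fset.
have h4 : all (fun v => v \in nball k) (x :: s).
  by apply/allP => v hv; apply: (fsubsetP hk); move: hv; rewrite !inE.
have [_ _ hnot] := hp k; exact: (negP (hnot s h1 h2 h4)) h3.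
Qed.

End SplitEvent.

(** * Bounds for the spanning tree of a finite subnetwork *)

Section FiniteBounds.
Variables (R : realType) (V : choiceType) (N : network R V) (o : V).
Variables (W : {fset V}) (F : {fset {fset V}}).
Hypothesis WF : finite_connected_subnetwork N W F.
Hypothesis oW : o \in W.
Local Notation nball := (nball N o).
Local Notation sv := (surv N (noto o) (fun=> 1)).

Let rt : W := FSetSub oW.
Local Notation c := (sub_cond N (W := W) F).
Local Notation Z := (Zf c).
Local Notation tree p := (fun e => e \in ptree rt p).
Hypothesis Zo_gt0 : 0 < Z [set rt]%SET (fun=> 1).

Let c_ge0 := sub_cond_ge0 WF.
Let c_conn := sub_connect WF rt.

Lemma mean_Zf (f : ({fset V} -> bool) -> R) :
  finite_ust_mean N W F f = Z [set rt]%SET (fun p => f (tree p)) / Z [set rt]%SET (fun=> 1).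
Proof.
rewrite /finite_ust_mean (spanning_tree_sum WF rt f); congr (_ / _).
rewrite -(spanning_tree_sum WF rt (fun=> 1)); apply: eq_bigr => T _; by rewrite mulr1.
Qed.

Lemma Zf_le_tree (G1 G2 : {ffun W -> W} -> R) :
  (forall p, forest [set rt]%SET p ->
     (forall x, x != rt -> [fset val x; val (p x)]%fset \in F) -> G1 p <= G2 p) ->
  Z [set rt]%SET G1 <= Z [set rt]%SET G2.
Proof.
move=> h; apply: ler_sum => p hp.
have [/forallP hF|] := boolP [forall x, (x != rt) ==> ([fset val x; val (p x)]%fset \in F)].
  rewrite ler_wpM2l ?wt_ge0 ?h // => x xr; by have := hF x; rewrite xr.
rewrite negb_forall => /existsP[x]; rewrite negb_imply => /andP[xo hx].
by rewrite /wt (bigD1 x) ?inE //= /sub_cond (negbTE hx) !mul0r.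
Qed.

Section Tree.
Variable p : {ffun W -> W}.
Hypotheses (hp : forest [set rt]%SET p)
  (hF : forall x, x != rt -> [fset val x; val (p x)]%fset \in F).

Lemma tree_step_nball n (x : W) : val (p x) \in nball n -> val x \in nball n.+1.
Proof.
move=> h; have [->|xr] := eqVneq x rt; first exact: nball_root.
by apply: nball_nbr h _; rewrite nbr_sym; apply: (F_edge WF (hF xr)).
Qed.

Lemma tree_iter_nball n i (x : W) : val (iter i p x) \in nball n -> val x \in nball (n + i).
Proof.
elim: i n => [|i IH] n; first by rewrite addn0.
by rewrite iterS => /tree_step_nball/IH; rewrite addSnnS.
Qed.

Variables (r : nat).
Let K := vset W (nball r).

(** Tree steps change the distance to [o] by at most one, so the branch of a vertex outside the ball
    of radius [r + k] makes at least [k] steps before its gate. Read backwards from the gate, they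
    form the simple path. *)
Lemma gate_reaches (z x : W) k : gate K p z x -> val z \notin nball (r + k) ->
  val x \in nball r.+1 /\ reaches N o (tree p) r k (val x).
Proof.
move=> [i [ex hi hpx]] hz.
have Kr y : (y \in K) = (val y \in nball r) by rewrite inE.
have xb : val x \in nball r.+1 by apply: tree_step_nball; rewrite -Kr.
split=> //.
have ki : (k <= i)%N.
  rewrite leqNgt; apply: contra hz => hik.
  have := @tree_iter_nball r i.+1 z; rewrite iterS -ex -Kr => /(_ hpx).
  by apply: fsubsetP; apply: nball_le; rewrite leq_add2l.
have nroot j : (j <= i)%N -> iter j p z != rt.
  by move=> /hi; rewrite Kr; apply: contraNneq => ->; apply: nball_root.
have inj a b : (a < b)%N -> (b <= i)%N -> iter a p z != iter b p z.
  move=> ab bi; have h : iter a p z \notin [set rt]%SET.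
    by rewrite inE; apply: nroot; apply: leq_trans bi; apply: ltnW.
  have := forest_no_cycle (b - a.+1) hp h.
  by rewrite -iterD addSnnS subnK // eq_sym.
exists [seq val (iter (i - j.+1) p z) | j <- iota 0 k]; split.
- by rewrite size_map size_iota.
- have hgen n m : (m + n <= i)%N -> path (adj N (tree p)) (val (iter (i - m) p z))
      [seq val (iter (i - j.+1) p z) | j <- iota m n].
    elim: n m => //= n IH m hm; rewrite IH ?andbT; last by rewrite addSnnS.
    have e : p (iter (i - m.+1) p z) = iter (i - m) p z.
      by rewrite -iterS subnSK //; apply: leq_trans hm; rewrite addnS ltnS leq_addr.
    have nr : iter (i - m.+1) p z != rt by apply: nroot; rewrite leq_subr.
    have he := hF nr; rewrite e in he.
    rewrite /adj /edge_rel /= ptree_edge nr e eqxx orbT /=.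
    by rewrite nbr_sym; apply: (F_edge WF he).
  by have := hgen k 0 ki; rewrite subn0 -ex.
- have -> : val x :: [seq val (iter (i - j.+1) p z) | j <- iota 0 k] =
     [seq val (iter (i - j) p z) | j <- iota 0 k.+1].
    rewrite /= subn0 -ex; congr (_ :: _).
    by rewrite (iotaDl 1 0) -map_comp.
  rewrite map_inj_in_uniq ?iota_uniq // => a b; rewrite !mem_iota /= !add0n !ltnS => ha hb /val_inj e.
  apply/eqP; rewrite eqn_leq; apply/andP; split; rewrite leqNgt; apply/negP => hab.
    have := inj (i - a)%N (i - b)%N; rewrite e eqxx => h.
    by have := h (ltn_sub2l (leq_trans hab (leq_trans ha ki)) hab) (leq_subr _ _).
  have := inj (i - b)%N (i - a)%N; rewrite e eqxx => h.
  by have := h (ltn_sub2l (leq_trans hab (leq_trans hb ki)) hab) (leq_subr _ _).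
- apply/allP => v; rewrite inE => /orP[/eqP->|/mapP[j _ ->]].
    by rewrite -Kr ex hi.
  by rewrite -Kr hi // leq_subr.
Qed.

Lemma coalesce_split (z w : W) k : val z \notin nball (r + k) -> val w \notin nball (r + k) ->
  coalesce rt K z w p -> split_at N o r k (tree p).
Proof.
move=> hz hw hc.
have Kr y : (y \in K) = (val y \in nball r) by rewrite inE.
have out y : val y \notin nball (r + k) -> y \notin K.
  by rewrite Kr; apply: contra; apply: fsubsetP; apply: nball_le; rewrite leq_addr.
have rK : rt \in K by rewrite Kr; apply: nball_root.
have [x [y [gx gy hs]]] := coalesce_gates hp rK (out _ hz) (out _ hw) hc.
have [xb hx] := gate_reaches gx hz; have [yb hy] := gate_reaches gy hw.
exists (val x), (val y); split=> // s h1 h2 _; apply/negP => h3.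
have [s' es hs'] := lift_path WF (ptree_sub hF) h1.
apply: (negP (hs s' _ _)).
- apply: sub_path hs' => a b; rewrite /sub_rel /= ptree_edge /par_rel /=.
  by case/orP => /andP[_ ->]; rewrite ?orbT.
- by apply: val_inj; rewrite -h2 es last_map.
move: h3; rewrite es -(map_cons val x s') all_map; apply: sub_all => v /=.
by rewrite Kr.
Qed.

End Tree.

Lemma ptree_agree (p q : {ffun W -> W}) a b : (forall v, val v = a \/ val v = b -> p v = q v) ->
  [fset a; b]%fset \in ptree rt p -> [fset a; b]%fset \in ptree rt q.
Proof.
move=> h /ptreeP[x xo e]; apply/ptreeP; exists x; rewrite // e -h //.
by case/fset2_eq: e => -[-> ->]; [left|right].
Qed.

Definition split_ind r k (u : {fset V} -> bool) : R := (`[< split_at N o r k u >])%:R.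

(** The constant 4 is the product of the two mass bounds. Since [m1] and [m2] vanish on the ball of
    radius [r + k], any pair that counts and merges inside [nball r] yields a split. *)
Lemma mean_split_lb (D : {fset V}) (m1 m2 : V -> R) r k t : o \notin D ->
  (forall x, x \in D -> full N W F x) ->
  (forall x, 0 <= m1 x) -> (forall x, 0 <= m2 x) ->
  (forall x, x \in nball (r + k) -> m1 x = 0) -> (forall x, x \in nball (r + k) -> m2 x = 0) ->
  \sum_(z <- D) m1 z <= 2 -> \sum_(z <- D) m2 z <= 2 ->
  \sum_(z <- D) m1 z * \sum_(k < t) \sum_(s <- lists D k) walk_to N o z s *
    \sum_(w <- D) m2 w * \sum_(k' < t) \sum_(s' <- lists D k') walk_to N o w s' *
      (disjoint_off (nball r) (z :: s) (w :: s'))%:R <=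
  4 * finite_ust_mean N W F (split_ind r k).
Proof.
move=> oD hD m10 m20 m1r m2r m1s m2s; rewrite mean_Zf mulrA ler_pdivlMr // mulrC.
apply: le_trans (coalesce_walks WF Zo_gt0 oD hD (nball_root N o r) m10 m20 t) _.
set S := Z _ _; have S0 : 0 <= S by apply: Zf_ge0.
have h2 (G : V -> R) : (forall w, w \notin nball (r + k) -> 0 <= G w <= S) ->
    \sum_(w <- D) m2 w * G w <= 2 * S.
  move=> hG; apply: le_trans (_ : \sum_(w <- D) m2 w * S <= _); last first.
    by rewrite -mulr_suml ler_wpM2r.
  apply: ler_sum => w _; have [wr|wr] := boolP (w \in nball (r + k)).
    by rewrite m2r ?mul0r.
  by rewrite ler_wpM2l //; case/andP: (hG w wr).
apply: le_trans (_ : \sum_(z <- D) m1 z * (2 * S) <= _); last first.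
  rewrite -mulr_suml mulrA ler_wpM2r //; lra.
apply: ler_sum => z _; have [zr|zr] := boolP (z \in nball (r + k)).
  by rewrite m1r ?mul0r.
rewrite ler_wpM2l // h2 // => w wr; rewrite /ext.
case: insubP => [z' _ ez|_]; last by rewrite lexx.
case: insubP => [w' _ ew|_]; last by rewrite lexx.
rewrite Zf_ge0 //=; apply: Zf_le_tree => p hp hF.
case hc: (coalesce _ _ _ _ _) => //=; rewrite ler_nat lt0b.
apply/asboolP; apply: (coalesce_split hp hF _ _ hc); rewrite ?ez ?ew //.
Qed.

(** [Zf_local] bounds the joint mean below by the wired weight of [C]. Applied to the complement of
    [C] with trivial [th], it bounds the wired weight of the complement above. The two leave a gap
    only for branches from [nball m] that end in the wired part. *)
Lemma mean_local (C : ({fset V} -> bool) -> bool) m r k : (m <= r)%N ->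
  (forall x, x \in nball r -> x != o -> full N W F x) ->
  (forall u u' : {fset V} -> bool, (forall a b, a \in nball m -> b \in nball m ->
     u [fset a; b]%fset = u' [fset a; b]%fset) -> C u = C u') ->
  (finite_ust_mean N W F (fun u => (C u)%:R) - \sum_(v <- nball m) sv r v) *
    finite_ust_mean N W F (split_ind r k) <=
  finite_ust_mean N W F (fun u => (C u)%:R * split_ind r k u).
Proof.
move=> mr hfull hC.
pose B : {set W} := vset W (nball r); pose L : {set W} := vset W (nball m).
have rL : rt \in L by rewrite inE; apply: nball_root.
have rB : rt \in B by rewrite inE; apply: nball_root.
pose X : {set W} := (rt |: ~: B)%SET.
pose th (p : {ffun W -> W}) := split_ind r k (tree p).
have th_ge0 p : 0 <= th p by rewrite ler0n.
have agree (p q : {ffun W -> W}) a b : (forall v, val v = a \/ val v = b -> p v = q v) ->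
    tree p [fset a; b]%fset = tree q [fset a; b]%fset.
  by move=> h; apply/idP/idP; apply: ptree_agree => v /h.
have th_inv (p : {ffun W -> W}) z y : z \in B -> th (upd p z y) = th p.
  move=> zB; congr (nat_of_bool _)%:R; rewrite inE in zB.
  have hag a b : a \notin nball r -> b \notin nball r ->
      tree (upd p z y) [fset a; b]%fset = tree p [fset a; b]%fset.
    move=> ar br; apply: agree => v hv; rewrite upd_other //.
    by apply: contraTneq zB => <-; case: hv => ->.
  by apply/asboolP/asboolP; apply: split_ext => a b _ _ ar br; rewrite hag.
have hCt (p q : {ffun W -> W}) : {in hull L p, q =1 p} -> C (tree q) = C (tree p).
  move=> hpq; apply: hC => a b am bm; apply: agree => v hv; apply: hpq.
  by apply: (fintype.subsetP (hull_sub _ _)); rewrite inE; case: hv => ->.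
pose T := Z [set rt]%SET (fun=> 1); pose z1 := Z X (fun=> 1).
have z1_gt0 : 0 < z1 by apply: (Zf_gt0 c_ge0 Zo_gt0); rewrite /X finset.setU11.
pose good (p : {ffun W -> W}) := [forall v in L, sink p v == rt].
pose ga := Z X (fun p => (good p)%:R * (C (tree p))%:R).
pose gb := Z X (fun p => (good p)%:R * (~~ C (tree p))%:R).
have l1 : Z [set rt]%SET th * ga <= Z [set rt]%SET (fun p => (C (tree p))%:R * th p) * z1.
  exact: (Zf_local c_ge0 c_conn Zo_gt0 th_ge0 th_inv (C := fun p => C (tree p)) rL rB hCt).
have l2 : T * gb <= Z [set rt]%SET (fun p => (~~ C (tree p))%:R) * z1.
  have := Zf_local c_ge0 c_conn Zo_gt0 (th := fun=> 1) (B := B) (fun _ => ler01)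
    (fun _ _ _ _ => erefl) (C := fun p => ~~ C (tree p)) rL rB.
  move=> /(_ (fun p q h => congr1 negb (hCt p q h))).
  by rewrite (Zf_eq c (G1 := fun p => _ * 1) (G2 := fun p => (~~ C (tree p))%:R)) // => p _; rewrite mulr1.
have hTC : Z [set rt]%SET (fun p => (~~ C (tree p))%:R) = T - Z [set rt]%SET (fun p => (C (tree p))%:R).
  apply/eqP; rewrite eq_sym subr_eq -Zf_add; apply/eqP; apply: Zf_eq => p _.
  by case: (C _); rewrite ?add0r ?addr0.
have sv_step (v : W) : val v \in nball r -> v != rt ->
    \sum_x c v x * sv r (val x) <= (\sum_x c v x) * sv r (val v).
  move=> vr vo; have vo' : val v != o by apply: contraNneq vo => e; apply/eqP/val_inj.
  have hfv := hfull _ vr vo'.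
  rewrite (ext_sum WF (fun x => sv r (val x)) hfv) (ext_total WF hfv).
  apply: le_trans (_ : \sum_(y <- nbr N (val v)) conductance N (val v) y * sv r y <= _).
    apply: ler_sum => y _; rewrite ler_wpM2l ?conductance_ge0 // /ext.
    by case: insubP => [y' _ ->//|_]; apply: sv_ge0.
  rewrite -sum_walk_probE ler_wpM2l ?(ltW (total_conductance_gt0 _ _)) //.
  exact: sv_superharm.
(* Ending in the wired part has a probability harmonic in [v]; it is compared with [sv r], which is
   superharmonic, nonnegative, and 1 outside the ball of radius [r]. *)
have bad (v : W) : Z X (fun p => (sink p v != rt)%:R) <= sv r (val v) * z1.
  rewrite -subr_le0.
  pose f w := Z X (fun p => 1 * (sink p w != rt)%:R).
  have -> : Z X (fun p => (sink p v != rt)%:R) = f v by apply: Zf_eq => p _; rewrite mul1r.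
  apply: (finite_max_principle c_ge0 c_conn (I := B :\ rt) (u := fun w => f w - sv r (val w) * z1)) => [|w|w].
  - by rewrite !inE eqxx.
  - rewrite in_setD1 => /andP[wo wB]; rewrite inE in wB.
    have wX : w \notin X by rewrite !inE negb_or negbK wo.
    rewrite mulrBr; under [leRHS]eq_bigr do rewrite mulrBr mulrA.
    rewrite sumrB -mulr_suml (Zf_harm c_ge0 (th := fun=> 1) (fun v => (v != rt)%:R) wX) //.
    by rewrite lerB // mulrA ler_wpM2r ?(ltW z1_gt0) // sv_step.
  rewrite in_setD1 negb_and negbK inE => /orP[/eqP->|wr].
    rewrite sv_root mul0r subr0 /f /Zf big1 // => p hp.
    by rewrite (sink_id hp) ?/X ?finset.setU11 // eqxx !mulr0.
  rewrite sv_outside // mul1r subr_le0; apply: Zf_le => // p _.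
  by rewrite mul1r lern1 leq_b1.
have hgood : z1 - z1 * (\sum_(v <- nball m) sv r v) <= ga + gb.
  rewrite /ga /gb -Zf_add lerBlDr -lerBlDl.
  have -> : z1 - Z X (fun p => (good p)%:R * (C (tree p))%:R + (good p)%:R * (~~ C (tree p))%:R) =
      Z X (fun p => (~~ good p)%:R).
    apply/eqP; rewrite subr_eq -Zf_add; apply/eqP; apply: Zf_eq => p _.
    by case: (good p); case: (C _); rewrite /= ?mulr0 ?mulr1 ?addr0 ?add0r.
  pose bd x (p : {ffun W -> W}) : R := if insub x is Some v then (sink p (v : W) != rt)%:R else 0.
  have bd0 x p : 0 <= bd x p by rewrite /bd; case: insubP.
  apply: le_trans (_ : Z X (fun p => \sum_(x <- nball m) bd x p) <= _).
    apply: Zf_le => // p _; case hg: (good p) => /=; first by apply: sumr_ge0.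
    move/negbT: hg; rewrite /good negb_forall => /existsP[v]; rewrite negb_imply => /andP[vL hv].
    rewrite inE in vL; rewrite (bigD1_seq (val v)) ?fset_uniq //= {1}/bd valK hv lerDl.
    exact: sumr_ge0.
  rewrite Zf_sum mulr_sumr; apply: ler_sum => x _; rewrite /bd mulrC.
  case: insubP => [v _ <-|_]; first exact: bad.
  by rewrite /Zf big1 ?mulr_ge0 ?sv_ge0 ?(ltW z1_gt0) // => p _; rewrite mulr0.
rewrite !mean_Zf -/T -/(split_ind r k _).
set eps := \sum_(v <- nball m) sv r v; rewrite -/eps in hgood.
set ZC := Z _ (fun p => (C (tree p))%:R) in hTC *.
have Zth0 : 0 <= Z [set rt]%SET th by apply: Zf_ge0.
rewrite mulrA ler_pM2r ?invr_gt0 // -(ler_pM2r z1_gt0).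
apply: le_trans l1; rewrite -mulrA [leLHS]mulrC -mulrA ler_wpM2l //.
rewrite hTC in l2.
have h3 : gb <= (T - ZC) * z1 / T by rewrite ler_pdivlMr // mulrC.
have h4 : (T - ZC) * z1 / T = z1 - z1 * (ZC / T).
  by field; rewrite gt_eqF.
rewrite mulrBr; lra.
Qed.

End FiniteBounds.

(** * Passage to the limit *)

Section Probability.
Variables (d : measure_display) (T : measurableType d) (R : realType) (P : probability T R).

Definition pr (A : set T) : R := fine (P A).

Lemma prE A : measurable A -> (pr A)%:E = P A.
Proof. by move=> mA; rewrite /pr fineK // fin_num_measure. Qed.

Lemma pr_ge0 A : 0 <= pr A.
Proof. exact: fine_ge0. Qed.

Lemma pr_le A B : measurable A -> measurable B -> A `<=` B -> pr A <= pr B.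
Proof. by move=> mA mB AB; rewrite -lee_fin !prE // le_measure ?inE. Qed.

Lemma pr_le1 A : measurable A -> pr A <= 1.
Proof. by move=> mA; rewrite -lee_fin prE // probability_le1. Qed.

Lemma prD A B : measurable A -> measurable B -> A `<=` B -> pr (B `\` A) = pr B - pr A.
Proof.
move=> mA mB AB; apply: EFin_inj; rewrite EFinB !prE //; last exact: measurableD.
rewrite measureD //; last by rewrite ltey_eq fin_num_measure.
by rewrite setIidr.
Qed.

Lemma pr_cvg_nonincreasing (A : nat -> set T) : (forall n, measurable (A n)) ->
  (forall m n, (m <= n)%N -> A n `<=` A m) -> pr (A n) @[n --> \oo] --> pr (\bigcap_n A n).
Proof.
move=> mA hA; apply: fine_cvg; rewrite prE; last exact: bigcapT_measurable.
apply: nonincreasing_cvg_mu => //.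
- by rewrite ltey_eq fin_num_measure.
- exact: bigcapT_measurable.
by move=> m n mn; apply/subsetPset; apply: hA.
Qed.

Lemma pr_cvg_nondecreasing (A : nat -> set T) : (forall n, measurable (A n)) ->
  (forall m n, (m <= n)%N -> A m `<=` A n) -> pr (A n) @[n --> \oo] --> pr (\bigcup_n A n).
Proof.
move=> mA hA; apply: fine_cvg; rewrite prE; last exact: bigcupT_measurable.
apply: nondecreasing_cvg_mu => //; first exact: bigcupT_measurable.
by move=> m n mn; apply/subsetPset; apply: hA.
Qed.

End Probability.

Section Cylinders.
Variables (R : realType) (V : choiceType) (N : network R V) (o : V).
Variables (d : measure_display) (Omega : measurableType d) (P : probability Omega R)
  (U : Omega -> {fset V} -> bool).
Hypothesis mU : forall e, measurable [set w | U w e].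
Implicit Types (C : ({fset V} -> bool) -> bool).

Definition determined m C := forall u u' : {fset V} -> bool,
  (forall a b, a \in nball N o m -> b \in nball N o m -> u [fset a; b]%fset = u' [fset a; b]%fset) ->
  C u = C u'.

Definition ball_edges m : seq {fset V} :=
  [seq [fset a; b]%fset | a <- enum_fset (nball N o m), b <- enum_fset (nball N o m)].

Lemma determinedP m C (u u' : {fset V} -> bool) : determined m C ->
  (forall e, e \in ball_edges m -> u e = u' e) -> C u = C u'.
Proof.
by move=> hC h; apply: hC => a b ha hb; apply: h; apply/allpairsP; exists (a, b).
Qed.

(** The event is a finite union over the patterns that [U] can show on [ball_edges m]. *)
Lemma determined_measurable m C : determined m C -> measurable [set w | C (U w)].
Proof.
move=> hC; pose A := [fset e in ball_edges m]%fset.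
rewrite (_ : [set w | C (U w)] = \bigcup_(B in [set` [fset B in fpowerset A | C (fun e => e \in B)]%fset])
    \bigcap_(e in [set` A]) [set w | U w e = (e \in B)]).
  apply: fin_bigcup_measurable; first exact: finite_fset.
  move=> B _; apply: fin_bigcap_measurable; first exact: finite_fset.
  move=> e _; case: (e \in B); first exact: mU.
  rewrite (_ : [set w | _] = ~` [set w | U w e]); first exact: measurableC.
  by apply/seteqP; split=> w /=; [move=> ->|move/negP/negbTE].
apply/seteqP; split=> w /= => [hw|[B hB hw]].
  exists [fset e in A | U w e]%fset.
    rewrite /= !inE fpowersetE; apply/andP; split.
      by apply/fsubsetP => e; rewrite !inE => /andP[].
    rewrite -(determinedP (u := U w) hC) // => e he.
    by rewrite !inE he.
  by move=> e /= he; rewrite !inE in he *; rewrite he.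
have : B \in [fset B in fpowerset A | C (fun e => e \in B)]%fset by [].
rewrite !inE => /andP[_]; rewrite -(determinedP (u := U w) hC) // => e he.
by apply: hw; rewrite /= !inE.
Qed.

Lemma determined_continuous m C : determined m C ->
  continuous ((fun u => (C u)%:R) : {ptws {fset V} -> bool} -> R).
Proof.
move=> hC u; apply: cvg_near_cst.
have Fu : Filter (nbhs (u : {ptws {fset V} -> bool})) := nbhs_filter _.
have : nbhs (u : {ptws {fset V} -> bool}) [set u' | forall e, e \in ball_edges m -> u' e = u e].
  elim: (ball_edges m) => [|e l IH]; first by apply: filterE => u' e.
  have he : nbhs (u : {ptws {fset V} -> bool}) [set u' | u' e = u e].
    have := @proj_continuous {fset V} (fun=> bool) e u.
    by move=> /(_ [set u e] (discrete_set1 (u e))).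
  apply: filterS2 he IH => u' h1 h2 e'; rewrite inE => /orP[/eqP->//|].
  exact: h2.
apply: filterS => u' hu'; congr (nat_of_bool _)%:R.
exact: determinedP hC hu'.
Qed.

Lemma determined_cvg m C (W : nat -> {fset V}) (F : nat -> {fset {fset V}}) :
  determined m C ->
  (forall f : {ptws {fset V} -> bool} -> R, continuous f ->
      (finite_ust_mean N (W n) (F n) f)%:E @[n --> \oo]
        --> (\int[P]_w (f (U w))%:E)%E) ->
  finite_ust_mean N (W n) (F n) (fun u => (C u)%:R) @[n --> \oo] --> pr P [set w | C (U w)].
Proof.
move=> hC hcvg; have mC := determined_measurable hC.
have := hcvg _ (determined_continuous hC).
rewrite (_ : (\int[P]_w _)%E = (pr P [set w | C (U w)])%:E).
  by move/fine_cvg.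
rewrite prE // -(setIT [set w | C (U w)]) -integral_indic //; apply: eq_integral => w _.
rewrite indicE; congr (_%:R%:E); case hw: (C (U w)).
  by rewrite mem_set.
by rewrite memNset //= hw.
Qed.

End Cylinders.

Lemma cvg_close (R : realType) (u : nat -> R) (l e : R) : u n @[n --> \oo] --> l -> 0 < e ->
  exists n0, forall n, (n0 <= n)%N -> `|l - u n| <= e.
Proof.
move=> hc e0; have [n0 _ h] := (@cvgrPdist_le _ _ _ _ _ _ _).1 hc e e0.
by exists n0 => n hn; apply: h.
Qed.

Section MeetEvent.
Variables (R : realType) (V : choiceType) (N : network R V) (o : V).
Variables (d : measure_display) (Omega : measurableType d) (P : probability Omega R)
  (Y Z : nat -> Omega -> V).
Hypotheses (mY : forall n v, measurable [set w | Y n w = v])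
  (mZ : forall n v, measurable [set w | Z n w = v]).

(** [V] is a mere choice type; quantifying the common vertex over balls, which exhaust it, makes the
    intersection countable. *)
Lemma measurable_meet_inside K : measurable (meet_inside Y Z K).
Proof.
rewrite (_ : meet_inside Y Z K = \bigcap_i \bigcap_j \bigcap_r
   \bigcap_(v in [set` (nball N o r `\` K)%fset]) ~` ([set w | Y i w = v] `&` [set w | Z j w = v])).
  do 3 (apply: bigcapT_measurable => ?).
  apply: fin_bigcap_measurable; first exact: finite_fset.
  by move=> v _; apply/measurableC/measurableI.
apply/seteqP; split=> w.
  move=> hw i _ j _ r _ v /=; rewrite in_fsetD => /andP[vK _] [e1 e2].
  by move: vK; rewrite -e1 (hw i j (etrans e1 (esym e2))).
move=> hw i j e; apply: contrapT => /negP yK.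
have [r hr] := nball_exhausts N o (Y i w).
apply: (hw i I j I r I (Y i w)); last by split=> //=.
by rewrite /= in_fsetD yK.
Qed.

(** A finite set of common vertices fits into a ball, so the event is a countable union and some
    member has positive probability. *)
Lemma finite_meet_inside : (0 < P [set w | finite_set (visited Y w `&` visited Z w)])%E ->
  exists r, (0 < P (meet_inside Y Z (nball N o r)))%E.
Proof.
rewrite (_ : [set w | _] = \bigcup_r meet_inside Y Z (nball N o r)); last first.
  apply/seteqP; split=> w /=.
    move=> /finite_fsetP[A hA]; have [r hr] := nball_exhausts_fset N o A.
    exists r => // i j e; apply: (fsubsetP hr).
    have : [set` A] (Y i w); last by [].
    by rewrite -hA; split; [exists i|exists j].
  move=> [r _ hw]; apply: (sub_finite_set _ (finite_fset (nball N o r))).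
  by move=> v [[i _ <-] [j _ e]]; apply: (hw i j); rewrite e.
move=> hpos; apply: contrapT => hno.
have h0 r : P (meet_inside Y Z (nball N o r)) = 0%E.
  apply/eqP; rewrite eq_le measure_ge0 andbT leNgt; apply/negP => h.
  by apply: hno; exists r.
have : P.-negligible (\bigcup_r meet_inside Y Z (nball N o r)).
  apply: negligible_bigcup => r; apply/negligibleP; first exact: measurable_meet_inside.
  exact: h0.
move/measure_negligible => h; move: hpos; rewrite h ?ltxx //.
by apply: bigcup_measurable => r _; apply: measurable_meet_inside.
Qed.

Lemma meet_inside_mono r r' : (r <= r')%N ->
  meet_inside Y Z (nball N o r) `<=` meet_inside Y Z (nball N o r').
Proof.
by move=> rr w hw i j e; apply: (fsubsetP (nball_le N o rr)); apply: hw e.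
Qed.

End MeetEvent.

Lemma exhaustion_full (R : realType) (V : choiceType) (N : network R V)
    (W : nat -> {fset V}) (F : nat -> {fset {fset V}}) (l : seq V) : exhaustion N W F ->
  exists n0, forall n, (n0 <= n)%N -> forall x, x \in l -> full N (W n) (F n) x.
Proof.
move=> [_ hmono hV hE].
have Wle m n : (m <= n)%N -> (W m `<=` W n)%fset.
  elim: n => [|n IH]; first by rewrite leqn0 => /eqP->.
  rewrite leq_eqVlt => /orP[/eqP->//|]; rewrite ltnS => /IH h.
  exact: fsubset_trans h (hmono n).1.
have Fle m n : (m <= n)%N -> (F m `<=` F n)%fset.
  elim: n => [|n IH]; first by rewrite leqn0 => /eqP->.
  rewrite leq_eqVlt => /orP[/eqP->//|]; rewrite ltnS => /IH h.
  exact: fsubset_trans h (hmono n).2.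
have hx x : exists n0, forall n, (n0 <= n)%N -> full N (W n) (F n) x.
  have [n1 h1] := hV x.
  have [n2 h2] : exists n2, forall y, y \in enum_fset (nbr N x) -> [fset x; y]%fset \in F n2.
    have : forall y, y \in enum_fset (nbr N x) -> y \in nbr N x by [].
    elim: (enum_fset (nbr N x)) => [|y s IH] hs; first by exists 0.
    have [n2 h2] := IH (fun z hz => hs z (mem_behead (s := y :: s) hz)).
    have [n3 h3] : exists n, [fset x; y]%fset \in F n.
      by apply: hE; exists x, y; split=> //; apply: hs; apply: mem_head.
    exists (maxn n2 n3) => z; rewrite inE => /orP[/eqP->|/h2].
      by apply: (fsubsetP (Fle _ _ _)) h3; rewrite leq_maxr.
    by apply: (fsubsetP (Fle _ _ _)); rewrite leq_maxl.
  exists (maxn n1 n2) => n; rewrite geq_max => /andP[hn1 hn2]; split.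
    exact: (fsubsetP (Wle _ _ hn1)).
  by move=> y /h2; apply: (fsubsetP (Fle _ _ hn2)).
elim: l => [|x l [n0 h0]]; first by exists 0.
have [n1 h1] := hx x; exists (maxn n0 n1) => n; rewrite geq_max => /andP[hn0 hn1] y.
by rewrite inE => /orP[/eqP->|]; [apply: h1|apply: h0].
Qed.

(** * From a uniform lower bound to probability one *)

Section ZeroOne.
Variables (R : realType) (V : choiceType) (N : network R V) (o : V).
Variables (d : measure_display) (Omega : measurableType d) (P : probability Omega R)
  (U : Omega -> {fset V} -> bool).
Hypothesis mU : forall e, measurable [set w | U w e].
Variables (delta : R) (r0 : nat) (eps : nat -> nat -> R).
Hypotheses (delta_gt0 : 0 < delta) (delta_le1 : delta <= 1).

Let splitb r k u := `[< split_at N o r k u >].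

Hypothesis split_lb : forall r k, (r0 <= r)%N -> delta <= pr P [set w | splitb r k (U w)].
Hypothesis eps_small : forall m e, 0 < e -> exists r1, forall r, (r1 <= r)%N -> eps m r <= e.
Hypothesis split_local : forall C m r k, determined N o m C -> (m <= r)%N ->
  (pr P [set w | C (U w)] - eps m r) * pr P [set w | splitb r k (U w)] <=
  pr P [set w | C (U w) && splitb r k (U w)].

Lemma split_determined r k : determined N o (r.+1 + k) (splitb r k).
Proof.
move=> u u' h; apply/asboolP/asboolP; apply: split_ext => a b ha hb _ _; first exact: h.
by rewrite h.
Qed.

Lemma determined_le m n C : (m <= n)%N -> determined N o m C -> determined N o n C.
Proof.
move=> mn hC u u' h; apply: hC => a b ha hb.
by apply: h; apply: (fsubsetP (nball_le N o mn)).
Qed.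

Let mS r k : measurable [set w | splitb r k (U w)].
Proof. exact (determined_measurable mU (@split_determined r k)). Qed.

(* If the event Bad that no split happens had positive probability, then a
   cylinder C n k close to it would be nearly independent of the splits far
   away, which have probability at least delta. *)
Lemma split_ae : \forall w \ae P, more_than_one_end (edge_rel (U w)).
Proof.
pose A r := \bigcap_k [set w | splitb r k (U w)].
have mA r : measurable (A r) by apply: bigcapT_measurable.
(* [Bad] is approximated from above by [NN n], decreasing in [n], and [NN n] from below by the
   cylinders [C n k], increasing in [k]. *)
pose NN n := \bigcap_(r in `I_n) ~` A r.
have mNN n : measurable (NN n).
  by apply: bigcap_measurableType => r _; apply: measurableC.
pose Bad := \bigcap_n NN n.
have mBad : measurable Bad by apply: bigcapT_measurable.
have NNle m n : (m <= n)%N -> NN n `<=` NN m.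
  by move=> mn w hw r /= rm; apply: hw; apply: leq_trans mn.
pose C n k (u : {fset V} -> bool) := all (fun r => ~~ splitb r k u) (iota 0 n).
have detC n k : determined N o (n + k) (C n k).
  move=> u u' h; apply: eq_in_all => r; rewrite mem_iota add0n => /andP[_ rn].
  congr (~~ _); apply: (determined_le _ (@split_determined r k)) h.
  by rewrite leq_add2r.
have mC n k : measurable [set w | C n k (U w)] := (determined_measurable mU (@detC n k)).
have Cle n j k : (j <= k)%N -> [set w | C n j (U w)] `<=` [set w | C n k (U w)].
  move=> jk w /allP hw; apply/allP => r hr; have := hw r hr.
  by apply: contra => /asboolP h; apply/asboolP; apply: split_le h.
have CNN n : \bigcup_k [set w | C n k (U w)] = NN n.
  apply/seteqP; split=> w.
    move=> [k _ /allP hw] r /= rn hA; have := hw r; rewrite mem_iota add0n rn => /(_ isT).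
    by rewrite (hA k I : is_true (splitb _ _ _)).
  move=> hw; suff [k hk] : exists k, forall r, r \in iota 0 n -> ~~ splitb r k (U w).
    by exists k => //; apply/allP.
  have {hw} : forall r, r \in iota 0 n -> exists k, ~~ splitb r k (U w).
    move=> r; rewrite mem_iota add0n => /andP[_ rn]; apply: contrapT => h.
    apply: (hw r rn) => k _; apply: contrapT => /negP hk; apply: h.
    by exists k.
  elim: (iota 0 n) => [|r l IH] hl; first by exists 0.
  have [k hk] := hl r (mem_head _ _).
  have [j hj] := IH (fun q hq => hl q (mem_behead (s := r :: l) hq)).
  have hm q i i' : (i <= i')%N -> ~~ splitb q i (U w) -> ~~ splitb q i' (U w).
    by move=> ii; apply: contra => /asboolP h; apply/asboolP; apply: split_le h.
  exists (maxn k j) => q; rewrite inE => /orP[/eqP->|/hj].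
    by apply: hm hk; rewrite leq_maxl.
  by apply: hm; rewrite leq_maxr.
have Bad0 : pr P Bad = 0.
  apply/eqP; rewrite eq_le pr_ge0 andbT leNgt; apply/negP => b0.
  (* As [delta <= 1], this choice makes [(b - 2 * e) * delta] at least [b * delta / 2], which
     exceeds [e]. *)
  set b := pr P Bad in b0; pose e := b * delta / 4.
  have e0 : 0 < e by rewrite !mulr_gt0.
  have [n hn] : exists n, pr P (NN n) <= b + e.
    have [n hn] := cvg_close (pr_cvg_nonincreasing (P := P) mNN NNle) e0.
    exists n; have := hn n (leqnn n); rewrite distrC => /(le_trans (ler_norm _)).
    by rewrite lerBlDl.
  have [k hk] : exists k, pr P (NN n) - e <= pr P [set w | C n k (U w)].
    have [k hk] := cvg_close (pr_cvg_nondecreasing (P := P) (mC n) (@Cle n)) e0.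
    exists k; have := hk k (leqnn k); rewrite CNN => /(le_trans (ler_norm _)).
    by rewrite !lerBlDl addrC.
  have bN : b <= pr P (NN n) by apply: pr_le => // w hw; apply: hw.
  have [r1 hr1] := eps_small (n + k) e0.
  pose r := maxn (maxn r0 r1) (n + k).
  have hr : (r0 <= r)%N /\ (r1 <= r)%N by rewrite /r !leq_max !leqnn !orbT.
  have hr2 : (n + k <= r)%N by rewrite leq_maxr.
  have hlb j : (b - 2 * e) * delta <= pr P ([set w | C n k (U w)] `&` [set w | splitb r j (U w)]).
    have -> : [set w | C n k (U w)] `&` [set w | splitb r j (U w)] =
        [set w | C n k (U w) && splitb r j (U w)].
      by apply/seteqP; split=> w /andP.
    apply: le_trans (@split_local (C n k) (n + k) r j (@detC n k) hr2).
    have h1 := split_lb j hr.1; have h2 := hr1 r hr.2; have h5 := pr_ge0 P [set w | splitb r j (U w)].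
    have h3 : 0 <= b - 2 * e.
      have : e * 2 <= b; last by lra.
      rewrite /e; have : b * delta <= b by rewrite ler_piMr // ltW.
      lra.
    have h4 : b - 2 * e <= pr P [set w | C n k (U w)] - eps (n + k) r by lra.
    by apply: ler_pM => //; apply: ltW.
  have hcap : (b - 2 * e) * delta <= pr P ([set w | C n k (U w)] `&` A r).
    have hc : pr P ([set w | C n k (U w)] `&` [set w | splitb r j (U w)]) @[j --> \oo] -->
        pr P ([set w | C n k (U w)] `&` A r).
      have -> : [set w | C n k (U w)] `&` A r =
          \bigcap_j ([set w | C n k (U w)] `&` [set w | splitb r j (U w)]).
        apply/seteqP; split=> w; first by move=> [hw hA] j _; split=> //; apply: hA.
        by move=> hw; split=> [|j _]; [have [] := hw 0%N I|have [] := hw j I].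
      apply: pr_cvg_nonincreasing => [j|i j ij w [hw1 hw2]]; first exact: measurableI.
      by split=> //; apply/asboolP; apply: split_le ij _; apply/asboolP.
    by rewrite -(cvg_lim _ hc) //; apply: limr_ge; [apply: cvgP hc|apply: nearW].
  (* [Bad] excludes [A r], so the intersection lies in [NN n] minus [Bad], of probability at most
     [e]. *)
  have hle : pr P ([set w | C n k (U w)] `&` A r) <= e.
    apply: le_trans (_ : pr P (NN n `\` Bad) <= _); last first.
      by rewrite prD // ?lerBlDl //; move=> w hw; apply: hw.
    apply: pr_le; [exact: measurableI|exact: measurableD|].
    move=> w [hw hA]; split; first by rewrite -CNN; exists k.
    by move=> hB; apply: (hB r.+1 I r) => //=.
  have : (b - 2 * e) * delta <= e by apply: le_trans hle.
  have t0 : 0 < b * delta by rewrite mulr_gt0.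
  have t1 : b * delta * delta <= b * delta by rewrite ler_piMr // ltW.
  rewrite /e; lra.
exists Bad; split=> //; first by rewrite -prE // Bad0.
move=> w hw n _ r /= rn hA; apply: hw; apply: (split_more_ends (N := N) (o := o) (r := r)) => k.
by apply/asboolP; apply: hA.
Qed.

End ZeroOne.

Theorem lemma6p1 (R : realType) (V : choiceType) (N : network R V) (o : V)
  (h1 h2 : V -> R)
  (d : measure_display) (Omega : measurableType d) (P : probability Omega R)
  (Y Z : nat -> Omega -> V)
  (d' : measure_display) (Omega' : measurableType d')
  (P' : probability Omega' R) (U : Omega' -> {fset V} -> bool) :
  recurrent N ->
  potential N o h1 -> potential N o h2 ->
  h_process N o h1 P Y -> h_process N o h2 P Z ->
  independent_processes P Y Z ->
  (0 < P [set w | finite_set (visited Y w `&` visited Z w)])%E ->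
  is_ust N P' U ->
  \forall w \ae P', more_than_one_end (edge_rel (U w)).
Proof.
move=> N_rec hp1 hp2 hY hZ hYZ hfin [mU [W [F [hex hcvg]]]].
have mY n v : measurable [set w | Y n w = v] by case: hY.
have mZ n v : measurable [set w | Z n w = v] by case: hZ.
have mM K : measurable (meet_inside Y Z K) by apply: (measurable_meet_inside N o).
have [r0 hr0] := finite_meet_inside N o mY mZ hfin.
set s := pr P (meet_inside Y Z (nball N o r0)).
have s0 : 0 < s by rewrite -lte_fin prE.
have s1 : s <= 1 by apply: pr_le1.
pose sv := surv N (noto o) (fun=> 1 : R).
have WF n : finite_connected_subnetwork N (W n) (F n) by case: hex.
(* With total tree weight 0 the mean of the constant 1 would be 0 / 0 = 0, at distance 1 from its
   limit; so the normalisation is positive for large [n]. *)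
have [n1 hn1] : exists n1, forall n, (n1 <= n)%N -> forall oW : o \in W n,
    0 < Zf (sub_cond N (W := W n) (F n)) [set FSetSub oW]%SET (fun=> 1).
  have hdet : determined N o 0 (fun=> true) by [].
  have := determined_cvg mU hdet hcvg.
  have -> : pr P' [set w | true] = 1.
    by rewrite /pr (_ : [set w | true] = setT) ?probability_setT //; apply/seteqP; split.
  move=> hc; have [|n1 h] := cvg_close (e := 2^-1) hc; first by rewrite invr_gt0.
  exists n1 => n hn oW; have := h n hn; rewrite (mean_Zf (WF n) oW).
  rewrite lt0r Zf_ge0 ?andbT; last by [].
    apply: contraTneq => ->; rewrite invr0 mulr0 subr0 normr1 -ltNge invf_lt1 ?ltr1n //.
  exact: sub_cond_ge0.
have hfull (l : seq V) : exists n0, forall n, (n0 <= n)%N -> forall x, x \in l -> full N (W n) (F n) x.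
  exact: exhaustion_full hex.
pose eps m r := \sum_(v <- nball N o m) sv r v.
have d0 : 0 < s / 8 by rewrite divr_gt0.
(* Half of [s] is given up in [meet_walks], and the rest is divided by the 4 of [mean_split_lb]. *)
apply: (@split_ae _ _ N o _ _ P' U mU (s / 8) r0 eps) => //.
- lra.
- move=> r k rr0.
  have half0 : 0 < 2^-1 :> R by rewrite invr_gt0.
  have [t0 ht0] := sv_cvg0_seq o N_rec (enum_fset (nball N o (r + k).+1)) half0.
  (* The exit measures are taken at radius [r + k], so that they vanish on the ball that the
     branches have to cross. *)
  pose t1 := maxn t0 (r + k).+1.
  have rt : (r + k < t1)%N by rewrite leq_maxr.
  have hsv x : x \in nball N o (r + k).+1 -> sv t1 x <= 2^-1.
    by move=> hx; apply: le_trans (ht0 _ hx); apply: sv_le; rewrite leq_maxl.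
  have e0 : 0 < s / 2 by rewrite divr_gt0.
  have [m1 [m2 [t [[m10 m20] [m1r m2r] [m1s m2s] hJ]]]] :=
    meet_walks N_rec hp1 hp2 hY hZ hYZ rt hsv (mM (nball N o r)) e0.
  have [n2 hn2] := hfull (o :: enum_fset (nball N o t1)).
  have := determined_cvg mU (@split_determined _ _ N o r k) hcvg => hc.
  rewrite -(cvg_lim _ hc) //; apply: limr_ge; first exact: cvgP hc.
  exists (maxn n1 n2) => // n /=; rewrite geq_max => /andP[hn1' hn2'].
  have [oW _] := hn2 n hn2' o (mem_head _ _).
  have hD x : x \in (nball N o t1 `\ o)%fset -> full N (W n) (F n) x.
    rewrite in_fsetD1 => /andP[_ hx]; apply: (hn2 n hn2').
    by rewrite inE; apply/orP; right.
  have oD : o \notin (nball N o t1 `\ o)%fset by rewrite in_fsetD1 eqxx.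
  have := mean_split_lb (WF n) (hn1 n hn1' oW) (r := r) (k := k) t oD hD m10 m20 m1r m2r m1s m2s.
  have : s <= pr P (meet_inside Y Z (nball N o r)).
    by apply: pr_le => //; apply: meet_inside_mono.
  move: hJ; rewrite -prE // lee_fin /split_ind; lra.
- move=> m e e0.
  have hm : 0 < (size (enum_fset (nball N o m))).+1%:R :> R by rewrite ltr0n.
  have [r1 hr1] := sv_cvg0_seq o N_rec (enum_fset (nball N o m)) (divr_gt0 e0 hm).
  exists r1 => r rr; rewrite /eps.
  apply: le_trans (_ : \sum_(v <- nball N o m) e / (size (enum_fset (nball N o m))).+1%:R <= _).
    rewrite big_seq [leRHS]big_seq; apply: ler_sum => v hv.
    by apply: le_trans (hr1 v hv); apply: sv_le.
  rewrite big_const_seq count_predT iter_addr_0 -[leLHS]mulr_natr mulrAC ler_pdivrMr //.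
  by rewrite ler_wpM2l ?(ltW e0) // ler_nat.
move=> C m r k hC mr.
have [n2 hn2] := hfull (o :: enum_fset (nball N o r)).
have hdet := @split_determined _ _ N o r k.
have hCS : determined N o (maxn m (r.+1 + k)) (fun u => C u && `[< split_at N o r k u >]).
  move=> u u' h; congr (_ && _).
    by apply: (determined_le _ hC) h; rewrite leq_maxl.
  by apply: (determined_le _ hdet) h; rewrite leq_maxr.
have c1 := determined_cvg mU hC hcvg.
have c2 := determined_cvg mU hdet hcvg.
have c3 := determined_cvg mU hCS hcvg.
have c4 : (finite_ust_mean N (W n) (F n) (fun u => (C u)%:R) - eps m r) *
    finite_ust_mean N (W n) (F n) (fun u => (`[< split_at N o r k u >])%:R) @[n --> \oo] -->
    (pr P' [set w | C (U w)] - eps m r) * pr P' [set w | `[< split_at N o r k (U w) >]].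
  by apply: cvgM c2; apply: cvgB c1 _; apply: cvg_cst.
rewrite -(cvg_lim _ c3) // -(cvg_lim _ c4) //.
apply: ler_lim; [exact: cvgP c4|exact: cvgP c3|].
exists (maxn n1 n2) => // n /=; rewrite geq_max => /andP[hn1' hn2'].
have [oW _] := hn2 n hn2' o (mem_head _ _).
have hfl x : x \in nball N o r -> x != o -> full N (W n) (F n) x.
  by move=> hx _; apply: (hn2 n hn2'); rewrite inE; apply/orP; right.
have := mean_local (WF n) (hn1 n hn1' oW) k mr hfl hC.
congr (_ <= _); congr (finite_ust_mean _ _ _ _); apply: funext => u.
by rewrite /split_ind -natrM mulnb.
Qed.
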